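(* Let $p,q$ be such that $p^*,q\in[2,\infty)$. Then for every random matrix $(X_{ij})_{i\le m,j\le n}$ with independent centered entries, \begin{align*} \mathbb{E}\|(X_{ij})_{i,j}\|_{p\to q}\lesssim_{p,q}\ &\max_i\Bigl(\sum_j\mathbb{E}|X_{ij}|^{p^*}\Bigr)^{1/p^*}+\max_j\Bigl(\sum_i\mathbb{E}|X_{ij}|^{q}\Bigr)^{1/q}\\ &+\Bigl(\sum_i\Bigl(\sum_j\mathbb{E}|X_{ij}|^{2p^*}\Bigr)^{\frac{p^*\vee q}{p^*}}\Bigr)^{\frac1{2(p^*\vee q)}}+\Bigl(\sum_j\Bigl(\sum_i\mathbb{E}|X_{ij}|^{2q}\Bigr)^{\frac{p^*\vee q}{q}}\Bigr)^{\frac1{2(p^*\vee q)}} \end{align*} and, as a consequence, \begin{align*} \mathbb{E}\|(X_{ij})_{i,j}\|_{p\to q}\lesssim_{p,q}\ &\max_i\Bigl(\sum_j\mathbb{E}|X_{ij}|^{p^*}\Bigr)^{1/p^*}+\max_j\Bigl(\sum_i\mathbb{E}|X_{ij}|^{q}\Bigr)^{1/q}\\ &+\Bigl(\sum_{i,j}\mathbb{E}|X_{ij}|^{2p^*}\Bigr)^{1/(2p^* )}+\Bigl(\sum_{i,j}\mathbb{E}|X_{ij}|^{2q}\Bigr)^{1/(2q)} . \end{align*}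
   Context: For $p\in[1,\infty]$, $p^*$ is the Hölder conjugate: $1/p+1/p^*=1$. $\|M\|_{p\to q}$ is the operator norm of an $m\times n$ matrix from $\ell_p^n$ to $\ell_q^m$; $i$ ranges over $1,\dots,m$ and $j$ over $1,\dots,n$; $x\vee y=\max\{x,y\}$. $f\lesssim_{p,q}g$ means $f\le Cg$ with a constant $C$ depending only on $p,q$ (not on $m,n$ or the distributions of the entries). *)

(* Defs.v *)
From HB Require Import structures.
From mathcomp Require Import all_boot all_order all_algebra.
From mathcomp Require Import all_classical all_reals all_analysis.

Set Implicit Arguments.
Unset Strict Implicit.
Unset Printing Implicit Defensive.

Import Order.TTheory GRing.Theory Num.Theory.
Import numFieldNormedType.Exports.

Local Open Scope classical_set_scope.
Local Open Scope ring_scope.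

(* Meant for p in [1, +oo]; the value at p = -oo is a dummy. *)
Definition lpnorm (R : realType) (p : \bar R) (k : nat) (x : 'cV[R]_k) : R :=
  if p is r%:E then (\sum_(i < k) `|x i 0| `^ r) `^ r^-1
  else \big[Num.max/0]_(i < k) `|x i 0|.

(* The norm of M as an operator from l_p^n to l_q^m. For p, q in [1, +oo] the
   set below is nonempty and bounded, so that the real-valued sup is genuine. *)
Definition opnorm (R : realType) (p q : \bar R) (m n : nat) (M : 'M[R]_(m, n))
    : R :=
  sup [set lpnorm q (M *m x) | x in [set x : 'cV[R]_n | lpnorm p x <= 1]].

Definition mutually_independent (d : measure_display) (T : measurableType d)
    (R : realType) (P : probability T R) (I : finType)
    (X : I -> {RV P >-> R}) : Prop :=
  forall (J : {set I}) (B : I -> set R),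
    (forall i, i \in J -> measurable (B i)) ->
    P (\bigcap_(i in [set` J]) X i @^-1` B i) =
    (\prod_(i in J) P (X i @^-1` B i))%E.

Definition centered (d : measure_display) (T : measurableType d)
    (R : realType) (P : probability T R) (X : {RV P >-> R}) : Prop :=
  P.-integrable setT (EFin \o X) /\ 'E_P[X]%E = 0%E.

(* Main.v *)
Require Import Defs.
From HB Require Import structures.
From mathcomp Require Import all_boot all_order all_algebra.
From mathcomp Require Import all_classical all_reals all_analysis.
From mathcomp Require Import measurable_realfun.
From mathcomp Require Import ring lra zify.

(** The proof of both estimates.

    Write [al] for [pstar], [be] for [q], and [s] for the larger of the two. Both
    estimates follow from

      E ||X|| <= C (max_i (sum_j E |X_ij| ^ al) ^ (1 / al)
                  + max_j (sum_i E |X_ij| ^ be) ^ (1 / be)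
                  + (sum_ij E |X_ij| ^ (2 s)) ^ (1 / (2 s))),

    whose last term is the third or the fourth term of either right-hand side,
    according to which of [al] and [be] is the larger [expectation_opnorm_le].

    Reduction to random signs. The norm is a convex Lipschitz function of the
    entries, so that subgradient inequalities, applied to one entry after the other,
    bound its mean by the mean of the norm of [2 eps_ij X_ij], with independent
    signs [eps] [symmetrization]. For a fixed matrix [a], the mean of the norm of
    [eps_ij a_ij] is at most a constant times the sum of the largest norm of a row in
    [l al], of the largest norm of a column in [l be], and of the norm of all the
    entries in [l (2 s)] [sign_opnorm_bound]. For the matrix [X] the row
    and column sums are themselves random, and exceed a multiple of their means by
    no more than the last term [sum_excess_le].

    The fixed matrix. By duality the norm is the supremum of the forms
    [sum_ij eps_ij a_ij x_j y_i] over two unit balls. Coordinates are sorted by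
    size, the level of a coordinate being the logarithm of its rank: at most
    [2 ^ k.+1] coordinates have level at most [k]. Entries below [8 ^- k] are
    negligible against the number of cells at levels up to [k], and the norm in
    [l (2 s)] leaves only [2 ^ (D * k)] rows and columns with larger entries. A set
    of [2 ^ k] rows or columns of level [k] is thus described by about [k * 2 ^ k]
    bits, and a union bound over descriptions [sup_rademacher] controls all the
    forms by one random variable. The factor [k] is one too many, and it is removed
    in three ways.

    - If the levels [l] of the row and [k] of the column satisfy
      [k * 2 ^ l <= C * 2 ^ k], then the rows cost only [2 ^ k] bits, and once they
      are chosen the columns can be described relatively to the weight that the rows
      give them [unbalanced_bound].
    - Other levels are comparable. Unless [al = be = 2], the variance of the form
      then decays exponentially in the level, and pays for the crude description
      [balanced_bound]; both cases are put together in [half_bound].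
    - If [al = be = 2], levels that are not within a bounded factor of each other are
      still unbalanced. At comparable levels of order [2 ^ t] only a matrix of
      dimension exponential in [2 ^ t] with exponentially small entries counts. The
      method of moments applies: integration by parts over the signs gives for the
      closed walks the recursion of the Catalan numbers up to small errors
      [loop_recursion], so that the moments of order [2 ^ t] grow geometrically
      [avg_loop_le] and the norm is bounded [near_diagonal_bound]. *)

Set Implicit Arguments.
Unset Strict Implicit.
Unset Printing Implicit Defensive.

Import Order.TTheory GRing.Theory Num.Theory.
Import numFieldNormedType.Exports.

Local Open Scope ring_scope.

(* inside this module the notations for sets are those of finite sets *)
Module FiniteDimensional.
Import mathcomp.boot.fintype mathcomp.boot.finset.

(** * Rademacher averages *)

Section Signs.
Context {R : realType}.

(** The expectation of [f] under independent uniform signs, [w s] telling whether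
    the sign of [s] is negative. *)
Definition avg (S : finType) (f : {ffun S -> bool} -> R) : R :=
  (\sum_w f w) / (2 ^+ #|S|).

Definition sg (S : finType) (w : {ffun S -> bool}) (s : S) : R := (-1) ^+ w s.

Lemma avg_ge0 (S : finType) (f : {ffun S -> bool} -> R) :
  (forall w, 0 <= f w) -> 0 <= avg f.
Proof. by move=> f0; rewrite /avg divr_ge0 ?exprn_ge0 ?sumr_ge0. Qed.

Lemma avg_le (S : finType) (f g : {ffun S -> bool} -> R) :
  (forall w, f w <= g w) -> avg f <= avg g.
Proof.
move=> fg; rewrite /avg ler_pM2r ?invr_gt0 ?exprn_gt0//.
by apply: ler_sum => w _; exact: fg.
Qed.

Lemma eq_avg (S : finType) (f g : {ffun S -> bool} -> R) :
  (forall w, f w = g w) -> avg f = avg g.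
Proof. by move=> fg; rewrite /avg (eq_bigr g). Qed.

Lemma avgD (S : finType) (f g : {ffun S -> bool} -> R) :
  avg (fun w => f w + g w) = avg f + avg g.
Proof. by rewrite /avg big_split mulrDl. Qed.

Lemma avgZ (S : finType) c (f : {ffun S -> bool} -> R) :
  avg (fun w => c * f w) = c * avg f.
Proof. by rewrite /avg -mulr_sumr mulrA. Qed.

Lemma avg_cst (S : finType) c : avg (fun _ : {ffun S -> bool} => c) = c.
Proof.
rewrite /avg sumr_const card_ffun card_bool -[c *+ _]mulr_natr natrX mulfK//.
Qed.

Lemma avg_sum (S I : finType) (P : pred I) (f : I -> {ffun S -> bool} -> R) :
  avg (fun w => \sum_(i | P i) f i w) = \sum_(i | P i) avg (f i).
Proof. by rewrite /avg exchange_big mulr_suml. Qed.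

Lemma avg_prod (S : finType) (f : S -> bool -> R) :
  avg (fun w => \prod_s f s (w s)) = \prod_s ((f s true + f s false) / 2).
Proof.
rewrite /avg -(bigA_distr_bigA f) -prodr_const -prodf_div.
by apply: eq_bigr => s _; rewrite big_bool.
Qed.

(** Independent signs may be multiplied by fixed ones. *)
Lemma avg_flip (S : finType) (v : {ffun S -> bool}) (f : {ffun S -> bool} -> R) :
  avg (fun w => f [ffun s => v s (+) w s]) = avg f.
Proof.
rewrite /avg; congr (_ / _).
rewrite [RHS](reindex_inj (h := fun w : {ffun S -> bool} => [ffun s => v s (+) w s]))//.
move=> w1 w2 /ffunP h; apply/ffunP => s; move: (h s); rewrite !ffunE.
by case: (v s); case: (w1 s); case: (w2 s).
Qed.

Lemma sg_sqr (S : finType) (w : {ffun S -> bool}) s : sg w s * sg w s = 1.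
Proof. by rewrite /sg -expr2 sqrr_sign. Qed.

Lemma normr_sg1 (S : finType) (w : {ffun S -> bool}) s : `|sg w s| = 1.
Proof. by rewrite /sg normr_sign. Qed.

Lemma cosh_le (x : R) : (expR x + expR (- x)) / 2 <= expR (2 * x ^+ 2).
Proof.
wlog x0 : x / 0 <= x.
  move=> h; case: (leP 0 x) => [/h//|x0].
  by have := h (- x); rewrite opprK sqrrN addrC; apply; lra.
case: (leP x (2^-1)) => [x2|x2].
  have e1 : expR x <= 1 + x + 2 * x ^+ 2.
    rewrite -[expR x]invrK -expRN -[leLHS]mul1r ler_pdivrMr ?expR_gt0//.
    have := expR_ge1Dx (- x); nra.
  have e2 : expR (- x) <= 1 - x + x ^+ 2.
    rewrite expRN -[leLHS]mul1r ler_pdivrMr ?expR_gt0//.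
    have := expR_ge1Dx x; nra.
  by apply: (@le_trans _ _ (1 + 2 * x ^+ 2)); [nra|exact: expR_ge1Dx].
apply: (@le_trans _ _ (expR x)).
  have : expR (- x) <= expR x by rewrite ler_expR; lra.
  lra.
by rewrite ler_expR; nra.
Qed.

(** Rademacher sums are sub-Gaussian. *)
Lemma avg_expR_le (S : finType) (c : S -> R) :
  avg (fun w => expR (\sum_s c s * sg w s)) <= expR (2 * \sum_s c s ^+ 2).
Proof.
under eq_avg => w do rewrite expR_sum.
rewrite (avg_prod (fun s b => expR (c s * (-1) ^+ b))) mulr_sumr expR_sum.
apply: ler_prod => s _; apply/andP; split.
  by rewrite divr_ge0// addr_ge0// expR_ge0.
by rewrite expr1 expr0 mulr1 mulrN1 addrC; exact: cosh_le.
Qed.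

(** A union bound performed on exponential moments: the moments, weighted by
    [expR (- H f)], are added into a single variable, which then controls each sum
    at the scale dictated by its own entropy [H f]. *)
Lemma sup_rademacher (S F : finType) (P : pred F) (c : F -> S -> R) (H : F -> R)
    (K : R) :
  (forall f, P f -> 1 <= H f) -> \sum_(f | P f) expR (- H f) <= K ->
  exists N : {ffun S -> bool} -> R,
    [/\ forall w, 0 <= N w, avg N <= 3 + K &
        forall w f (s : R), P f -> \sum_x c f x ^+ 2 <= s ^+ 2 -> 0 <= s ->
          \sum_x c f x * sg w x <= N w * Num.sqrt (H f) * s].
Proof.
move=> H1 HK.
pose sig f := Num.sqrt (\sum_x c f x ^+ 2).
(* optimizes the exponential moment at the scale [Num.sqrt (H f) * sig f] *)
pose lam f := Num.sqrt (H f) / sig f.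
pose M w := \sum_(f | P f) expR (- H f) * expR (lam f * (\sum_x c f x * sg w x) - 2 * H f).
have sq0 f : 0 <= \sum_x c f x ^+ 2 by apply: sumr_ge0 => x _; exact: sqr_ge0.
have M0 w : 0 <= M w by apply: sumr_ge0 => f _; rewrite mulr_ge0// expR_ge0.
exists (fun w => 3 + M w); split.
- by move=> w; rewrite addr_ge0.
- rewrite avgD avg_cst lerD2l avg_sum; apply: le_trans HK.
  apply: ler_sum => f Pf; rewrite avgZ ler_piMr ?expR_ge0//.
  under eq_avg => w do rewrite expRD mulrC mulr_sumr.
  rewrite avgZ.
  under eq_avg => w.
    under [X in expR X]eq_bigr => x _ do rewrite mulrA.
    over.
  have := avg_expR_le (fun x => lam f * c f x).
  have -> : \sum_s (lam f * c f s) ^+ 2 = lam f ^+ 2 * \sum_x c f x ^+ 2.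
    by rewrite mulr_sumr; apply: eq_bigr => x _; rewrite exprMn.
  move=> h; rewrite expRN mulrC ler_pdivrMr ?expR_gt0// mul1r.
  apply: (le_trans h); rewrite ler_expR ler_pM2l//.
  have [s0|s0] := eqVneq (sig f) 0.
    by rewrite /lam s0 invr0 mulr0 expr0n/= mul0r (le_trans _ (H1 f Pf)).
  rewrite -(sqr_sqrtr (sq0 f)) -/(sig f) /lam -exprMn divfK//.
  by rewrite sqr_sqrtr// (le_trans _ (H1 f Pf)).
- move=> w f s Pf cs s0; have H0 := H1 f Pf.
  have hsq : 0 < Num.sqrt (H f) by rewrite sqrtr_gt0; lra.
  have hsq1 : Num.sqrt (H f) ^+ 2 = H f by rewrite sqr_sqrtr//; lra.
  have hs1 : 1 <= Num.sqrt (H f) by rewrite -sqrtr1 ler_sqrt//; lra.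
  have sigs : sig f <= s by rewrite -[leRHS](ger0_norm s0) -sqrtr_sqr ler_wsqrtr.
  have [sf0|sf0] := eqVneq (sig f) 0.
    have z : \sum_x c f x ^+ 2 = 0.
      by apply/eqP; rewrite eq_le sq0 andbT -sqrtr_eq0 -/(sig f) sf0.
    have cz x : c f x = 0.
      apply/eqP; rewrite -sqrf_eq0; apply/eqP.
      by apply: (psumr_eq0P _ z) => // y _; exact: sqr_ge0.
    rewrite big1 ?mulr_ge0 ?addr_ge0 ?sqrtr_ge0// => x _.
    by rewrite cz mul0r.
  have sfp : 0 < sig f by rewrite lt_neqAle eq_sym sf0 sqrtr_ge0.
  apply: (@le_trans _ _ ((3 + M w) * Num.sqrt (H f) * sig f)); last first.
    by rewrite ler_wpM2l// mulr_ge0// ?addr_ge0// ltW.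
  set th := \sum_x _.
  have : expR (lam f * th - 3 * H f) <= M w.
    rewrite /M (bigD1 f)//= -/th -expRD.
    apply: (@le_trans _ _ (expR (- H f + (lam f * th - 2 * H f)))).
      by rewrite ler_expR; lra.
    by rewrite lerDl; apply: sumr_ge0 => g _; rewrite mulr_ge0// expR_ge0.
  move=> /(le_trans (expR_ge1Dx _)) h.
  have : lam f * th <= 3 * H f + M w by lra.
  rewrite /lam mulrAC ler_pdivrMr// -[X in 3 * X]hsq1 => h2.
  rewrite -(ler_pM2l hsq) (le_trans h2)// [leRHS]mulrA ler_pM2r//.
  by rewrite [leRHS]mulrCA -expr2 hsq1 [leRHS]mulrDl lerD2l ler_peMr.
Qed.

End Signs.

(** * Levels of a finite family and decreasing rearrangement *)

Section Levels.
Context {R : realType} (J : finType).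
Implicit Types g : J -> R.

Definition rank_above g j := #|[pred j' | g j <= g j']|.

(** The dyadic logarithm of the rank of [g j] in decreasing order. It groups the
    coordinates into blocks of size comparable to [2 ^ k], which is what entropy
    sees, rather than by magnitude. *)
Definition level g j := trunc_log 2 (rank_above g j).

(** The [2 ^ t]-th largest value of [g]. *)
Definition rearr g t : R :=
  \big[Num.max/0]_(j | (2 ^ t <= rank_above g j)%N) g j.

Lemma rank_above_gt0 g j : (0 < rank_above g j)%N.
Proof. by rewrite /rank_above; apply/card_gt0P; exists j; rewrite inE. Qed.

Lemma level_rank g j : (2 ^ level g j <= rank_above g j)%N.
Proof. exact: trunc_logP (rank_above_gt0 g j). Qed.

Lemma level_lt g j : (level g j < #|J|.+1)%N.
Proof.
rewrite ltnS (leq_trans (ltnW (ltn_expl (level g j) (isT : 1 < 2)%N)))//.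
by rewrite (leq_trans (level_rank g j))// max_card.
Qed.

(** All coordinates of level at most [t] are at least as large as the smallest of
    them, whose rank is below [2 ^ t.+1]. *)
Lemma card_level_le g t : (#|[set j | (level g j <= t)%N]| <= 2 ^ t.+1)%N.
Proof.
case: (pickP [pred j | (level g j <= t)%N]) => [j0 j0t|h]; last first.
  by rewrite (_ : [set j | _] = set0) ?cards0//; apply/setP => j; rewrite !inE; exact: h.
pose j1 := [arg min_(j < j0 | (level g j <= t)%N) g j]%O.
have [j1t j1min] : (level g j1 <= t)%N /\ forall j, (level g j <= t)%N -> g j1 <= g j.
  by rewrite /j1; case: arg_minP.
apply: (@leq_trans (rank_above g j1)).
  by apply: subset_leq_card; apply/subsetP => j; rewrite !inE; exact: j1min.
rewrite ltnW// (leq_trans (trunc_log_ltn (rank_above g j1) (isT : 1 < 2)%N))//.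
by rewrite leq_exp2l.
Qed.

Lemma rearr_ge0 g t : 0 <= rearr g t.
Proof. exact: bigmax_ge_id. Qed.

Lemma le_rearr g j t : (2 ^ t <= rank_above g j)%N -> g j <= rearr g t.
Proof. by move=> h; rewrite /rearr; exact: le_bigmax_cond. Qed.

Lemma le_rearr_level g j : g j <= rearr g (level g j).
Proof. exact: le_rearr (level_rank g j). Qed.

Lemma le_rearr_card g t z : (2 ^ t <= #|[pred j | (z <= g j)%R]|)%N -> z <= rearr g t.
Proof.
move=> h.
have /card_gt0P[j0 j0z] : (0 < #|[pred j | (z <= g j)%R]|)%N.
  by rewrite (leq_trans _ h)// expn_gt0.
pose j1 := [arg min_(j < j0 | z <= g j) g j]%O.
have [j1z j1min] : z <= g j1 /\ forall j, z <= g j -> g j1 <= g j.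
  by rewrite /j1; case: arg_minP.
apply: (le_trans j1z); apply: le_rearr; apply: (leq_trans h).
by apply: subset_leq_card; apply/subsetP => j; rewrite !inE; exact: j1min.
Qed.

Lemma rearr_attained g t : 0 < rearr g t ->
  exists2 j, (2 ^ t <= rank_above g j)%N & g j = rearr g t.
Proof.
move=> h; have [//|hn] := pselect (exists2 j, (2 ^ t <= rank_above g j)%N & g j = rearr g t).
exfalso; move: h; rewrite ltNge => /negP; apply.
rewrite leNgt; apply/negP => h; apply: hn.
have : rearr g t = 0 \/ exists2 j, (2 ^ t <= rank_above g j)%N & g j = rearr g t.
  rewrite /rearr; elim/big_ind: _ => [|x y [->|[j ? <-]] [->|[j' ? <-]]|j hj].
  - by left.
  - by left; rewrite maxxx.
  - by case: (leP 0 (g j')) => _; [right; exists j'|left].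
  - by case: (leP (g j) 0) => _; [left|right; exists j].
  - by case: (leP (g j) (g j')) => _; right; [exists j'|exists j].
  - by right; exists j.
by case => // r0; rewrite r0 ltxx in h.
Qed.

Lemma rearr_antitone g t u : (t <= u)%N -> rearr g u <= rearr g t.
Proof.
move=> tu; apply: bigmax_le => [|j hj]; first exact: rearr_ge0.
by apply: le_rearr; rewrite (leq_trans _ hj)// leq_exp2l.
Qed.

Lemma subset_of_card (A : {set J}) n : (n <= #|A|)%N ->
  exists2 B : {set J}, B \subset A & #|B| = n.
Proof.
move=> nA; exists [set x in take n (enum A)].
  by apply/subsetP => x; rewrite inE => /mem_take; rewrite mem_enum.
by rewrite cardsE (card_uniqP _) ?take_uniq ?enum_uniq// size_takel -?cardE.
Qed.

(** Cauchy condensation: each value [rearr g t] is charged to about [2 ^ t] values of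
    [g] that are at least as large. *)
Lemma sum_rearr g T : (forall j, 0 <= g j) ->
  \sum_(t < T) 2 ^+ t * rearr g t <= 2 * \sum_j g j.
Proof.
move=> g0.
have main t : 0 < rearr g t -> exists2 B : {set J}, #|B| = (2 ^ t)%N &
    \sum_(u < t.+1) 2 ^+ u * rearr g u <= 2 * \sum_(j in B) g j.
  elim: t => [|t ih] h.
    have [j jt gj] := rearr_attained h.
    exists [set j]; first by rewrite cards1.
    by rewrite big_ord1 big_set1 gj expr0 ler_wpM2r ?rearr_ge0// ler1n.
  have [|B cB hB] := ih; first by rewrite (lt_le_trans h)// rearr_antitone.
  have [j jt gj] := rearr_attained h.
  have [|D DA cD] := @subset_of_card ([set j' | g j <= g j'] :\: B) (2 ^ t).
    rewrite cardsD; apply: (@leq_trans (2 ^ t.+1 - #|B|)).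
      by rewrite cB expnS mul2n -addnn addnK.
    apply: leq_sub; first by rewrite cardsE.
    by rewrite subset_leq_card// subsetIr.
  have dBD : [disjoint B & D].
    rewrite disjoint_sym disjoints_subset (subset_trans DA)//.
    by rewrite setDE subsetIr.
  exists (B :|: D).
    rewrite cardsU disjoint_setI0// cards0 subn0 cB cD expnS mul2n addnn//.
  rewrite big_ord_recr/= [in leRHS](eq_bigl [predU B & D]); last first.
    by move=> x; rewrite !inE.
  rewrite bigU//= mulrDr lerD// exprS -mulrA ler_pM2l//.
  have -> : 2 ^+ t * rearr g t.+1 = \sum_(j' in D) rearr g t.+1.
    by rewrite sumr_const cD -[RHS]mulr_natl natrX.
  apply: ler_sum => j' /(subsetP DA); rewrite !inE => /andP[_].
  by rewrite gj.
elim: T => [|T ih]; first by rewrite big_ord0 mulr_ge0// sumr_ge0.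
have := rearr_ge0 g T; rewrite le_eqVlt => /predU1P[r0|/main[B _ hB]].
  by rewrite big_ord_recr/= -r0 mulr0 addr0.
apply: (le_trans hB); rewrite ler_pM2l//.
rewrite [leRHS](bigID (mem B))/= lerDl; apply: sumr_ge0 => j _; exact: g0.
Qed.

Lemma sum_over_levels (I : finType) (l : I -> nat) g (U : nat -> nat -> bool) (t : I -> J -> R) :
  \sum_i \sum_j (U (l i) (level g j))%:R * t i j =
  \sum_(k < #|J|.+1) \sum_(i in [set i | U (l i) k]) \sum_(j in [set j | level g j == k]) t i j.
Proof.
under [RHS]eq_bigr do rewrite big_mkcond/=.
rewrite [RHS]exchange_big/=; apply: eq_bigr => i _.
rewrite (partition_big (fun j => inord (level g j) : 'I_(#|J|.+1)) xpredT)//=.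
apply: eq_bigr => k _; rewrite inE.
have kE j : ((inord (level g j) : 'I_(#|J|.+1)) == k) = (level g j == k).
  by rewrite -val_eqE/= inordK// level_lt.
rewrite (eq_bigl (fun j => j \in [set j | level g j == k])); last by move=> j; rewrite inE kE.
case: ifPn => Uk.
  by apply: eq_bigr => j; rewrite inE => /eqP ->; rewrite Uk mul1r.
by apply: big1 => j; rewrite inE => /eqP ->; rewrite (negbTE Uk) mul0r.
Qed.

End Levels.

(** Chernoff's method: with weight [expR (- h)] for each label, the weights of the
    labellings add up to a product over [S], and none of those that are counted
    weighs less than [expR (- h * n)]. *)
Lemma card_labelling_le {R : realType} (A T : finType) (S : {set A}) (Q : {set T})
    (n : nat) (h : R) :
  0 <= h ->
  #|[set g : {ffun A -> option T} |
      [forall x, if g x is Some t then (x \in S) && (t \in Q) else true]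
      && (#|[set x | g x != None]| <= n)%N]|%:R
  <= expR (h * n%:R + #|Q|%:R * #|S|%:R * expR (- h)).
Proof.
move=> h0; set G := [set g | _].
pose wt (x : A) (o : option T) : R :=
  if o is Some t then (if (x \in S) && (t \in Q) then expR (- h) else 0) else 1.
have wt0 x o : 0 <= wt x o.
  by rewrite /wt; case: o => [t|//]; case: ifP => // _; exact: expR_ge0.
have tot : \sum_(g : {ffun A -> option T}) \prod_x wt x (g x) <=
    expR (#|Q|%:R * #|S|%:R * expR (- h)).
  rewrite -(bigA_distr_bigA wt).
  have -> : \prod_x \sum_o wt x o = \prod_(x in S) (1 + #|Q|%:R * expR (- h)).
    rewrite [RHS]big_mkcond; apply: eq_bigr => x _.
    rewrite (bigD1 None)//=.
    rewrite (reindex_omap Some id)//=; last by case.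
    rewrite (eq_bigl xpredT); last by move=> t; rewrite eqxx.
    case: ifP => xS; last by rewrite big1 ?addr0.
    rewrite -big_mkcond/= sumr_const mulr_natl.
    by congr (1 + _ *+ _); apply: eq_card => t; rewrite inE.
  rewrite prodr_const mulrAC expRM_natr.
  rewrite lerXn2r ?nnegrE ?expR_ge0 ?expR_ge1Dx//.
have low g : g \in G -> expR (- (h * n%:R)) <= \prod_x wt x (g x).
  rewrite inE => /andP[/forallP gS gn].
  have -> : \prod_x wt x (g x) = \prod_(x in [set x | g x != None]) expR (- h).
    rewrite [RHS]big_mkcond; apply: eq_bigr => x _; rewrite inE /wt.
    by have := gS x; case: (g x) => [t|] //= ->.
  rewrite prodr_const -expRM_natl ler_expR mulrN lerN2 mulrC ler_wpM2l//.
  by rewrite ler_nat.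
have : #|G|%:R * expR (- (h * n%:R)) <= expR (#|Q|%:R * #|S|%:R * expR (- h)).
  apply: le_trans tot; rewrite mulr_natl -sumr_const.
  rewrite [leRHS](bigID (mem G))/= -[leLHS]addr0 lerD//.
    by apply: ler_sum => g gG; exact: low.
  by apply: sumr_ge0 => g _; apply: prodr_ge0 => x _.
by rewrite expRN ler_pdivrMr ?expR_gt0// -expRD addrC.
Qed.

(** * Suprema of signed forms over described blocks *)

Section Atoms.
Context {R : realType}.

Lemma expR_ge_expn n : 2 ^+ n <= expR n%:R :> R.
Proof.
rewrite -[n%:R]mulr1 expRM_natl; apply: lerXn2r; rewrite ?nnegrE ?expR_ge0//.
exact: expR_ge1Dx.
Qed.

Lemma expRN_le_expn n : expR (- n%:R) <= (2^-1) ^+ n :> R.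
Proof. by rewrite expRN exprVn lef_pV2 ?posrE ?expR_gt0 ?exprn_gt0// expR_ge_expn. Qed.

Lemma sum_geometric_half n : \sum_(k < n) (2^-1) ^+ k <= 2 :> R.
Proof.
suff -> : \sum_(k < n) (2^-1) ^+ k = 2 - 2 * (2^-1) ^+ n :> R.
  by rewrite gerBl mulr_ge0// exprn_ge0.
elim: n => [|n ih]; first by rewrite big_ord0 expr0; ring.
by rewrite big_ord_recr/= ih exprS; field.
Qed.

Context (I J : finType) (a : I -> J -> R) (K D : nat).
Context (SI : nat -> {set I}) (n1 n2 : nat -> nat).
Context (cand : nat -> nat -> (I -> R) -> {set J}).
Context (m : nat -> nat -> nat) (h2 H : nat -> nat -> R).
Hypothesis card_SI : forall k, (#|SI k| <= 2 ^ (D * k))%N.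
Hypothesis card_cand : forall k r rho, (#|cand k r rho| <= 2 ^ m k r)%N.
Hypothesis h2_ge0 : forall k r, 0 <= h2 k r.
Hypothesis H_big : forall k r,
  ((D + 4) * k.+1 * n1 k)%:R + h2 k r * (n2 k)%:R
    + (2 ^ (m k r).+1)%:R * expR (- h2 k r) + (k + r)%:R + 1 <= H k r.

Let T := ('I_(3 * K).+1 * bool)%type.
Let row := {ffun I -> option T}.
Let col := {ffun J -> option bool}.

(* a row label holds an exponent and a sign, a column label holds a sign *)
Let rowc (g : row) i : R :=
  if g i is Some (s, b) then (-1) ^+ b * (2^-1) ^+ s else 0.
Let colc (h : col) j : R := if h j is Some b then (-1) ^+ b else 0.

Let okrow k (g : row) :=
  [forall x, if g x is Some t then (x \in SI k) && (t \in [set t : T | (t.1 <= 3 * k)%N])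
             else true] && (#|[set x | g x != None]| <= n1 k)%N.
Let okcol k r (g : row) (h : col) :=
  [forall x, if h x is Some t then
      (x \in cand k r (fun i => rowc g i ^+ 2)) && (t \in [set: bool]) else true]
  && (#|[set x | h x != None]| <= n2 k)%N.
Let valid (f : 'I_K * 'I_K * row * col) :=
  okrow f.1.1.1 f.1.2 && okcol f.1.1.1 f.1.1.2 f.1.2 f.2.

Let count_row (k : 'I_K) : #|[set g | okrow k g]|%:R <= expR (((D + 4) * k.+1 * n1 k)%:R + 1) :> R.
Proof.
have h0 : 0 <= ((D + 4) * k.+1)%:R :> R by [].
apply: le_trans (card_labelling_le _ _ _ h0) _.
rewrite ler_expR -natrM lerD2l.
apply: (@le_trans _ _ ((2 ^ ((D + 4) * k.+1))%:R * expR (- ((D + 4) * k.+1)%:R))).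
  rewrite ler_wpM2r ?expR_ge0// -natrM ler_nat.
  have cQ : (#|[set t : T | (t.1 <= 3 * k)%N]| <= (3 * k).+1 * 2)%N.
    have inj : injective (fun t : T => (t.1 : nat, t.2)).
      by move=> [s b] [s' b']/= [/val_inj -> ->].
    have -> : ((3 * k).+1 * 2 = #|{: 'I_(3 * k).+1 * bool}|)%N.
      by rewrite card_prod card_ord card_bool.
    pose F (t : T) : 'I_(3 * k).+1 * bool := (inord t.1, t.2).
    rewrite -(@card_in_imset _ _ F [set t : T | (t.1 <= 3 * k)%N]); first exact: max_card.
    move=> [s b] [s' b']; rewrite !inE /F/= => sk s'k [/(congr1 val)/=].
    by rewrite !inordK// => /val_inj -> ->.
  apply: leq_trans (leq_mul cQ (card_SI k)) _.
  have -> : ((D + 4) * k.+1 = (3 * k).+1 + 1 + D * k + (D + k + 2))%N by lia.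
  rewrite !expnD expn1 (leq_trans _ (leq_pmulr _ _))// ?expn_gt0// ?muln_gt0 ?expn_gt0//.
  by rewrite leq_mul2r orbC leq_mul2r/= ltnW// ltn_expl.
by rewrite expRN ler_pdivrMr ?expR_gt0// mul1r natrX expR_ge_expn.
Qed.

Let count_col (k r : 'I_K) g : #|[set h | okcol k r g h]|%:R <=
  expR (h2 k r * (n2 k)%:R + (2 ^ (m k r).+1)%:R * expR (- h2 k r)) :> R.
Proof.
apply: le_trans (card_labelling_le _ _ _ (h2_ge0 k r)) _.
rewrite ler_expR lerD2l ler_wpM2r ?expR_ge0// -natrM ler_nat cardsT card_bool.
by rewrite expnS leq_mul2l/= card_cand.
Qed.

Let entropy : \sum_(f | valid f) expR (- H f.1.1.1 f.1.1.2) <= 4.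
Proof.
rewrite -(pair_big_dep (fun p : 'I_K * 'I_K * row => okrow p.1.1 p.2)
  (fun p (h : col) => okcol p.1.1 p.1.2 p.2 h) (fun p _ => expR (- H p.1.1 p.1.2)))/=.
rewrite -(pair_big_dep xpredT (fun (q : 'I_K * 'I_K) (g : row) => okrow q.1 g)
  (fun q g => \sum_(h | okcol q.1 q.2 g h) expR (- H q.1 q.2)))/=.
rewrite -(pair_bigA _ (fun k r : 'I_K => \sum_(g | okrow k g)
  \sum_(h | okcol k r g h) expR (- H k r)))/=.
apply: (@le_trans _ _ (\sum_(k < K) \sum_(r < K) (2^-1) ^+ k * (2^-1) ^+ r)); last first.
  have -> : \sum_(k < K) \sum_(r < K) (2^-1) ^+ k * (2^-1) ^+ r =
    (\sum_(k < K) (2^-1) ^+ k) * (\sum_(k < K) (2^-1) ^+ k) :> R.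
    by rewrite mulr_suml; apply: eq_bigr => k _; rewrite mulr_sumr.
  have s0 : 0 <= \sum_(k < K) (2^-1) ^+ k :> R.
    by apply: sumr_ge0 => k _; rewrite exprn_ge0.
  have := sum_geometric_half K; nra.
apply: ler_sum => k _; apply: ler_sum => r _.
set E := expR (h2 k r * (n2 k)%:R + (2 ^ (m k r).+1)%:R * expR (- h2 k r)).
apply: (@le_trans _ _ (\sum_(g | okrow k g) E * expR (- H k r))).
  apply: ler_sum => g _; rewrite sumr_const -[leLHS]mulr_natl ler_wpM2r ?expR_ge0//.
  by apply: le_trans (count_col k r g); rewrite cardsE.
rewrite sumr_const -[leLHS]mulr_natl.
apply: (@le_trans _ _ (expR (((D + 4) * k.+1 * n1 k)%:R + 1) * (E * expR (- H k r)))).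
  rewrite ler_wpM2r ?mulr_ge0 ?expR_ge0//.
  by apply: le_trans (count_row k); rewrite cardsE.
rewrite -!expRD -exprD; apply: le_trans (expRN_le_expn _).
rewrite ler_expR; have := H_big k r; lra.
Qed.

(** When [y i] is of size [2 ^- e i] and [x j] at most [X], the form over a block
    is largest for coefficients equal to these bounds, with suitable signs. Only the
    supports, the exponents and the signs have to be named: [n1 k] rows of [SI k],
    then [n2 k] columns among candidates that may depend on the sizes chosen for
    the rows. One variable controls all these forms, with a mean that depends
    neither on [I] nor on [J]. *)
Lemma sup_block_forms : exists N : {ffun I * J -> bool} -> R,
  [/\ forall w, 0 <= N w, avg N <= 7 &
   forall w k r (I0 : {set I}) (e : I -> nat) (J0 : {set J}) (x : J -> R) (y : I -> R)
     (X s : R),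
   (k < K)%N -> (r < K)%N -> I0 \subset SI k -> (#|I0| <= n1 k)%N ->
   {in I0, forall i, (e i <= 3 * k)%N} -> {in I0, forall i, `|y i| <= (2^-1) ^+ e i} ->
   J0 \subset cand k r (fun i => if i \in I0 then ((2^-1) ^+ e i) ^+ 2 else 0) ->
   (#|J0| <= n2 k)%N -> {in J0, forall j, `|x j| <= X} ->
   \sum_(i in I0) \sum_(j in J0) ((2^-1) ^+ e i) ^+ 2 * a i j ^+ 2 <= s ^+ 2 ->
   0 <= X -> 0 <= s ->
   \sum_(i in I0) \sum_(j in J0) a i j * sg w (i, j) * x j * y i <=
     X * (N w * Num.sqrt (H k r) * s)].
Proof.
pose c (f : 'I_K * 'I_K * row * col) (p : I * J) := rowc f.1.2 p.1 * colc f.2 p.2 * a p.1 p.2.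
have [|N [N0 Na Nb]] := @sup_rademacher R _ _ valid c (fun f => H f.1.1.1 f.1.1.2) 4 _ entropy.
  move=> f _; apply: le_trans (H_big _ _); rewrite lerDr.
  by rewrite !addr_ge0// mulr_ge0// expR_ge0.
exists N; split => //; first by rewrite (le_trans Na)//; lra.
move=> w k r I0 e J0 x y X s kK rK I0S I0n e3 ye J0c J0n xX ss X0 s0.
(* [W] and [Z] carry the signs that make the form largest, first in [x], then in
   [y] *)
pose W j := \sum_(i in I0) a i j * sg w (i, j) * y i.
pose Z i := \sum_(j in J0) (-1) ^+ (W j < 0)%R * (a i j * sg w (i, j)).
pose g : row := [ffun i => if i \in I0 then Some (inord (e i), (Z i < 0)%R) else None].
pose h : col := [ffun j => if j \in J0 then Some (W j < 0)%R else None].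
pose f := (Ordinal kK, Ordinal rK, g, h).
have eK i : i \in I0 -> (inord (e i) : 'I_(3 * K).+1) = e i :> nat.
  by move=> iI; rewrite inordK// ltnS (leq_trans (e3 i iI))// leq_mul2l/= ltnW.
have rgE i : rowc g i = if i \in I0 then (-1) ^+ (Z i < 0)%R * (2^-1) ^+ e i else 0.
  by rewrite /rowc ffunE; case: ifPn => // iI; rewrite eK.
have rg2 : (fun i => rowc g i ^+ 2) = fun i => if i \in I0 then ((2^-1) ^+ e i) ^+ 2 else 0.
  apply/funext => i; rewrite rgE; case: ifP => // _; last by rewrite expr0n.
  by rewrite exprMn sqrr_sign mul1r.
have chE j : colc h j = if j \in J0 then (-1) ^+ (W j < 0)%R else 0.
  by rewrite /colc ffunE; case: ifPn.
have vf : valid f.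
  apply/andP; split; apply/andP; split => /=.
  - apply/forallP => i; rewrite ffunE; case: ifPn => // iI.
    by rewrite (subsetP I0S)//= inE/= eK// e3.
  - apply: leq_trans I0n; apply: subset_leq_card; apply/subsetP => i.
    by rewrite inE ffunE; case: ifP.
  - apply/forallP => j; rewrite ffunE; case: ifPn => // jJ.
    by rewrite rg2 (subsetP J0c)//= inE.
  - apply: leq_trans J0n; apply: subset_leq_card; apply/subsetP => j.
    by rewrite inE ffunE; case: ifP.
have cE : \sum_p c f p ^+ 2 = \sum_(i in I0) \sum_(j in J0) ((2^-1) ^+ e i) ^+ 2 * a i j ^+ 2.
  rewrite -(pair_bigA _ (fun i j => c f (i, j) ^+ 2))/= [RHS]big_mkcond.
  apply: eq_bigr => i _; rewrite /c/= rgE; case: ifP => iI; last first.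
    by rewrite big1// => j _; rewrite !mul0r expr0n.
  rewrite [RHS]big_mkcond; apply: eq_bigr => j _; rewrite chE; case: ifP => jJ.
    by rewrite !exprMn !sqrr_sign; ring.
  by rewrite mulr0 mul0r expr0n.
have thE : \sum_p c f p * sg w p = \sum_(i in I0) (2^-1) ^+ e i * `|Z i|.
  rewrite (eq_bigr (fun p => c f (p.1, p.2) * sg w (p.1, p.2))); last by case.
  rewrite -(pair_bigA _ (fun i j => c f (i, j) * sg w (i, j)))/= [RHS]big_mkcond.
  apply: eq_bigr => i _; rewrite /c/= rgE; case: ifP => iI; last first.
    by rewrite big1// => j _; rewrite !mul0r.
  rewrite normrEsign {2}/Z !mulr_sumr [RHS]big_mkcond; apply: eq_bigr => j _.
  by rewrite chE; case: ifP => jJ; ring.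
have := Nb w f s vf; rewrite cE => /(_ ss s0); rewrite thE => hN.
apply: le_trans (ler_wpM2l X0 hN).
have -> : \sum_(i in I0) \sum_(j in J0) a i j * sg w (i, j) * x j * y i =
    \sum_(j in J0) x j * W j.
  rewrite exchange_big/=; apply: eq_bigr => j _; rewrite mulr_sumr.
  by apply: eq_bigr => i _; ring.
apply: (@le_trans _ _ (X * \sum_(j in J0) (-1) ^+ (W j < 0)%R * W j)).
  rewrite mulr_sumr; apply: ler_sum => j jJ; rewrite -normrEsign.
  by rewrite (le_trans (ler_norm _))// normrM ler_wpM2r// xX.
rewrite ler_wpM2l//.
have -> : \sum_(j in J0) (-1) ^+ (W j < 0)%R * W j = \sum_(i in I0) y i * Z i.
  under eq_bigr do rewrite {2}/W mulr_sumr.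
  rewrite exchange_big/=; apply: eq_bigr => i _; rewrite mulr_sumr.
  by apply: eq_bigr => j _; ring.
apply: ler_sum => i iI; rewrite (le_trans (ler_norm _))// normrM ler_wpM2r//.
exact: ye.
Qed.

End Atoms.

(** * Real powers and elementary series *)

Section Tools.
Context {R : realType}.

Lemma dyadic_exponent (n : nat) (t : R) : (2^-1) ^+ n <= t -> t <= 1 ->
  exists s, [/\ (s <= n)%N, t <= (2^-1) ^+ s & (2^-1) ^+ s <= 2 * t].
Proof.
elim: n => [|n ih] h t1; first by exists 0; split => //; rewrite expr0 in h *; lra.
case: (leP ((2^-1) ^+ n) t) => [/ih/(_ t1)[s [sn h1 h2]]|tn].
  by exists s; split => //; rewrite ltnW// ltnS.
exists n; split => //; first exact: ltW.
by move: h; rewrite exprS; lra.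
Qed.

Lemma ler_wpowR (x y r : R) : 0 <= r -> 0 <= x -> x <= y -> x `^ r <= y `^ r.
Proof.
by move=> r0 x0 xy; apply: ge0_ler_powR; rewrite ?nnegrE// (le_trans x0).
Qed.

Lemma powR1l (r : R) : 1 `^ r = 1.
Proof. by rewrite powR1. Qed.

Lemma powRV (x r : R) : 0 <= x -> x^-1 `^ r = (x `^ r)^-1.
Proof.
by move=> x0; rewrite -powR_inv1// powRAC powR_inv1 ?powR_ge0.
Qed.

Lemma powR_le1 (x r : R) : 0 <= x -> 0 < r -> x `^ r <= 1 -> x <= 1.
Proof.
move=> x0 r0; rewrite leNgt => /negP h; rewrite leNgt; apply/negP => x1; apply: h.
by rewrite -(powR1l r); apply: gt0_ltr_powR; rewrite ?nnegrE.
Qed.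

Lemma sum_powR_le1 (I : finType) (f : I -> R) (r : R) i : 0 < r -> (forall i, 0 <= f i) ->
  \sum_i f i `^ r <= 1 -> f i <= 1.
Proof.
move=> r0 f0 hf; apply: (powR_le1 (f0 i) r0); apply: le_trans hf.
by rewrite (bigD1 i)//= lerDl; apply: sumr_ge0 => *; exact: powR_ge0.
Qed.

Lemma coord_le1 (I : finType) (r : R) (y : I -> R) i : 0 < r ->
  \sum_i `|y i| `^ r <= 1 -> `|y i| <= 1.
Proof. by move=> r0; apply: (@sum_powR_le1 _ (fun i => `|y i|)). Qed.

(** Splits a product of two Hoelder factors into a sum that is summed over the
    levels afterwards. *)
Lemma powR_split (u v p al : R) : 0 <= u -> 0 <= v -> 0 < p -> 0 < al ->
  p^-1 + al^-1 = 1 -> u `^ p^-1 * v `^ al^-1 <= u + v.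
Proof.
move=> u0 v0 p0 al0 pal.
have uv : 0 <= u + v by rewrite addr_ge0.
rewrite -[leRHS](powRr1 uv) -pal powRD; last first.
  by rewrite pal oner_eq0.
apply: ler_pM; rewrite ?powR_ge0//.
  by rewrite ler_wpowR ?invr_ge0 ?(ltW p0)// lerDl.
by rewrite ler_wpowR ?invr_ge0 ?(ltW al0)// lerDr.
Qed.

Lemma sum_arith_geometric (q : R) n : 0 <= q -> q < 1 ->
  \sum_(r < n) r.+1%:R * q ^+ r <= (1 - q) ^- 2.
Proof.
move=> q0 q1; have q2 : 0 < (1 - q) ^+ 2 by rewrite exprn_gt0// subr_gt0.
rewrite -[leRHS]mul1r ler_pdivlMr//.
have -> : (\sum_(r < n) r.+1%:R * q ^+ r) * (1 - q) ^+ 2 =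
    1 - n.+1%:R * q ^+ n + n%:R * q ^+ n.+1.
  elim: n => [|n ih]; first by rewrite big_ord0 expr0 expr1; ring.
  by rewrite big_ord_recr/= mulrDl ih !exprS !mulrS; ring.
have : 0 <= q ^+ n by rewrite exprn_ge0.
have : 0 <= n%:R * q ^+ n by rewrite mulr_ge0// exprn_ge0.
by rewrite exprS mulrS; nra.
Qed.

Lemma half_powR_lt1 (k : R) : 0 < k -> (2^-1 : R) `^ k < 1.
Proof.
move=> k0; rewrite -[ltRHS](powR1l k); apply: gt0_ltr_powR; rewrite ?nnegrE//; lra.
Qed.

Lemma half_powRX (k : R) r : ((2^-1 : R) ^+ r) `^ k = ((2^-1) `^ k) ^+ r.
Proof.
elim: r => [|r ih]; first by rewrite !expr0 powR1l.
by rewrite !exprS powRM ?exprn_ge0// ih.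
Qed.

Lemma le_sqr_powR (t z al : R) : 0 <= t -> 0 < z -> 2 <= al ->
  t ^+ 2 <= z ^+ 2 * (1 + (z `^ al)^-1 * t `^ al).
Proof.
move=> t0 z0 al2; have z20 : 0 < z ^+ 2 by rewrite exprn_gt0.
have za : 0 < z `^ al by rewrite powR_gt0.
have pos : 0 <= (z `^ al)^-1 * t `^ al by rewrite mulr_ge0 ?powR_ge0// invr_ge0 ltW.
case: (leP t z) => [tz|zt].
  apply: (@le_trans _ _ (z ^+ 2)); last by rewrite ler_peMr ?(ltW z20)// lerDl.
  by rewrite ler_sqr ?nnegrE// ltW.
rewrite -ler_pdivrMl// mulrC -expr_div_n.
apply: (@le_trans _ _ ((t / z) `^ al)); last first.
  by rewrite powRM ?invr_ge0 ?(ltW z0)// powRV ?(ltW z0)// mulrC lerDr.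
rewrite -powR_mulrn ?divr_ge0 ?(ltW z0)//; apply: ler_powR => //.
by rewrite ler_pdivlMr// mul1r ltW.
Qed.

End Tools.

(** * Rows much coarser than columns *)

Section Unbalanced.
Context {R : realType} (al p : R) (D CL : nat).
Hypothesis al_ge2 : 2 <= al.
Hypothesis p_gt0 : 0 < p.
Hypothesis p_al : p^-1 + al^-1 = 1.

Let al_gt0 : 0 < al. Proof. by rewrite (lt_le_trans _ al_ge2). Qed.
Let c1 : nat := ((D + 4) * (2 * CL) + 8)%N.
Let q : R := (2^-1) `^ al^-1.
Let q0 : 0 <= q. Proof. exact: powR_ge0. Qed.
Let q1 : q < 1. Proof. by apply: half_powR_lt1; rewrite invr_gt0. Qed.

(** The rows concerned have levels up to the finest admissible one, hence are few.
    The factor [k.+1] pays for naming each of them. *)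
Lemma card_union_levels (I : finType) (l : I -> nat) (U : nat -> nat -> bool) k :
  (forall t, #|[set i | (l i <= t)%N]| <= 2 ^ t.+1)%N ->
  (forall l k, U l k -> k.+1 * 2 ^ l <= CL * 2 ^ k)%N ->
  (k.+1 * #|[set i | U (l i) k]| <= 2 * CL * 2 ^ k)%N.
Proof.
move=> hl hU; case: (pickP [pred i | U (l i) k]) => [i0 i0U|h]; last first.
  by rewrite (_ : [set i | _] = set0) ?cards0 ?muln0//; apply/setP => i; rewrite !inE; exact: h.
pose i1 := [arg max_(i > i0 | U (l i) k) l i].
have [i1U i1max] : U (l i1) k /\ forall i, U (l i) k -> (l i <= l i1)%N.
  by rewrite /i1; case: arg_maxnP.
apply: (@leq_trans (k.+1 * 2 ^ (l i1).+1)).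
  rewrite leq_mul2l/=; apply: leq_trans (hl (l i1)).
  by apply: subset_leq_card; apply/subsetP => i; rewrite !inE; exact: i1max.
by rewrite expnS mulnCA -mulnA leq_mul2l/= hU.
Qed.

Context (I J : finType) (a : I -> J -> R) (U : nat -> nat -> bool).
Hypothesis a_ge0 : forall i j, 0 <= a i j.
Hypothesis a_row : forall i, \sum_j a i j `^ al <= 1.
Hypothesis a_near : forall k,
  (#|[set i | [exists j, (8^-1 ^+ k < a i j)%R]]| <= 2 ^ (D * k))%N.
Hypothesis U_small : (forall l k, U l k -> k.+1 * 2 ^ l <= CL * 2 ^ k)%N.

Let K := #|J|.+1.
Let SI k := [set i | [exists j, (8^-1 ^+ k < a i j)%R]].
Let col (rho : I -> R) j := \sum_i rho i * a i j `^ al.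
Let cand k r (rho : I -> R) := [set j | (level (col rho) j <= k + r)%N].
Let n1 k := ((2 * CL * 2 ^ k) %/ k.+1)%N.
Let n2 k := (2 ^ k.+1)%N.
Let H (k r : nat) : R := (c1 * 2 ^ k * r.+1)%:R.

Let a_le1 i j : a i j <= 1.
Proof. exact: sum_powR_le1 al_gt0 (a_ge0 i) (a_row i). Qed.

Let forms : exists N : {ffun I * J -> bool} -> R,
  [/\ forall w, 0 <= N w, avg N <= 7 &
   forall w k r (I0 : {set I}) (e : I -> nat) (J0 : {set J}) (x : J -> R) (y : I -> R)
     (X s : R),
   (k < K)%N -> (r < K)%N -> I0 \subset SI k -> (#|I0| <= n1 k)%N ->
   {in I0, forall i, (e i <= 3 * k)%N} -> {in I0, forall i, `|y i| <= (2^-1) ^+ e i} ->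
   J0 \subset cand k r (fun i => if i \in I0 then ((2^-1) ^+ e i) ^+ 2 else 0) ->
   (#|J0| <= n2 k)%N -> {in J0, forall j, `|x j| <= X} ->
   \sum_(i in I0) \sum_(j in J0) ((2^-1) ^+ e i) ^+ 2 * a i j ^+ 2 <= s ^+ 2 ->
   0 <= X -> 0 <= s ->
   \sum_(i in I0) \sum_(j in J0) a i j * sg w (i, j) * x j * y i <=
     X * (N w * Num.sqrt (H k r) * s)].
Proof.
apply: (@sup_block_forms R I J a K D SI n1 n2 cand (fun k r => (k + r).+1)
  (fun _ r => r%:R) H) => //.
- by move=> k r rho; exact: card_level_le.
- move=> k r; rewrite /H /c1 /n1 /n2 -natrM.
  have e1 : ((D + 4) * k.+1 * ((2 * CL * 2 ^ k) %/ k.+1) <= (D + 4) * (2 * CL) * 2 ^ k)%N.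
    by rewrite -!mulnA leq_mul2l; apply/orP; right; rewrite mulnC leq_trunc_div.
  have e2 : (2 ^ (k + r).+2)%:R * expR (- r%:R) <= (4 * 2 ^ k)%:R :> R.
    have -> : (2 ^ (k + r).+2)%:R = (4 * 2 ^ k)%:R * 2 ^+ r :> R.
      by rewrite -natrX -natrM (_ : (k + r).+2 = 2 + k + r)%N// !expnD.
    by rewrite expRN -mulrA ler_piMr// ler_pdivrMr ?expR_gt0// mul1r expR_ge_expn.
  apply: (@le_trans _ _ (((D + 4) * (2 * CL) * 2 ^ k)%:R + (r * 2 ^ k.+1)%:R
    + (4 * 2 ^ k)%:R + (k + r)%:R + 1)).
    by rewrite !lerD2r lerD// lerD2r ler_nat.
  rewrite -!natrD -[1]/(1%:R) -natrD ler_nat expnS.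
  have k2 : (k < 2 ^ k)%N by exact: ltn_expl.
  move: (2 ^ k)%N k2 => E kE; set G := ((D + 4) * (2 * CL))%N.
  have : (r <= r * E)%N by rewrite leq_pmulr//; lia.
  have : (G * E <= G * E * r.+1)%N by rewrite leq_pmulr.
  nia.
Qed.

(** The rows are so few that naming them is cheap. Once they are named, the columns
    are ranked by their weighted sums [col]: naming a column of relative level
    [k + r] costs only [r], and the weight of these columns decays like [2 ^- r].
    This is what removes the logarithm that a crude description would cost. *)
Lemma unbalanced_bound : exists N : {ffun I * J -> bool} -> R,
  [/\ forall w, 0 <= N w,
      avg N <= 8 * CL%:R + 420 * Num.sqrt c1%:R * (1 - q) ^- 2 &
   forall w (x : J -> R) (y : I -> R) (l : I -> nat),
     \sum_j `|x j| `^ p <= 1 -> \sum_i y i ^+ 2 <= 1 ->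
     (forall t, #|[set i | (l i <= t)%N]| <= 2 ^ t.+1)%N ->
     \sum_i \sum_j (U (l i) (level (fun j => `|x j| `^ p) j))%:R *
        (a i j * sg w (i, j) * x j * y i) <= N w].
Proof.
have [N [N0 Na Nb]] := forms.
set Cq := (1 - q) ^- 2.
have Cq0 : 0 <= Cq by rewrite invr_ge0 exprn_ge0// subr_ge0 ltW.
exists (fun w => 8 * CL%:R + 60 * Num.sqrt c1%:R * Cq * N w); split.
- by move=> w; rewrite addr_ge0 ?mulr_ge0// sqrtr_ge0.
- rewrite avgD avg_cst avgZ lerD2l.
  apply: (@le_trans _ _ (60 * Num.sqrt c1%:R * Cq * 7)).
    by rewrite ler_wpM2l// !mulr_ge0// sqrtr_ge0.
  rewrite le_eqVlt; apply/orP; left; apply/eqP; ring.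
move=> w x y l hx hy hl.
pose gx j := `|x j| `^ p; pose kx := level gx.
pose t i j := a i j * sg w (i, j) * x j * y i.
have gx0 j : 0 <= gx j by exact: powR_ge0.
have x1 j : `|x j| <= 1 by exact: coord_le1 hx.
have y1 i : `|y i| <= 1.
  rewrite -(@ler_pXn2r _ 2)// ?nnegrE// expr1n -normrX ger0_norm ?sqr_ge0//.
  apply: le_trans hy; rewrite (bigD1 i)//= lerDl.
  by apply: sumr_ge0 => i' _; exact: sqr_ge0.
pose Ik k := [set i | U (l i) k].
pose Jk k := [set j | kx j == k].
pose u k := 2 ^+ k * rearr gx k.
pose Ab j := \sum_i y i ^+ 2 * a i j `^ al.
have Ab0 j : 0 <= Ab j by apply: sumr_ge0 => i _; rewrite mulr_ge0 ?sqr_ge0 ?powR_ge0.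
have sAb : \sum_j Ab j <= 1.
  rewrite exchange_big/=; apply: le_trans hy; apply: ler_sum => i _.
  by rewrite -mulr_sumr ler_piMr ?sqr_ge0.
(* bounds the weight of the columns of level [k] and relative level [k + r], up to
   the factor [2 ^- r]; the last term keeps it positive *)
pose d k r := (if r == 0%N then 4 * \sum_(j in Jk k) Ab j
   else 8 * (2 ^+ (k + r) * rearr Ab (k + r))) + (2^-1) ^+ k.
have d_gt0 k r : 0 < d k r.
  rewrite /d ltr_wpDl ?exprn_gt0//; case: ifP => _.
    by rewrite mulr_ge0// sumr_ge0.
  by rewrite !mulr_ge0 ?rearr_ge0 ?exprn_ge0.
have split_sum : \sum_i \sum_j (U (l i) (kx j))%:R * t i j =
    \sum_(k < K) \sum_(i in Ik k) \sum_(j in Jk k) t i j by exact: sum_over_levels.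
have cIk k : (#|Ik k| <= n1 k)%N.
  by rewrite /n1 leq_divRL// mulnC card_union_levels.
have cJk k : (#|Jk k| <= n2 k)%N.
  apply: leq_trans (card_level_le gx k); apply: subset_leq_card.
  by apply/subsetP => j; rewrite !inE /kx => /eqP ->.
have block (k : 'I_K) : \sum_(i in Ik k) \sum_(j in Jk k) t i j <=
    4 * CL%:R * (2^-1) ^+ k +
    \sum_(r < K) 3 * Num.sqrt c1%:R * (r.+1%:R * q ^+ r) * (u k + d k r) * N w.
  (* the cells outside [I0] are below [8 ^- k], against a multiple of [4 ^ k] cells *)
  pose I0 := [set i in Ik k | (i \in SI k) && ((8^-1) ^+ k <= `|y i|)].
  have /choice[e he] : forall i, exists s, i \in I0 ->
      [/\ (s <= 3 * k)%N, `|y i| <= (2^-1) ^+ s & (2^-1) ^+ s <= 2 * `|y i|].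
    move=> i; case: (boolP (i \in I0)) => [|_]; last by exists 0%N.
    rewrite inE => /and3P[_ _ yi].
    have [|s ?] := @dyadic_exponent R (3 * k) `|y i| _ (y1 i); last by exists s.
    by rewrite exprM (_ : (2^-1) ^+ 3 = 8^-1)//; field.
  pose rho (i : I) : R := if i \in I0 then ((2^-1) ^+ e i) ^+ 2 else 0.
  pose A := col rho.
  have rho0 i : 0 <= rho i by rewrite /rho; case: ifP; rewrite ?sqr_ge0.
  have rho4 i : rho i <= 4 * y i ^+ 2.
    rewrite /rho; case: ifPn => [iI|_]; last by rewrite mulr_ge0 ?sqr_ge0.
    have [_ _ h] := he i iI.
    have -> : 4 * y i ^+ 2 = (2 * `|y i|) ^+ 2.
      by rewrite exprMn real_normK ?num_real//; ring.
    by rewrite ler_sqr ?nnegrE ?mulr_ge0 ?exprn_ge0.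
  have srho : \sum_i rho i <= 4.
    apply: (@le_trans _ _ (4 * \sum_i y i ^+ 2)).
      by rewrite mulr_sumr; apply: ler_sum => i _.
    by rewrite -[leRHS]mulr1 ler_pM2l.
  have A4 j : A j <= 4 * Ab j.
    by rewrite mulr_sumr; apply: ler_sum => i _; rewrite mulrA ler_wpM2r ?powR_ge0.
  have A0 j : 0 <= A j by apply: sumr_ge0 => i _; rewrite mulr_ge0 ?powR_ge0.
  rewrite (big_setID I0)/= (setIidPr _); last by apply/subsetP => i; rewrite inE => /andP[].
  rewrite addrC lerD//.
    have tb i j : i \in Ik k :\: I0 -> t i j <= (8^-1) ^+ k.
      rewrite !inE => /andP[hn iU]; rewrite iU/= negb_and in hn.
      rewrite (le_trans (ler_norm _))// /t !normrM normr_sg1 mulr1 (ger0_norm (a_ge0 _ _)).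
      case/orP: hn => [/existsPn/(_ j)|]; rewrite -?leNgt -?ltNge => hn.
        by rewrite -[leRHS]mulr1 -[leRHS]mulr1 !ler_pM ?mulr_ge0.
      by apply: le_trans (ltW hn); rewrite -[leRHS]mul1r ler_wpM2r// mulr_ile1.
    apply: (@le_trans _ _ (\sum_(i in Ik k :\: I0) \sum_(j in Jk k) (8^-1) ^+ k)).
      by apply: ler_sum => i iI; apply: ler_sum => j _; exact: tb.
    rewrite !sumr_const -mulrnA -[leLHS]mulr_natl.
    have cnt : (#|Jk k| * #|Ik k :\: I0| <= 4 * CL * (4 ^ k))%N.
      apply: (@leq_trans (2 ^ k.+1 * (2 * CL * 2 ^ k))).
        apply: leq_mul; first exact: cJk.
        apply: leq_trans (subset_leq_card (subsetDl _ _)) _.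
        by apply: leq_trans (cIk k) _; exact: leq_div.
      have -> : (4 ^ k = 2 ^ k * 2 ^ k)%N by rewrite -expnMn.
      rewrite expnS; move: (2 ^ k)%N => E.
      by rewrite leq_eqVlt; apply/orP; left; apply/eqP; ring.
    apply: (@le_trans _ _ ((4 * CL * 4 ^ k)%:R * (8^-1) ^+ k)).
      by rewrite ler_wpM2r ?exprn_ge0// ler_nat.
    rewrite natrM natrM natrX -mulrA -exprMn.
    by rewrite (_ : 4 * 8^-1 = 2^-1 :> R); [|field].
  pose Jr (r : 'I_K) := [set j in Jk k | (level A j - k == r)%N].
  have -> : \sum_(i in I0) \sum_(j in Jk k) t i j =
      \sum_(r < K) \sum_(i in I0) \sum_(j in Jr r) t i j.
    rewrite [RHS]exchange_big/=; apply: eq_bigr => i _.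
    rewrite (partition_big (fun j => inord (level A j - k) : 'I_K) xpredT)//=.
    apply: eq_bigr => r _; apply: eq_bigl => j; rewrite [in RHS]inE; congr (_ && _).
    by rewrite -val_eqE/= inordK// (leq_ltn_trans (leq_subr _ _))// level_lt.
  apply: ler_sum => r _.
  pose X := rearr gx k `^ p^-1.
  (* threshold at which both terms of [le_sqr_powR], summed over the columns, are of the
     same order *)
  pose Z := (2^-1) ^+ (k + r) * d k r.
  have Z0 : 0 < Z by rewrite mulr_gt0 ?exprn_gt0.
  pose z := Z `^ al^-1.
  have z0 : 0 < z by rewrite powR_gt0.
  have zZ : z `^ al = Z.
    by rewrite -powRrM mulVf ?lt0r_neq0// powRr1// ltW.
  have xX : {in Jr r, forall j, `|x j| <= X}.
    move=> j; rewrite !inE => /andP[/eqP kj _].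
    have := le_rearr_level gx j; rewrite -/(kx j) kj => h.
    rewrite -[leLHS](powRr1 (normr_ge0 _)) -(mulfV (lt0r_neq0 p_gt0)) powRrM.
    by rewrite ler_wpowR ?invr_ge0 ?powR_ge0 ?(ltW p_gt0).
  have cJr : (#|Jr r| <= 2 ^ k.+1)%N.
    by apply: leq_trans (cJk k); apply: subset_leq_card; apply/subsetP => j; rewrite inE => /andP[].
  have sA : \sum_(j in Jr r) A j <= (2^-1) ^+ r * d k r.
    apply: (@le_trans _ _ ((2^-1) ^+ r * (d k r - (2^-1) ^+ k))); last first.
      by rewrite ler_wpM2l ?exprn_ge0// gerBl exprn_ge0.
    rewrite /d addrK; case: ifPn => [/eqP r0|r0].
      rewrite r0 expr0 mul1r mulr_sumr.
      apply: (@le_trans _ _ (\sum_(j in Jk k) A j)); last exact: ler_sum.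
      rewrite [leRHS](big_setID (Jr r))/= (setIidPr _).
        by rewrite lerDl; apply: sumr_ge0 => j _.
      by apply/subsetP => j; rewrite inE => /andP[].
    have Aj j : j \in Jr r -> A j <= 4 * rearr Ab (k + r).
      rewrite inE => /andP[_ /eqP lj].
      have lv : level A j = (k + r)%N by rewrite -lj subnKC// ltnW// -subn_gt0 lj lt0n.
      rewrite -ler_pdivrMl//; apply: le_rearr_card; rewrite -lv.
      apply: leq_trans (level_rank A j) _; apply: subset_leq_card; apply/subsetP => j'.
      rewrite !inE => h; rewrite ler_pdivrMl//; exact: le_trans h (A4 j').
    apply: (le_trans (ler_sum _ Aj)); rewrite sumr_const -[leLHS]mulr_natl.
    apply: (@le_trans _ _ ((2 ^ k.+1)%:R * (4 * rearr Ab (k + r)))).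
      by rewrite ler_wpM2r ?mulr_ge0 ?rearr_ge0// ler_nat.
    rewrite le_eqVlt; apply/orP; left; apply/eqP; rewrite natrX exprS exprD.
    have e2 : (2^-1) ^+ r * 2 ^+ r = 1 :> R by rewrite -exprMn mulVf ?expr1n.
    transitivity ((2^-1) ^+ r * 2 ^+ r * (2 * 2 ^+ k * (4 * rearr Ab (k + r)))).
      by rewrite e2 mul1r.
    by ring.
  have sq2 : Num.sqrt (2 ^+ k) ^+ 2 = 2 ^+ k :> R by rewrite sqr_sqrtr ?exprn_ge0.
  pose s := 3 * z * Num.sqrt (2 ^+ k).
  have var : \sum_(i in I0) \sum_(j in Jr r) ((2^-1) ^+ e i) ^+ 2 * a i j ^+ 2 <= s ^+ 2.
    rewrite exchange_big/=.
    apply: (@le_trans _ _ (\sum_(j in Jr r) z ^+ 2 * (4 + Z^-1 * A j))).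
      apply: ler_sum => j _.
      apply: (@le_trans _ _ (\sum_i rho i * (z ^+ 2 * (1 + Z^-1 * a i j `^ al)))).
        rewrite [leRHS](bigID (mem I0))/= -[leLHS]addr0 lerD//; last first.
          by apply: sumr_ge0 => i /negbTE iI; rewrite /rho iI mul0r.
        apply: ler_sum => i iI; rewrite /rho iI ler_wpM2l ?sqr_ge0//.
        by rewrite -zZ; exact: le_sqr_powR.
      rewrite (eq_bigr (fun i => z ^+ 2 * (rho i + Z^-1 * (rho i * a i j `^ al)))); last first.
        by move=> i _; ring.
      rewrite -mulr_sumr ler_wpM2l ?sqr_ge0// big_split/= -mulr_sumr lerD2r.
      exact: srho.
    have sE : s ^+ 2 = z ^+ 2 * (9 * 2 ^+ k) by rewrite /s !exprMn sq2; ring.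
    rewrite sE -mulr_sumr ler_wpM2l ?sqr_ge0// big_split/= sumr_const -[_ *+ _]mulr_natl -mulr_sumr.
    apply: (@le_trans _ _ (8 * 2 ^+ k + 2 ^+ k)); last by rewrite le_eqVlt; apply/orP; left; apply/eqP; ring.
    apply: lerD.
      apply: (@le_trans _ _ ((2 ^ k.+1)%:R * 4)); first by rewrite ler_wpM2r// ler_nat.
      by rewrite natrX exprS le_eqVlt; apply/orP; left; apply/eqP; ring.
    rewrite ler_pdivrMl// /Z exprD (_ : _ * _ * _ * _ = (2^-1) ^+ r * d k r)//.
    have e2 : (2^-1) ^+ k * 2 ^+ k = 1 :> R by rewrite -exprMn mulVf ?expr1n.
    transitivity ((2^-1) ^+ k * 2 ^+ k * ((2^-1) ^+ r * d k r)); first by ring.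
    by rewrite e2 mul1r.
  have X0 : 0 <= X by exact: powR_ge0.
  have s0 : 0 <= s by rewrite /s !mulr_ge0 ?sqrtr_ge0 ?(ltW z0).
  have I0S : I0 \subset SI k by apply/subsetP => i; rewrite inE => /and3P[].
  have I0n : (#|I0| <= n1 k)%N.
    apply: leq_trans (cIk k); apply: subset_leq_card.
    by apply/subsetP => i; rewrite inE => /andP[].
  have Jc : Jr r \subset cand k r (fun i => if i \in I0 then ((2^-1) ^+ e i) ^+ 2 else 0).
    apply/subsetP => j; rewrite !inE => /andP[_ /eqP <-].
    by rewrite -leq_subLR.
  have := Nb w k r I0 e (Jr r) x y X s (ltn_ord k) (ltn_ord r) I0S I0n
    (fun i iI => let: And3 h _ _ := he i iI in h) (fun i iI => let: And3 _ h _ := he i iI in h)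
    Jc cJr xX var X0 s0.
  move=> /le_trans; apply.
  have sH : Num.sqrt (H k r) = Num.sqrt c1%:R * Num.sqrt (2 ^+ k) * Num.sqrt r.+1%:R.
    by rewrite /H !natrM natrX !sqrtrM// mulr_ge0// exprn_ge0.
  have sr : Num.sqrt r.+1%:R <= r.+1%:R :> R.
    rewrite -[leRHS]ger0_norm// -sqrtr_sqr ler_wsqrtr// expr2 ler_peMl//.
    by rewrite ler1n.
  have key : 2 ^+ k * (X * z) <= q ^+ r * (u k + d k r).
    have hk : ((2^-1) ^+ k) `^ p^-1 * ((2^-1) ^+ k) `^ al^-1 = (2^-1) ^+ k :> R.
      rewrite -powRD; first by rewrite p_al powRr1 ?exprn_ge0.
      by rewrite p_al oner_eq0.
    have e2 : (2^-1) ^+ k * 2 ^+ k = 1 :> R by rewrite -exprMn mulVf ?expr1n.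
    have Xe : X = ((2^-1) ^+ k) `^ p^-1 * u k `^ p^-1.
      rewrite -powRM ?exprn_ge0 ?mulr_ge0 ?rearr_ge0 ?exprn_ge0//.
      by rewrite /u mulrA e2 mul1r.
    have ze : z = ((2^-1) ^+ k) `^ al^-1 * q ^+ r * d k r `^ al^-1.
      rewrite /z /Z exprD !powRM ?mulr_ge0 ?exprn_ge0 ?(ltW (d_gt0 _ _))//.
      by rewrite -half_powRX.
    have u0 : 0 <= u k by rewrite mulr_ge0 ?rearr_ge0 ?exprn_ge0.
    have -> : 2 ^+ k * (X * z) = q ^+ r * (u k `^ p^-1 * d k r `^ al^-1).
      transitivity (2 ^+ k * (((2^-1) ^+ k) `^ p^-1 * ((2^-1) ^+ k) `^ al^-1) *
          (q ^+ r * (u k `^ p^-1 * d k r `^ al^-1))); first by rewrite Xe ze; ring.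
      by rewrite hk [2 ^+ k * _]mulrC e2 mul1r.
    rewrite ler_wpM2l ?exprn_ge0//.
    by apply: powR_split; rewrite ?(ltW (d_gt0 _ _)).
  have -> : X * (N w * Num.sqrt (H k r) * s) =
      3 * Num.sqrt c1%:R * Num.sqrt r.+1%:R * (2 ^+ k * (X * z)) * N w.
    transitivity (3 * Num.sqrt c1%:R * Num.sqrt r.+1%:R *
        (Num.sqrt (2 ^+ k) ^+ 2 * (X * z)) * N w); first by rewrite sH /s; ring.
    by rewrite sq2.
  rewrite ler_wpM2r//.
  have -> : 3 * Num.sqrt c1%:R * (r.+1%:R * q ^+ r) * (u k + d k r) =
     3 * Num.sqrt c1%:R * r.+1%:R * (q ^+ r * (u k + d k r)) by ring.
  apply: ler_pM => //.
  - by rewrite mulr_ge0 ?exprn_ge0// mulr_ge0// ltW.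
  - by rewrite ler_wpM2l// mulr_ge0 ?sqrtr_ge0.
rewrite split_sum; apply: (le_trans (ler_sum _ (fun k _ => block k))).
rewrite big_split/= -mulr_sumr lerD//.
  have := sum_geometric_half (R := R) K; have : 0 <= CL%:R :> R by []. nra.
rewrite exchange_big/=.
apply: (@le_trans _ _ (\sum_(r < K) 60 * Num.sqrt c1%:R * (r.+1%:R * q ^+ r) * N w)).
  apply: ler_sum => r _; rewrite -mulr_suml ler_wpM2r//.
  rewrite -mulr_sumr.
  have dsum : \sum_(k < K) (u k + d k r) <= 20.
    rewrite big_split/= (_ : 20 = 2 * 1 + 18); last by ring.
    apply: lerD; first by rewrite (le_trans (sum_rearr _ gx0))// ler_pM2l.
    rewrite /d big_split/= (_ : 18 = 16 + 2); last by ring.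
    apply: lerD; last exact: sum_geometric_half.
    case: (eqVneq (nat_of_ord r) 0%N) => r0.
      rewrite -mulr_sumr; apply: (@le_trans _ _ (4 * 1)); last by lra.
      rewrite ler_pM2l//; apply: le_trans sAb.
      rewrite [leRHS](partition_big (fun j => inord (kx j) : 'I_K) xpredT)//=.
      apply: ler_sum => k _; rewrite le_eqVlt; apply/orP; left; apply/eqP.
      by apply: eq_bigl => j; rewrite inE -val_eqE/= inordK// level_lt.
    rewrite -mulr_sumr; apply: (@le_trans _ _ (8 * (2 * 1))); last by lra.
    rewrite ler_pM2l//; apply: (@le_trans _ _ (2 * \sum_j Ab j)); last by rewrite ler_pM2l.
    apply: le_trans (sum_rearr (r + K) Ab0).
    rewrite [leRHS]big_split_ord/=.
    rewrite -[leLHS]add0r lerD//.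
      by apply: sumr_ge0 => k _; rewrite mulr_ge0 ?rearr_ge0 ?exprn_ge0.
    by apply: ler_sum => k _; rewrite addnC.
  apply: (@le_trans _ _ (3 * Num.sqrt c1%:R * (r.+1%:R * q ^+ r) * 20)).
    by rewrite ler_wpM2l// !mulr_ge0 ?sqrtr_ge0 ?exprn_ge0.
  rewrite le_eqVlt; apply/orP; left; apply/eqP; ring.
rewrite -mulr_suml -mulr_sumr ler_wpM2r// ler_wpM2l ?mulr_ge0 ?sqrtr_ge0//.
exact: sum_arith_geometric.
Qed.

End Unbalanced.

(** * Rows and columns of comparable levels *)

Section Balanced.
Context {R : realType} (p : R) (D : nat).
Hypothesis p_gt0 : 0 < p.

Let c1 : nat := (4 * D + 13)%N.

Context (I J : finType) (a : I -> J -> R) (V : nat -> nat -> bool).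
Hypothesis a_ge0 : forall i j, 0 <= a i j.
Hypothesis a_le1 : forall i j, a i j <= 1.
Hypothesis a_near_row : forall k,
  (#|[set i | [exists j, (8^-1 ^+ k < a i j)%R]]| <= 2 ^ (D * k))%N.
Hypothesis a_near_col : forall k,
  (#|[set j | [exists i, (8^-1 ^+ k < a i j)%R]]| <= 2 ^ (D * k))%N.
Hypothesis V_le : forall l k, V l k -> (l <= k)%N.

Let K := #|J|.+1.
Let SI k := [set i | [exists j, (8^-1 ^+ k < a i j)%R]].
Let SJ k := [set j | [exists i, (8^-1 ^+ k < a i j)%R]].
Let n1 k := (2 ^ k.+1)%N.
Definition balanced_entropy (k r : nat) : R := (c1 * k.+1 * 2 ^ k.+1 + r)%:R.

Let forms : exists N : {ffun I * J -> bool} -> R,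
  [/\ forall w, 0 <= N w, avg N <= 7 &
   forall w k r (I0 : {set I}) (e : I -> nat) (J0 : {set J}) (x : J -> R) (y : I -> R)
     (X s : R),
   (k < K)%N -> (r < K)%N -> I0 \subset SI k -> (#|I0| <= n1 k)%N ->
   {in I0, forall i, (e i <= 3 * k)%N} -> {in I0, forall i, `|y i| <= (2^-1) ^+ e i} ->
   J0 \subset SJ k ->
   (#|J0| <= n1 k)%N -> {in J0, forall j, `|x j| <= X} ->
   \sum_(i in I0) \sum_(j in J0) ((2^-1) ^+ e i) ^+ 2 * a i j ^+ 2 <= s ^+ 2 ->
   0 <= X -> 0 <= s ->
   \sum_(i in I0) \sum_(j in J0) a i j * sg w (i, j) * x j * y i <=
     X * (N w * Num.sqrt (balanced_entropy k r) * s)].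
Proof.
apply: (@sup_block_forms R I J a K D SI n1 n1 (fun k _ _ => SJ k) (fun k _ => (D * k)%N)
  (fun k _ => (D * k)%:R) balanced_entropy) => //.
  by move=> k r _; exact: a_near_col.
move=> k r; rewrite /balanced_entropy /c1 /n1.
have -> : (D * k)%:R * (2 ^ k.+1)%:R = (D * k * 2 ^ k.+1)%:R :> R by rewrite [RHS]natrM.
have e2 : (2 ^ (D * k).+1)%:R * expR (- (D * k)%:R) <= 2 :> R.
  rewrite expRN ler_pdivrMr ?expR_gt0// expnS natrM ler_wpM2l// natrX.
  exact: expR_ge_expn.
apply: (@le_trans _ _ (((D + 4) * k.+1 * 2 ^ k.+1)%:R + (D * k * 2 ^ k.+1)%:R
    + 2 + (k + r)%:R + 1)); first by rewrite !lerD2r lerD2l.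
rewrite (_ : _ + _ = ((D + 4) * k.+1 * 2 ^ k.+1 + D * k * 2 ^ k.+1 + 2 + (k + r) + 1)%:R :> R); last first.
  by rewrite !natrD.
rewrite ler_nat.
have k2 : (k.+1 <= 2 ^ k.+1)%N by rewrite ltnW// ltn_expl.
move: (2 ^ k.+1)%N k2 => E kE.
have : (D * k * E <= D * k.+1 * E)%N by rewrite leq_mul2r leq_mul2l leqnSn !orbT.
have : (E <= k.+1 * E)%N by rewrite leq_pmull.
have : (k.+1 * E * D <= k.+1 * E * (4 * D))%N by rewrite leq_mul2l leq_pmull// orbT.
rewrite !mulnDl; move: (k.+1 * E)%N => F.
nia.
Qed.

(** At least [2 ^ level] coordinates are no smaller than [x j], and each contributes
    as much as [x j] to the norm. *)
Lemma level_coord (x : J -> R) j : \sum_j `|x j| `^ p <= 1 ->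
  `|x j| <= ((2^-1) ^+ level (fun j => `|x j| `^ p) j) `^ p^-1.
Proof.
move=> hx; set gx := fun j => _.
have h : gx j <= (2^-1) ^+ level gx j.
  rewrite exprVn -[leRHS]mul1r ler_pdivlMr ?exprn_gt0//.
  apply: le_trans hx; apply: (@le_trans _ _ (\sum_(j' | gx j <= gx j') gx j')); last first.
    rewrite [leRHS](bigID (fun j' => gx j <= gx j'))/= lerDl.
    by apply: sumr_ge0 => j' _; exact: powR_ge0.
  apply: (@le_trans _ _ (\sum_(j' | gx j <= gx j') gx j)); last exact: ler_sum.
  rewrite sumr_const -[leRHS]mulr_natl mulrC ler_wpM2r ?powR_ge0//.
  rewrite -natrX ler_nat; exact: level_rank.
have -> : `|x j| = gx j `^ p^-1.
  by rewrite /gx -powRrM mulfV ?lt0r_neq0// powRr1.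
by rewrite ler_wpowR ?invr_ge0 ?powR_ge0 ?(ltW p_gt0).
Qed.

(** Comparable levels: a crude description of rows and columns, affordable only
    when the variances [G k] decay. *)
Lemma balanced_bound : exists N : {ffun I * J -> bool} -> R,
  [/\ forall w, 0 <= N w, avg N <= 7 &
   forall w (x : J -> R) (y : I -> R) (l : I -> nat) (G : nat -> R),
     \sum_j `|x j| `^ p <= 1 -> \sum_i y i ^+ 2 <= 1 ->
     (forall t, #|[set i | (l i <= t)%N]| <= 2 ^ t.+1)%N ->
     (forall k, 0 <= G k) ->
     (forall k (J0 : {set J}), (#|J0| <= 2 ^ k.+1)%N ->
       \sum_(i | V (l i) k) \sum_(j in J0) y i ^+ 2 * a i j ^+ 2 <= G k ^+ 2) ->
     \sum_i \sum_j (V (l i) (level (fun j => `|x j| `^ p) j))%:R *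
        (a i j * sg w (i, j) * x j * y i) <=
     16 + N w * \sum_(k < #|J|.+1) 2 * ((2^-1) ^+ k) `^ p^-1 *
        Num.sqrt (balanced_entropy k 0) * G k].
Proof.
have [N [N0 Na Nb]] := forms; exists N; split => //.
move=> w x y l G hx hy hl G0 hG.
pose gx j := `|x j| `^ p; pose kx := level gx.
pose t i j := a i j * sg w (i, j) * x j * y i.
have x1 j : `|x j| <= 1 by exact: coord_le1 hx.
have y1 i : `|y i| <= 1.
  rewrite -(@ler_pXn2r _ 2)// ?nnegrE// expr1n -normrX ger0_norm ?sqr_ge0//.
  apply: le_trans hy; rewrite (bigD1 i)//= lerDl.
  by apply: sumr_ge0 => i' _; exact: sqr_ge0.
pose Ik k := [set i | V (l i) k].
pose Jk k := [set j | kx j == k].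
have split_sum : \sum_i \sum_j (V (l i) (kx j))%:R * t i j =
    \sum_(k < K) \sum_(i in Ik k) \sum_(j in Jk k) t i j by exact: sum_over_levels.
have cIk k : (#|Ik k| <= n1 k)%N.
  apply: leq_trans (hl k); apply: subset_leq_card.
  by apply/subsetP => i; rewrite !inE; exact: V_le.
have cJk k : (#|Jk k| <= n1 k)%N.
  apply: leq_trans (card_level_le gx k); apply: subset_leq_card.
  by apply/subsetP => j; rewrite !inE /kx => /eqP ->.
have block (k : 'I_K) : \sum_(i in Ik k) \sum_(j in Jk k) t i j <=
    8 * (2^-1) ^+ k + N w * (2 * ((2^-1) ^+ k) `^ p^-1 *
        Num.sqrt (balanced_entropy k 0) * G k).
  (* the cells outside [I0] and [J0] are below [8 ^- k], against a multiple of
     [4 ^ k] cells *)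
  pose I0 := [set i in Ik k | (i \in SI k) && ((8^-1) ^+ k <= `|y i|)].
  pose J0 := [set j in Jk k | j \in SJ k].
  have /choice[e he] : forall i, exists s, i \in I0 ->
      [/\ (s <= 3 * k)%N, `|y i| <= (2^-1) ^+ s & (2^-1) ^+ s <= 2 * `|y i|].
    move=> i; case: (boolP (i \in I0)) => [|_]; last by exists 0%N.
    rewrite inE => /and3P[_ _ yi].
    have [|s ?] := @dyadic_exponent R (3 * k) `|y i| _ (y1 i); last by exists s.
    by rewrite exprM (_ : (2^-1) ^+ 3 = 8^-1)//; field.
  pose good i j := (i \in I0) && (j \in J0).
  have split2 : \sum_(i in Ik k) \sum_(j in Jk k) t i j =
      \sum_(i in I0) \sum_(j in J0) t i j +
      \sum_(i in Ik k) \sum_(j in Jk k) (~~ good i j)%:R * t i j.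
    have -> : \sum_(i in I0) \sum_(j in J0) t i j =
        \sum_(i in Ik k) \sum_(j in Jk k) (good i j)%:R * t i j.
      rewrite [LHS]big_mkcond [RHS]big_mkcond; apply: eq_bigr => i _.
      rewrite /good; case: (boolP (i \in I0)) => [iI|_].
        rewrite (subsetP _ _ iI); last by apply/subsetP => i'; rewrite inE => /andP[].
        rewrite [LHS]big_mkcond [RHS]big_mkcond; apply: eq_bigr => j _.
        case: (boolP (j \in J0)) => [jJ|_] /=; last by rewrite mul0r if_same.
        rewrite (subsetP _ _ jJ) ?mul1r//.
        by apply/subsetP => j'; rewrite inE => /andP[].
      by case: ifP => // _; rewrite big1// => j _; rewrite mul0r.
    rewrite -big_split/=; apply: eq_bigr => i _; rewrite -big_split/=.
    by apply: eq_bigr => j _; case: good; rewrite /=; ring.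
  rewrite split2 addrC lerD//.
    have tb i j : i \in Ik k -> j \in Jk k -> (~~ good i j)%:R * t i j <= (8^-1) ^+ k.
      move=> iI jJ; case: (boolP (good i j)) => [_|]; first by rewrite mul0r exprn_ge0.
      rewrite mul1r /good /I0 /J0 !inE in iI jJ *; rewrite iI jJ/= => hn.
      rewrite (le_trans (ler_norm _))// /t !normrM normr_sg1 mulr1 (ger0_norm (a_ge0 _ _)).
      have [ha|ha] := leP (a i j) (8^-1 ^+ k).
        by rewrite -[leRHS]mulr1 -[leRHS]mulr1 !ler_pM ?mulr_ge0.
      have ya : `|y i| < 8^-1 ^+ k.
        rewrite ltNge; apply/negP => hy8; move/negP: hn; apply.
        rewrite hy8 andbT; apply/andP; split; first by apply/existsP; exists j.
        by apply/existsP; exists i.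
      by apply: le_trans (ltW ya); rewrite -[leRHS]mul1r ler_wpM2r// mulr_ile1.
    apply: (@le_trans _ _ (\sum_(i in Ik k) \sum_(j in Jk k) (8^-1) ^+ k)).
      by apply: ler_sum => i iI; apply: ler_sum => j jJ; exact: tb.
    rewrite !sumr_const -mulrnA -[leLHS]mulr_natl.
    have cnt : (#|Jk k| * #|Ik k| <= 8 * (4 ^ k))%N.
      apply: (@leq_trans (2 ^ k.+1 * 2 ^ k.+1)); first by apply: leq_mul.
      rewrite -expnMn expnS leq_mul2r; apply/orP; right; lia.
    apply: (@le_trans _ _ ((8 * 4 ^ k)%:R * (8^-1) ^+ k)).
      by rewrite ler_wpM2r ?exprn_ge0// ler_nat.
    by rewrite natrM natrX -mulrA -exprMn (_ : 4 * 8^-1 = 2^-1 :> R); [|field].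
  pose X := ((2^-1) ^+ k) `^ p^-1 : R.
  have xX : {in J0, forall j, `|x j| <= X}.
    move=> j; rewrite !inE => /andP[/eqP kj _].
    by have := @level_coord x j hx; rewrite -/gx -/(kx j) kj.
  have cJ0 : (#|J0| <= 2 ^ k.+1)%N.
    by apply: leq_trans (cJk k); apply: subset_leq_card; apply/subsetP => j; rewrite inE => /andP[].
  have cI0 : (#|I0| <= n1 k)%N.
    by apply: leq_trans (cIk k); apply: subset_leq_card; apply/subsetP => i; rewrite inE => /andP[].
  have var : \sum_(i in I0) \sum_(j in J0) ((2^-1) ^+ e i) ^+ 2 * a i j ^+ 2 <= (2 * G k) ^+ 2.
    rewrite exprMn -natrX; apply: le_trans (ler_wpM2l _ (hG k J0 cJ0)) => //.
    rewrite mulr_sumr [leRHS](bigID (mem I0))/= -[leLHS]addr0 lerD//; last first.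
      apply: sumr_ge0 => i _; rewrite mulr_ge0//; apply: sumr_ge0 => j _.
      by rewrite mulr_ge0 ?sqr_ge0.
    rewrite [leRHS](eq_bigl (fun i => i \in I0)); last first.
      move=> i; case: (boolP (i \in I0)); last by rewrite andbF.
      by rewrite inE => /andP[]; rewrite inE => ->.
    apply: ler_sum => i iI; rewrite mulr_sumr; apply: ler_sum => j _.
    rewrite [leRHS]mulrA ler_wpM2r ?sqr_ge0//; have [_ _ h] := he i iI.
    have -> : (2 ^ 2)%:R * y i ^+ 2 = (2 * `|y i|) ^+ 2.
      by rewrite exprMn real_normK ?num_real// natrX.
    by rewrite ler_sqr ?nnegrE ?mulr_ge0 ?exprn_ge0.
  have I0S : I0 \subset SI k by apply/subsetP => i; rewrite inE => /and3P[].
  have J0S : J0 \subset SJ k by apply/subsetP => j; rewrite inE => /andP[].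
  have X0 : 0 <= X by exact: powR_ge0.
  have := Nb w k 0%N I0 e J0 x y X (2 * G k) (ltn_ord k) (ltn0Sn _) I0S cI0
    (fun i iI => let: And3 h _ _ := he i iI in h) (fun i iI => let: And3 _ h _ := he i iI in h)
    J0S cJ0 xX var X0 (mulr_ge0 (ler0n R 2) (G0 k)).
  move=> /le_trans; apply.
  by rewrite le_eqVlt; apply/orP; left; apply/eqP; rewrite /X; ring.
rewrite split_sum; apply: (le_trans (ler_sum _ (fun k _ => block k))).
rewrite big_split/= -!mulr_sumr lerD2r.
have := sum_geometric_half (R := R) K; lra.
Qed.

End Balanced.

(** * Polynomials in signs *)

Lemma cauchy_schwarz_sum {R : realFieldType} (I : finType) (f g : I -> R) :
  (\sum_i f i * g i) ^+ 2 <= (\sum_i f i ^+ 2) * (\sum_i g i ^+ 2).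
Proof.
have : 0 <= \sum_i \sum_j (f i * g j - f j * g i) ^+ 2.
  by apply: sumr_ge0 => i _; apply: sumr_ge0 => j _; exact: sqr_ge0.
have -> : \sum_i \sum_j (f i * g j - f j * g i) ^+ 2 =
    2 * ((\sum_i f i ^+ 2) * (\sum_i g i ^+ 2)) - 2 * (\sum_i f i * g i) ^+ 2.
  transitivity (\sum_i \sum_j (f i ^+ 2 * g j ^+ 2 + f j ^+ 2 * g i ^+ 2
      - 2 * ((f i * g i) * (f j * g j)))).
    by apply: eq_bigr => i _; apply: eq_bigr => j _; ring.
  under eq_bigr do rewrite big_split big_split/= sumrN -mulr_sumr -mulr_sumr -mulr_suml -mulr_sumr.
  rewrite big_split big_split/= -mulr_suml -mulr_sumr sumrN -mulr_sumr -mulr_suml.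
  by ring.
by lra.
Qed.

Section SignedWords.
Context {R : realType} (E : finType).
Notation sgn := {ffun E -> bool}.

Definition sgword (w : sgn) (s : seq E) : R := \prod_(x <- s) sg w x.

(** The words of mean one; all the others have mean zero. *)
Definition even_word (s : seq E) := [forall x, ~~ odd (count_mem x s)].

Lemma sgword_cat w s t : sgword w (s ++ t) = sgword w s * sgword w t.
Proof. by rewrite /sgword big_cat. Qed.

Lemma avg_sgword s : avg (fun w => sgword w s) = (even_word s)%:R.
Proof.
have h w : sgword w s = \prod_x ((-1) ^+ w x) ^+ count_mem x s.
  rewrite /sgword; elim: s => [|x s ih].
    by rewrite big_nil big1// => x _; rewrite expr0.
  rewrite big_cons ih /sg/= -[X in X * _](@big_pred1_eq _ _ *%R _ x (fun y => (-1) ^+ w y)).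
  rewrite big_mkcond -big_split/=; apply: eq_bigr => y _; rewrite exprD eq_sym.
  by case: (eqVneq x y) => _; rewrite ?expr1 ?expr0.
under eq_avg do rewrite h.
rewrite (avg_prod (fun x b => ((-1) ^+ b) ^+ count_mem x s)) /even_word.
case: (boolP [forall x, _]) => [/forallP hs|/forallPn[x]].
  by apply: big1 => x _; rewrite expr0 expr1 expr1n -signr_odd (negbTE (hs x)) expr0; field.
by rewrite negbK => hx; rewrite (bigD1 x)//= expr0 expr1 expr1n -signr_odd hx expr1 addNr mul0r mul0r.
Qed.

(** A polynomial in the signs with nonnegative coefficients, together with its
    Euler derivatives x_e d/dx_e evaluated at the signs. *)
Definition sign_poly (F : sgn -> R) (F' : E -> sgn -> R) :=
  exists l : seq (R * seq E),
    [/\ all (fun c => 0 <= c.1) l,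
        forall w, F w = \sum_(c <- l) c.1 * sgword w c.2 &
        forall e w, F' e w = \sum_(c <- l) c.1 * (count_mem e c.2)%:R * sgword w c.2].

Lemma sign_poly_ext F F' G G' : (forall w, F w = G w) -> (forall e w, F' e w = G' e w) ->
  sign_poly F F' -> sign_poly G G'.
Proof. by move=> h h' [l [l0 l1 l2]]; exists l; split => // *; rewrite -?h -?h'. Qed.

Lemma sign_poly_cst (c : R) : 0 <= c -> sign_poly (fun=> c) (fun _ _ => 0).
Proof.
move=> c0; exists [:: (c, [::])]; split => [|w|e w]; first by rewrite /= c0.
  by rewrite big_seq1 /sgword big_nil mulr1.
by rewrite big_seq1/= mulr0 mul0r.
Qed.

Lemma sign_poly_var (c : R) x : 0 <= c ->
  sign_poly (fun w => c * sg w x) (fun e w => c * sg w x * (x == e)%:R).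
Proof.
move=> c0; exists [:: (c, [:: x])]; split => [|w|e w]; first by rewrite /= c0.
  by rewrite big_seq1 /sgword big_seq1.
by rewrite big_seq1 /sgword big_seq1/= addn0 mulrAC.
Qed.

Lemma sign_polyD F F' G G' : sign_poly F F' -> sign_poly G G' ->
  sign_poly (fun w => F w + G w) (fun e w => F' e w + G' e w).
Proof.
move=> [l [l0 l1 l2]] [k [k0 k1 k2]]; exists (l ++ k); split => [|w|e w].
- by rewrite all_cat l0.
- by rewrite l1 k1 big_cat.
- by rewrite l2 k2 big_cat.
Qed.

Lemma sign_polyM F F' G G' : sign_poly F F' -> sign_poly G G' ->
  sign_poly (fun w => F w * G w) (fun e w => F' e w * G w + F w * G' e w).
Proof.
move=> [l [l0 l1 l2]] [k [k0 k1 k2]].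
exists [seq (c.1 * d.1, c.2 ++ d.2) | c <- l, d <- k]; split => [|w|e w].
- apply/allP => _ /allpairsP[[c d] [/= cl dk ->]]/=.
  by rewrite mulr_ge0//; [have := allP l0 _ cl|have := allP k0 _ dk].
- rewrite l1 k1 big_allpairs_dep mulr_suml/=; apply: eq_bigr => c _.
  rewrite mulr_sumr; apply: eq_bigr => d _; rewrite /= sgword_cat; ring.
- rewrite l1 l2 k1 k2 big_allpairs_dep/= !mulr_suml -big_split/=; apply: eq_bigr => c _.
  rewrite !mulr_sumr -big_split/=; apply: eq_bigr => d _.
  by rewrite sgword_cat count_cat natrD; ring.
Qed.

Lemma sign_poly_sum (I : finType) (F : I -> sgn -> R) F' :
  (forall i, sign_poly (F i) (F' i)) ->
  sign_poly (fun w => \sum_i F i w) (fun e w => \sum_i F' i e w).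
Proof.
move=> h; elim: (index_enum I) => [|i r ih].
  by apply: sign_poly_ext (sign_poly_cst (lexx 0)) => *; rewrite big_nil.
by apply: sign_poly_ext (sign_polyD (h i) ih) => *; rewrite big_cons.
Qed.

Lemma avg_sum_seq (l : seq (R * seq E)) (f : R * seq E -> sgn -> R) :
  avg (fun w => \sum_(c <- l) f c w) = \sum_(c <- l) avg (f c).
Proof. by rewrite /avg exchange_big mulr_suml. Qed.

Lemma avg_sign_poly_ge0 F F' : sign_poly F F' -> 0 <= avg F.
Proof.
move=> [l [/allP l0 l1 _]]; rewrite (eq_avg l1) avg_sum_seq big_seq.
by apply: sumr_ge0 => c /l0 c0; rewrite avgZ avg_sgword mulr_ge0.
Qed.

Lemma sgword_cons w x s : sgword w (x :: s) = sg w x * sgword w s.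
Proof. by rewrite /sgword big_cons. Qed.

(** Integration by parts: [sg w e] is averaged out except against monomials of odd
    degree in it, which the Euler derivative counts at least once. *)
Lemma avg_ibp F F' e : sign_poly F F' ->
  avg (fun w => sg w e * F w) <= avg (fun w => sg w e * F' e w).
Proof.
move=> [l [/allP l0 l1 l2]].
have -> : avg (fun w => sg w e * F w) = \sum_(c <- l) c.1 * (even_word (e :: c.2))%:R.
  rewrite (@eq_avg _ _ _ (fun w => \sum_(c <- l) c.1 * sgword w (e :: c.2))).
    by rewrite avg_sum_seq; apply: eq_bigr => c _; rewrite avgZ avg_sgword.
  by move=> w; rewrite l1 mulr_sumr; apply: eq_bigr => c _; rewrite sgword_cons mulrCA.
have -> : avg (fun w => sg w e * F' e w) =
    \sum_(c <- l) c.1 * (count_mem e c.2)%:R * (even_word (e :: c.2))%:R.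
  rewrite (@eq_avg _ _ _ (fun w => \sum_(c <- l) c.1 * (count_mem e c.2)%:R * sgword w (e :: c.2))).
    by rewrite avg_sum_seq; apply: eq_bigr => c _; rewrite avgZ avg_sgword.
  by move=> w; rewrite l2 mulr_sumr; apply: eq_bigr => c _; rewrite sgword_cons mulrCA.
rewrite big_seq [leRHS]big_seq; apply: ler_sum => c /l0 c0.
case: (boolP (even_word _)) => [/forallP/(_ e)|_]; last by rewrite !mulr0.
by rewrite /= eqxx/= negbK !mulr1 => oc; rewrite ler_peMr// ler1n odd_gt0.
Qed.

(** When the product of two monomials is even and the factors are not, some sign
    occurs an odd number of times in both, and the Euler derivatives see it. *)
Lemma avg_mul_le F F' G G' : sign_poly F F' -> sign_poly G G' ->
  avg (fun w => F w * G w) <= avg F * avg G + \sum_e avg (fun w => F' e w * G' e w).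
Proof.
move=> [l [/allP l0 l1 l2]] [k [/allP k0 k1 k2]].
have -> : avg (fun w => F w * G w) =
    \sum_(c <- l) \sum_(d <- k) c.1 * d.1 * (even_word (c.2 ++ d.2))%:R.
  rewrite (@eq_avg _ _ _ (fun w => \sum_(c <- l) \sum_(d <- k) c.1 * d.1 * sgword w (c.2 ++ d.2))).
    rewrite avg_sum_seq; apply: eq_bigr => c _; rewrite avg_sum_seq; apply: eq_bigr => d _.
    by rewrite avgZ avg_sgword.
  move=> w; rewrite l1 k1 mulr_suml; apply: eq_bigr => c _.
  by rewrite mulr_sumr; apply: eq_bigr => d _; rewrite /= sgword_cat; ring.
have -> : avg F * avg G =
    \sum_(c <- l) \sum_(d <- k) c.1 * d.1 * ((even_word c.2)%:R * (even_word d.2)%:R).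
  rewrite (eq_avg l1) (eq_avg k1) !avg_sum_seq mulr_suml; apply: eq_bigr => c _.
  by rewrite mulr_sumr; apply: eq_bigr => d _; rewrite !avgZ !avg_sgword; ring.
have -> : \sum_e avg (fun w => F' e w * G' e w) =
    \sum_(c <- l) \sum_(d <- k) c.1 * d.1 *
      ((\sum_e (count_mem e c.2)%:R * (count_mem e d.2)%:R) * (even_word (c.2 ++ d.2))%:R).
  transitivity (\sum_e \sum_(c <- l) \sum_(d <- k) c.1 * d.1 *
      ((count_mem e c.2)%:R * (count_mem e d.2)%:R * (even_word (c.2 ++ d.2))%:R)).
    apply: eq_bigr => e _.
    rewrite (@eq_avg _ _ _ (fun w => \sum_(c <- l) \sum_(d <- k)
      (c.1 * d.1 * ((count_mem e c.2)%:R * (count_mem e d.2)%:R)) * sgword w (c.2 ++ d.2))).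
      rewrite avg_sum_seq; apply: eq_bigr => c _; rewrite avg_sum_seq; apply: eq_bigr => d _.
      by rewrite avgZ avg_sgword; ring.
    move=> w; rewrite l2 k2 mulr_suml; apply: eq_bigr => c _.
    by rewrite mulr_sumr; apply: eq_bigr => d _; rewrite /= sgword_cat; ring.
  rewrite exchange_big; apply: eq_bigr => c _; rewrite exchange_big; apply: eq_bigr => d _/=.
  by rewrite -mulr_sumr -mulr_suml.
rewrite -big_split/= big_seq [leRHS]big_seq; apply: ler_sum => c /l0 c0.
rewrite -big_split/= big_seq [leRHS]big_seq; apply: ler_sum => d /k0 d0.
rewrite -mulrDr ler_wpM2l ?mulr_ge0//.
have s0 : 0 <= \sum_e (count_mem e c.2)%:R * (count_mem e d.2)%:R :> R.
  by apply: sumr_ge0 => e _; rewrite mulr_ge0.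
case: (boolP (even_word (c.2 ++ d.2))) => [/forallP hcd|_]; last first.
  by rewrite mulr0 addr0 mulr_ge0.
rewrite mulr1; have [/forallP hc|/forallPn[e]] := boolP (even_word c.2).
  have -> : even_word d.2.
    by apply/forallP => x; have := hcd x; have := hc x; rewrite count_cat oddD; case: odd.
  by rewrite mulr1 lerDl.
rewrite negbK => ec; rewrite mul0r add0r (bigD1 e)//=.
have ed : odd (count_mem e d.2).
  by have := hcd e; rewrite count_cat oddD ec; case: odd.
have : (1 : R) <= (count_mem e c.2)%:R * (count_mem e d.2)%:R.
  by rewrite -natrM ler1n muln_gt0; case: count ec => //; case: count ed.
move=> /le_trans; apply; rewrite lerDl; apply: sumr_ge0 => x _.
by rewrite mulr_ge0.
Qed.

End SignedWords.

(** * Moments of a symmetric matrix with random signs *)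

Section LogConvex.
Context {R : realType}.

(** The roots of order [k] of a log-convex sequence starting at 1 are nondecreasing
    in [k]; [rho] is the one of order [M]. *)
Lemma log_convex_root (mu : nat -> R) (M : nat) :
  (forall k, 0 <= mu k) -> mu 0 = 1 -> (forall k, mu k.+1 ^+ 2 <= mu k * mu k.+2) ->
  exists2 rho, 0 <= rho & (forall i, (i <= M)%N -> mu i <= rho ^+ i) /\ rho ^+ M <= mu M.
Proof.
move=> mu0 mu1 lc.
have step k : mu k ^+ k.+1 <= mu k.+1 ^+ k.
  elim: k => [|k ih]; first by rewrite mu1 expr1.
  have := mu0 k.+1; rewrite le_eqVlt => /predU1P[z|mk].
    by rewrite -z expr0n/= exprn_ge0.
  rewrite -(@ler_pM2l _ (mu k.+1 ^+ k)) ?exprn_gt0//.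
  apply: (@le_trans _ _ ((mu k * mu k.+2) ^+ k.+1)).
    rewrite -exprD (_ : (k + k.+2 = 2 * k.+1)%N); last by lia.
    by rewrite exprM lerXn2r ?nnegrE ?sqr_ge0 ?mulr_ge0.
  by rewrite exprMn ler_wpM2r// exprn_ge0.
have chain i m : (i <= m)%N -> mu i ^+ m <= mu m ^+ i.
  elim: m => [|m ih]; first by rewrite leqn0 => /eqP ->.
  rewrite leq_eqVlt => /predU1P[->//|]; rewrite ltnS => im.
  case: m => [|m] in ih im *; first by move: im; rewrite leqn0 => /eqP ->; rewrite mu1 expr1n expr0.
  rewrite -(@ler_pXn2r _ m.+1) ?nnegrE ?exprn_ge0//.
  rewrite -exprM mulnC exprM.
  apply: (@le_trans _ _ ((mu m.+1 ^+ i) ^+ m.+2)).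
    by rewrite lerXn2r ?nnegrE ?exprn_ge0 ?ih.
  rewrite -exprM mulnC exprM -exprM -exprM [leRHS](_ : _ = (mu m.+2 ^+ m.+1) ^+ i).
    by rewrite exprM lerXn2r ?nnegrE ?exprn_ge0.
  by rewrite -!exprM mulnC.
case: M => [|M]; first by exists 0 => //; split=> [i|]; rewrite ?expr0 ?mu1// leqn0 => /eqP ->; rewrite mu1 expr0.
exists (mu M.+1 `^ M.+1%:R^-1); first exact: powR_ge0.
have rM : (mu M.+1 `^ M.+1%:R^-1) ^+ M.+1 = mu M.+1.
  by rewrite -powR_mulrn ?powR_ge0// -powRrM mulVf ?pnatr_eq0// powRr1.
split; last by rewrite rM.
move=> i iM; rewrite -(@ler_pXn2r _ M.+1) ?nnegrE ?exprn_ge0 ?powR_ge0//.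
by rewrite -exprM mulnC exprM rM chain.
Qed.

End LogConvex.

Section InverseSquares.
Context {R : realType}.

Lemma sum_inv_sqr n : \sum_(b < n) (b.+1%:R ^- 2) <= 2 :> R.
Proof.
case: n => [|n]; first by rewrite big_ord0.
suff : \sum_(b < n.+1) (b.+1%:R ^- 2) <= 2 - n.+1%:R^-1 :> R.
  by move=> /le_trans; apply; rewrite gerBl.
elim: n => [|n ih]; first by rewrite big_ord1 expr1n invr1; lra.
rewrite big_ord_recr/=; apply: (le_trans (lerD ih (lexx _))).
have -> : n.+2%:R = n.+1%:R + 1 :> R by rewrite -natr1.
have : 0 < n.+1%:R :> R by [].
move: (n.+1%:R : R) => x x0.
have x1 : 0 < x + 1 by lra.
have : (x + 1) ^- 2 <= (x * (x + 1))^-1.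
  by rewrite lef_pV2 ?posrE ?exprn_gt0 ?mulr_gt0//; nra.
have -> : (x * (x + 1))^-1 = x^-1 - (x + 1)^-1.
  by field; rewrite !lt0r_neq0.
lra.
Qed.

(** The larger of [p] and [q] is at least their mean, which makes inverse squares
    stable under convolution. *)
Lemma inv_sqr_mul_le (p q : R) : 0 < p -> 0 < q ->
  p ^- 2 * q ^- 2 <= 4 * (p + q) ^- 2 * (p ^- 2 + q ^- 2).
Proof.
move=> p0 q0; have pq : 0 < p + q by rewrite addr_gt0.
rewrite -subr_ge0.
have -> : 4 * (p + q) ^- 2 * (p ^- 2 + q ^- 2) - p ^- 2 * q ^- 2 =
    (4 * (p ^+ 2 + q ^+ 2) - (p + q) ^+ 2) / (p ^+ 2 * q ^+ 2 * (p + q) ^+ 2).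
  by field; rewrite !lt0r_neq0.
apply: divr_ge0; first by have := sqr_ge0 (p - q); nra.
by rewrite mulr_ge0 ?sqr_ge0// mulr_ge0 ?sqr_ge0.
Qed.

(** Inverse squares thus play the part of the generating function of the Catalan
    numbers: they absorb the convolution in the recursion for the moments. *)
Lemma sum_conv_inv_sqr m :
  \sum_(a < m.+1) (a.+1%:R ^- 2) * ((m - a).+1%:R ^- 2) <= 16 * m.+2%:R ^- 2 :> R.
Proof.
set s := m.+2%:R ^- 2; have s0 : 0 <= s :> R by rewrite invr_ge0 exprn_ge0.
apply: (@le_trans _ _ (\sum_(a < m.+1) 4 * s * (a.+1%:R ^- 2 + (m - a).+1%:R ^- 2))).
  apply: ler_sum => a _; apply: le_trans (inv_sqr_mul_le _ _) _ => //.
  rewrite -natrD (_ : a.+1 + (m - a).+1 = m.+2)%N//.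
  by rewrite addnS addSn subnKC//; have := ltn_ord a; rewrite ltnS.
rewrite -mulr_sumr big_split/=.
have -> : \sum_(a < m.+1) (m - a).+1%:R ^- 2 = \sum_(a < m.+1) a.+1%:R ^- 2 :> R.
  by rewrite [RHS](reindex_inj rev_ord_inj)/=; apply: eq_bigr => a _; rewrite subSS.
have := sum_inv_sqr m.+1; set S := \sum_(_ < _) _ => S2.
have : 4 * s * (S + S) <= 4 * s * 4 by rewrite ler_wpM2l ?mulr_ge0//; lra.
lra.
Qed.

End InverseSquares.

Section Walks.
Context {R : realType} (V E : finType) (b : V -> V -> R) (e : V -> V -> E) (tau : R).
Hypothesis b_ge0 : forall u v, 0 <= b u v.
Hypothesis b_sym : forall u v, b u v = b v u.
Hypothesis b_diag : forall u, b u u = 0.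
Hypothesis e_sym : forall u v, e u v = e v u.
Hypothesis e_inj : forall u v u' v', b u v != 0 -> b u' v' != 0 -> e u v = e u' v' ->
  (u' = u /\ v' = v) \/ (u' = v /\ v' = u).
Hypothesis b_row : forall u, \sum_v b u v ^+ 2 <= 1.
Hypothesis b_tau : forall u v, b u v ^+ 2 <= tau.
Notation sgn := {ffun E -> bool}.

(** A weighted graph with one sign per edge: [e u v] is the edge between [u] and
    [v], so that [smx w] is a symmetric random matrix. *)
Definition smx (w : sgn) u v := b u v * sg w (e u v).

(** Signed weight of the walks of length [k] from [u] to [v]: an entry of the [k]-th
    power of [smx w]. *)
Fixpoint walk (w : sgn) k u v : R :=
  if k is k'.+1 then \sum_s smx w u s * walk w k' s v else (u == v)%:R.

Let smxE f w u v := smx w u v * (e u v == f)%:R.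

(** The Euler derivative of [walk] in the sign of the edge [f]. *)
Fixpoint dwalk (f : E) (w : sgn) k u v : R :=
  if k is k'.+1 then
    \sum_s (smxE f w u s * walk w k' s v + smx w u s * dwalk f w k' s v)
  else 0.

Lemma smx_sym w u v : smx w u v = smx w v u.
Proof. by rewrite /smx b_sym e_sym. Qed.

Lemma sum_delta (f : V -> R) u : \sum_s (u == s)%:R * f s = f u.
Proof.
rewrite (bigD1 u)//= eqxx mul1r big1 ?addr0// => s su.
by rewrite eq_sym (negbTE su) mul0r.
Qed.

Lemma walkD w s t u v : walk w (s + t) u v = \sum_r walk w s u r * walk w t r v.
Proof.
elim: s u => [|s ih] u; first by rewrite /= sum_delta.
rewrite /=; under [LHS]eq_bigr do rewrite ih mulr_sumr.
rewrite exchange_big/=; apply: eq_bigr => r _; rewrite mulr_suml.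
by apply: eq_bigr => r' _; rewrite mulrA.
Qed.

Lemma walk1 w u v : walk w 1 u v = smx w u v.
Proof.
rewrite /=; under eq_bigr do rewrite mulrC eq_sym.
by rewrite sum_delta.
Qed.

Lemma walk_sym w k u v : walk w k u v = walk w k v u.
Proof.
elim: k u v => [|k ih] u v; first by rewrite /= eq_sym.
rewrite -[in RHS]addn1 walkD; apply: eq_bigr => s _.
by rewrite walk1 mulrC ih smx_sym.
Qed.

Lemma walk_poly k u v : sign_poly (fun w => walk w k u v) (fun f w => dwalk f w k u v).
Proof.
elim: k u v => [|k ih] u v; first exact: sign_poly_cst.
by apply: sign_poly_sum => s; apply: sign_polyM; [exact: sign_poly_var|exact: ih].
Qed.

Lemma dwalkE f w k u v : dwalk f w k u v =
  \sum_(t < k) \sum_r \sum_s walk w t u r * smxE f w r s * walk w (k - t.+1) s v.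
Proof.
elim: k u => [|k ih] u; first by rewrite big_ord0.
rewrite big_ord_recl/= big_split/=; congr (_ + _).
  rewrite subSS subn0 -[LHS](sum_delta (fun r => \sum_s smxE f w r s * walk w k s v)).
  by apply: eq_bigr => r _; rewrite mulr_sumr; apply: eq_bigr => s _; rewrite mulrA.
under eq_bigr do rewrite ih mulr_sumr.
rewrite exchange_big/=; apply: eq_bigr => t _.
under eq_bigr do rewrite mulr_sumr.
rewrite exchange_big/=; apply: eq_bigr => r _.
under eq_bigr do rewrite mulr_sumr.
rewrite exchange_big/=; apply: eq_bigr => s _.
by rewrite !mulr_suml; apply: eq_bigr => s' _; rewrite subSS; ring.
Qed.

(** Diagonal entry of an even power, hence a moment of a positive measure. *)
Definition loop (w : sgn) u k := walk w k.*2 u u.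

Lemma loop_sqr w u k : loop w u k = \sum_v walk w k u v ^+ 2.
Proof.
by rewrite /loop -addnn walkD; apply: eq_bigr => v _; rewrite [walk w k v u]walk_sym expr2.
Qed.

Lemma loop_ge0 w u k : 0 <= loop w u k.
Proof. by rewrite loop_sqr; apply: sumr_ge0 => v _; exact: sqr_ge0. Qed.

Lemma walk_sqr_le w s t u v : walk w (s + t) u v ^+ 2 <= loop w u s * loop w v t.
Proof.
rewrite walkD !loop_sqr; under [X in _ <= _ * X]eq_bigr do rewrite walk_sym.
exact: cauchy_schwarz_sum.
Qed.

Lemma loop_log_convex w u k : loop w u k.+1 ^+ 2 <= loop w u k * loop w u k.+2.
Proof.
have := walk_sqr_le w k k.+2 u u; rewrite addnS -addSn.
by rewrite addnn.
Qed.

Lemma loop0 w u : loop w u 0 = 1.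
Proof. by rewrite /loop/= eqxx. Qed.

(** Two walks from [v] to [u] of total length [2 M] are compared with closed walks
    of length [2 M]: Cauchy-Schwarz splits each of them into a piece at [v] and a
    piece at [u], and log-convexity puts all pieces at the common length. *)
Lemma walk_mul_le w A B M u v : (A + B = M.*2)%N ->
  walk w A v u * walk w B v u <= loop w v M + loop w u M.
Proof.
move=> AB.
have [rv rv0 [hv hvM]] := @log_convex_root R (loop w v) M (loop_ge0 w v)
   (loop0 w v) (loop_log_convex w v).
have [ru ru0 [hu huM]] := @log_convex_root R (loop w u) M (loop_ge0 w u)
   (loop0 w u) (loop_log_convex w u).
pose rho := Num.max rv ru.
have rho0 : 0 <= rho by rewrite le_max rv0.
have half_le n : (n <= M.*2)%N -> walk w n v u ^+ 2 <= rho ^+ n.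
  move=> nM; have nE : (n = n./2 + uphalf n)%N by rewrite addnC uphalf_half -addnA addnn odd_double_half.
  rewrite {1}nE; apply: le_trans (walk_sqr_le _ _ _ _ _) _.
  rewrite {3}nE exprD; apply: ler_pM; rewrite ?loop_ge0//.
    apply: le_trans (hv _ _) _; first by lia.
    by rewrite lerXn2r ?nnegrE// le_max lexx.
  apply: le_trans (hu _ _) _; first by lia.
  by rewrite lerXn2r ?nnegrE// le_max lexx orbT.
have hA : walk w A v u ^+ 2 <= rho ^+ A by apply: half_le; lia.
have hB : walk w B v u ^+ 2 <= rho ^+ B by apply: half_le; lia.
apply: (@le_trans _ _ (rho ^+ M)).
  apply: le_trans (ler_norm _) _.
  rewrite -(@ler_pXn2r _ 2) ?nnegrE ?exprn_ge0// -normrX ger0_norm ?sqr_ge0//.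
  by rewrite exprMn -exprM muln2 -AB exprD ler_pM ?sqr_ge0.
rewrite /rho; case: (leP rv ru) => _.
  by rewrite (le_trans huM)// lerDr loop_ge0.
by rewrite (le_trans hvM)// lerDl loop_ge0.
Qed.

(** Edges are simple, hence a sign is repeated only by crossing the same edge, in
    either direction. *)
Lemma edge_pair w u v r s : smx w u v * smxE (e u v) w r s =
  b u v ^+ 2 * ((r == u)%:R * (s == v)%:R + (r == v)%:R * (s == u)%:R).
Proof.
rewrite /smxE /smx; have [b0|b0] := eqVneq (b u v) 0; first by rewrite b0 expr0n/= !mul0r.
have uv : u != v by apply: contra_neq b0 => ->; exact: b_diag.
have [c0|c0] := eqVneq (b r s) 0.
  rewrite c0 mul0r mul0r mulr0; case: (eqVneq r u) => [ru|_].
    case: (eqVneq s v) => [sv|_]; first by rewrite -ru -sv c0 eqxx in b0.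
    rewrite mulr0 add0r; case: (eqVneq r v) => [rv|_]; last by rewrite mul0r mulr0.
    by rewrite -ru -rv eqxx in uv.
  rewrite mul0r add0r; case: (eqVneq r v) => [rv|_]; last by rewrite mul0r mulr0.
  case: (eqVneq s u) => [su|_]; last by rewrite !mulr0.
  by rewrite b_sym -rv -su c0 eqxx in b0.
have [ee|ee] := eqVneq (e r s) (e u v); last first.
  rewrite !mulr0; case: (eqVneq r u) => [ru|_].
    case: (eqVneq s v) => [sv|_]; first by rewrite ru sv eqxx in ee.
    rewrite mulr0 add0r; case: (eqVneq r v) => [rv|_]; last by rewrite mul0r mulr0.
    by rewrite -ru -rv eqxx in uv.
  rewrite mul0r add0r; case: (eqVneq r v) => [rv|_]; last by rewrite mul0r mulr0.
  case: (eqVneq s u) => [su|_]; last by rewrite !mulr0.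
  by rewrite rv su e_sym eqxx in ee.
rewrite mulr1 ee mulrACA sg_sqr mulr1.
have [[-> ->]|[-> ->]] := e_inj b0 c0 (esym ee).
  by rewrite !eqxx (negbTE uv) mul0r addr0 !mulr1 expr2.
by rewrite !eqxx eq_sym (negbTE uv) mul0r add0r !mulr1 expr2 [b v u]b_sym.
Qed.

Lemma sum_edges w r s r' s' : \sum_f smxE f w r s * smxE f w r' s' =
  b r s ^+ 2 * ((r' == r)%:R * (s' == s)%:R + (r' == s)%:R * (s' == r)%:R).
Proof.
rewrite -(edge_pair w) (bigD1 (e r s))//= {1}/smxE eqxx mulr1 big1 ?addr0// => f fe.
by rewrite /smxE eq_sym (negbTE fe) mulr0 mul0r.
Qed.

Lemma dwalk_pairE f w k u v : dwalk f w k u v = \sum_(p : 'I_k * V * V)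
  (walk w p.1.1 u p.1.2 * walk w (k - p.1.1.+1) p.2 v) * smxE f w p.1.2 p.2.
Proof.
rewrite dwalkE pair_bigA/= pair_bigA/=; apply: eq_bigr => -[[t r] s] _/=.
by rewrite mulrAC.
Qed.

Lemma sum_two_deltas (g : V -> V -> R) r s :
  \sum_r' \sum_s' g r' s' * ((r' == r)%:R * (s' == s)%:R) = g r s.
Proof.
rewrite (bigD1 r)//= [X in _ + X]big1 ?addr0; last first.
  by move=> r' r'r; rewrite big1// => s' _; rewrite (negbTE r'r) mul0r mulr0.
rewrite (bigD1 s)//= !eqxx !mulr1 big1 ?addr0// => s' s's.
by rewrite (negbTE s's) !mulr0.
Qed.

Lemma sum_dwalk w t t' u v : \sum_f dwalk f w t v v * dwalk f w t' u u =
  \sum_(i < t) \sum_(i' < t') \sum_r \sum_s b r s ^+ 2 *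
    (walk w i v r * walk w (t - i.+1) s v * (walk w i' u r * walk w (t' - i'.+1) s u) +
     walk w i v r * walk w (t - i.+1) s v * (walk w i' u s * walk w (t' - i'.+1) r u)).
Proof.
transitivity (\sum_(p : 'I_t * V * V) \sum_(p' : 'I_t' * V * V)
  (walk w p.1.1 v p.1.2 * walk w (t - p.1.1.+1) p.2 v) *
  (walk w p'.1.1 u p'.1.2 * walk w (t' - p'.1.1.+1) p'.2 u) *
  \sum_f smxE f w p.1.2 p.2 * smxE f w p'.1.2 p'.2).
  under eq_bigr do rewrite !dwalk_pairE mulr_suml.
  rewrite exchange_big/=; apply: eq_bigr => p _.
  under eq_bigr do rewrite mulr_sumr.
  rewrite exchange_big/=; apply: eq_bigr => p' _.
  by rewrite mulr_sumr; apply: eq_bigr => f _; ring.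
under eq_bigr do under eq_bigr do rewrite sum_edges.
rewrite -(pair_bigA _ (fun (q : 'I_t * V) s => \sum_(p' : 'I_t' * V * V)
  (walk w q.1 v q.2 * walk w (t - q.1.+1) s v) *
  (walk w p'.1.1 u p'.1.2 * walk w (t' - p'.1.1.+1) p'.2 u) *
  (b q.2 s ^+ 2 * ((p'.1.2 == q.2)%:R * (p'.2 == s)%:R + (p'.1.2 == s)%:R * (p'.2 == q.2)%:R))))/=.
rewrite -(pair_bigA _ (fun (i : 'I_t) r => \sum_s \sum_(p' : 'I_t' * V * V)
  (walk w i v r * walk w (t - i.+1) s v) *
  (walk w p'.1.1 u p'.1.2 * walk w (t' - p'.1.1.+1) p'.2 u) *
  (b r s ^+ 2 * ((p'.1.2 == r)%:R * (p'.2 == s)%:R + (p'.1.2 == s)%:R * (p'.2 == r)%:R))))/=.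
apply: eq_bigr => i _.
transitivity (\sum_r \sum_s \sum_(i' < t') b r s ^+ 2 *
    (walk w i v r * walk w (t - i.+1) s v * (walk w i' u r * walk w (t' - i'.+1) s u) +
     walk w i v r * walk w (t - i.+1) s v * (walk w i' u s * walk w (t' - i'.+1) r u))); last first.
  under [LHS]eq_bigr do rewrite exchange_big/=.
  by rewrite exchange_big.
apply: eq_bigr => r _; apply: eq_bigr => s _.
rewrite -(pair_bigA _ (fun (q : 'I_t' * V) s' =>
  (walk w i v r * walk w (t - i.+1) s v) *
  (walk w q.1 u q.2 * walk w (t' - q.1.+1) s' u) *
  (b r s ^+ 2 * ((q.2 == r)%:R * (s' == s)%:R + (q.2 == s)%:R * (s' == r)%:R))))/=.
rewrite -(pair_bigA _ (fun (i' : 'I_t') r' => \sum_s'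
  (walk w i v r * walk w (t - i.+1) s v) *
  (walk w i' u r' * walk w (t' - i'.+1) s' u) *
  (b r s ^+ 2 * ((r' == r)%:R * (s' == s)%:R + (r' == s)%:R * (s' == r)%:R))))/=.
apply: eq_bigr => i' _.
pose g r' s' := b r s ^+ 2 * (walk w i v r * walk w (t - i.+1) s v *
  (walk w i' u r' * walk w (t' - i'.+1) s' u)).
rewrite mulrDr -[X in _ = X + _]/(g r s) -[X in _ = _ + X]/(g s r).
rewrite -(sum_two_deltas g r s) -(sum_two_deltas g s r) -big_split/=.
apply: eq_bigr => r' _; rewrite -big_split/=; apply: eq_bigr => s' _.
by rewrite /g; ring.
Qed.

Let tau_ge0 (u : V) : 0 <= tau.
Proof. exact: le_trans (sqr_ge0 (b u u)) (b_tau u u). Qed.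

Lemma avg_walk4_ge0 k1 u1 v1 k2 u2 v2 k3 u3 v3 k4 u4 v4 :
  0 <= avg (fun w => walk w k1 u1 v1 * walk w k2 u2 v2 * (walk w k3 u3 v3 * walk w k4 u4 v4)).
Proof.
by apply: avg_sign_poly_ge0; apply: sign_polyM; apply: sign_polyM; exact: walk_poly.
Qed.

(** Crossing pairs cost a factor [tau] and leave two walks between [v] and [u]. *)
Lemma avg_dwalk_le C t t' M u v : (0 < t)%N -> (0 < t')%N -> (t + t' = M.+1.*2)%N ->
  (forall u, avg (fun w => loop w u M) <= C) ->
  \sum_f avg (fun w => dwalk f w t v v * dwalk f w t' u u) <= (t * t')%:R * (4 * tau * C).
Proof.
move=> t0 t'0 tt' hC; rewrite -avg_sum.
rewrite (eq_avg (fun w => sum_dwalk w t t' u v)).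
rewrite avg_sum; apply: (@le_trans _ _ (\sum_(i < t) \sum_(i' < t') 4 * tau * C)); last first.
  by rewrite !sumr_const !card_ord -mulrnA [leRHS]mulr_natl (mulnC t').
apply: ler_sum => i _; rewrite avg_sum; apply: ler_sum => i' _; rewrite avg_sum.
pose G w r s := walk w i v r * walk w (t - i.+1) s v * (walk w i' u r * walk w (t' - i'.+1) s u) +
     walk w i v r * walk w (t - i.+1) s v * (walk w i' u s * walk w (t' - i'.+1) r u).
have G0 r s : 0 <= avg (fun w => G w r s) by rewrite avgD addr_ge0 ?avg_walk4_ge0.
apply: (@le_trans _ _ (tau * avg (fun w => \sum_r \sum_s G w r s))).
  rewrite avg_sum mulr_sumr; apply: ler_sum => r _; rewrite !avg_sum mulr_sumr.
  apply: ler_sum => s _; rewrite avgZ.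
  by apply: ler_wpM2r; [exact: G0|exact: b_tau].
rewrite -mulrA [leRHS]mulrCA ler_wpM2l ?(tau_ge0 u)//.
apply: (@le_trans _ _ (avg (fun w => 2 * (loop w v M + loop w u M)))); last first.
  by rewrite avgZ avgD; have := hC u; have := hC v; lra.
apply: avg_le => w.
have -> : \sum_r \sum_s G w r s =
   walk w (i + i') v u * walk w ((t - i.+1) + (t' - i'.+1)) v u +
   walk w (i + (t' - i'.+1)) v u * walk w ((t - i.+1) + i') v u.
  under eq_bigr do rewrite big_split/=; rewrite big_split/=; congr (_ + _).
    rewrite !walkD mulr_suml; apply: eq_bigr => r _; rewrite mulr_sumr.
    apply: eq_bigr => s _; rewrite [walk w i' u r]walk_sym [walk w _ s v]walk_sym; ring.
  rewrite !walkD mulr_suml; apply: eq_bigr => r _; rewrite mulr_sumr.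
  by apply: eq_bigr => s _; rewrite [walk w i' u s]walk_sym [walk w _ s v]walk_sym; ring.
rewrite mulr2n mulrDl mul1r; apply: lerD; apply: walk_mul_le.
  by have := ltn_ord i; have := ltn_ord i'; lia.
by have := ltn_ord i; have := ltn_ord i'; lia.
Qed.

Lemma walk_flip (w : sgn) k u v :
  walk [ffun x => ~~ w x] k u v = (-1) ^+ k * walk w k u v.
Proof.
elim: k u => [|k ih] u; first by rewrite expr0 mul1r.
rewrite /= mulr_sumr; apply: eq_bigr => s _; rewrite ih /smx /sg ffunE exprS.
by case: (w _) => /=; rewrite ?expr0 ?expr1; ring.
Qed.

Lemma avg_walk_odd k u v : odd k -> avg (fun w => walk w k u v) = 0.
Proof.
move=> ok; have := avg_flip [ffun=> true] (fun w => walk w k u v).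
have -> : avg (fun w => walk [ffun x => [ffun=> true] x (+) w x] k u v) =
    avg (fun w => - 1 * walk w k u v).
  apply: eq_avg => w; rewrite (_ : [ffun _ => _] = [ffun x => ~~ w x]); last first.
    by apply/ffunP => x; rewrite !ffunE.
  by rewrite walk_flip -signr_odd ok expr1.
by rewrite avgZ; lra.
Qed.

Lemma sum_even_terms (f : nat -> R) m : (forall t, odd t -> f t = 0) ->
  \sum_(t < m.*2.+1) f t = \sum_(a < m.+1) f a.*2.
Proof.
move=> h; elim: m => [|m ih]; first by rewrite !big_ord1.
by rewrite doubleS big_ord_recr big_ord_recr/= ih [RHS]big_ord_recr/= h ?addr0//= odd_double.
Qed.

(** Recursion for the closed walks; the main term is the Catalan convolution. *)
Lemma loop_recursion m (C : nat -> R) : (forall k, 0 <= C k) ->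
  (forall k u, (k <= m)%N -> avg (fun w => loop w u k) <= C k) ->
  forall u, avg (fun w => loop w u m.+1) <=
    \sum_(a < m.+1) C a * C (m - a)%N + (m.*2.+1)%:R * tau * C m
    + 8 * (m.+1%:R) ^+ 3 * tau * C m.-1.
Proof.
move=> C0 hC u; have t0 := tau_ge0 u.
set n := m.*2.+1.
pose q1 w v (t : nat) := walk w t v u * walk w (n - t.+1) v u.
pose q2 w v (t : nat) := walk w t v v * walk w (n - t.+1) u u.
have ibp : avg (fun w => loop w u m.+1) <=
    \sum_v b u v ^+ 2 * \sum_(t < n) (avg (fun w => q1 w v t) + avg (fun w => q2 w v t)).
  rewrite /loop doubleS -/n.
  have -> : avg (fun w => walk w n.+1 u u) =
     \sum_v b u v * avg (fun w => sg w (e u v) * walk w n v u).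
    rewrite (@eq_avg _ _ _ (fun w => \sum_v b u v * (sg w (e u v) * walk w n v u))).
      by rewrite avg_sum; apply: eq_bigr => v _; rewrite avgZ.
    by move=> w; rewrite [LHS]/=; apply: eq_bigr => v _; rewrite /smx mulrA.
  apply: ler_sum => v _.
  apply: le_trans (ler_wpM2l (b_ge0 u v) (avg_ibp (e u v) (walk_poly n v u))) _.
  have pt w : b u v * (sg w (e u v) * dwalk (e u v) w n v u) =
      b u v ^+ 2 * \sum_(t < n) (q1 w v t + q2 w v t).
    rewrite dwalkE !mulr_sumr; apply: eq_bigr => t _.
    pose g r s := walk w t v r * walk w (n - t.+1) s u.
    transitivity (\sum_r \sum_s g r s * (smx w u v * smxE (e u v) w r s)).
      rewrite !mulr_sumr; apply: eq_bigr => r _; rewrite !mulr_sumr; apply: eq_bigr => s _.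
      by rewrite /g {1}/smx; ring.
    transitivity (b u v ^+ 2 * (g u v + g v u)); last by rewrite /g /q1 /q2.
    rewrite -(sum_two_deltas g u v) -(sum_two_deltas g v u) -big_split/= mulr_sumr.
    apply: eq_bigr => r _; rewrite -big_split/= mulr_sumr; apply: eq_bigr => s _.
    by rewrite edge_pair; ring.
  rewrite -avgZ (eq_avg pt) avgZ avg_sum le_eqVlt; apply/orP; left; apply/eqP.
  by congr (_ * _); apply: eq_bigr => t _; rewrite avgD.
apply: (le_trans ibp).
under eq_bigr do rewrite big_split/= mulrDr.
rewrite big_split/= [leRHS]addrAC [leRHS]addrC lerD//.
  apply: (@le_trans _ _ (\sum_v tau * \sum_(t < n) avg (fun w => q1 w v t))).
    apply: ler_sum => v _; rewrite ler_wpM2r//; apply: sumr_ge0 => t _.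
    by apply: avg_sign_poly_ge0; apply: sign_polyM; exact: walk_poly.
  rewrite -mulr_sumr [_ * tau]mulrC -mulrA ler_wpM2l// exchange_big/=.
  apply: (@le_trans _ _ (\sum_(t < n) C m)); last first.
    by rewrite sumr_const card_ord mulr_natl.
  apply: ler_sum => t _; rewrite -avg_sum; apply: le_trans (hC m u (leqnn m)).
  rewrite le_eqVlt; apply/orP; left; apply/eqP; apply: eq_avg => w.
  rewrite /loop (_ : m.*2 = t + (n - t.+1))%N; last by have := ltn_ord t; rewrite /n; lia.
  by rewrite walkD; apply: eq_bigr => v _; rewrite /q1 [walk w t v u]walk_sym.
set T := _ + _; have T0 : 0 <= T.
  rewrite /T addr_ge0 ?mulr_ge0 ?exprn_ge0//; apply: sumr_ge0 => a _.
  by rewrite mulr_ge0.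
apply: (@le_trans _ _ (\sum_v b u v ^+ 2 * T)); last first.
  by rewrite -mulr_suml ler_piMl.
apply: ler_sum => v _; rewrite ler_wpM2l ?sqr_ge0//.
pose f t := avg (fun w => walk w t v v) * avg (fun w => walk w (n - t.+1) u u).
apply: (@le_trans _ _ (\sum_(t < n) (f t +
    (m.+1%:R) ^+ 2 * (4 * tau * C m.-1)))).
  apply: ler_sum => t _.
  apply: le_trans (avg_mul_le (walk_poly t v v) (walk_poly (n - t.+1) u u)) _.
  rewrite lerD2l.
  have E0 : 0 <= (m.+1%:R) ^+ 2 * (4 * tau * C m.-1) by rewrite !mulr_ge0 ?exprn_ge0.
  have tn := ltn_ord t.
  have [t00|t00] := posnP t.
    by rewrite big1// => f' _; rewrite t00 (eq_avg (g := fun=> 0)) ?avg_cst// => w; rewrite mul0r.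
  have [t10|t10] := posnP (n - t.+1).
    by rewrite big1// => f' _; rewrite t10 (eq_avg (g := fun=> 0)) ?avg_cst// => w; rewrite mulr0.
  have m0 : (0 < m)%N by rewrite /n in t10; lia.
  apply: (le_trans (@avg_dwalk_le (C m.-1) t (n - t.+1) m.-1 u v t00 t10 _ _)).
  - by rewrite prednK// /n; rewrite /n in tn; lia.
  - by move=> u'; apply: hC; rewrite leq_pred.
  - rewrite ler_wpM2r ?mulr_ge0// -natrX ler_nat.
    have : (t + (n - t.+1) = m.*2)%N by rewrite /n; rewrite /n in tn; lia.
    move: (n - t.+1)%N => t' ht; have := (nat_AGM2 t t').1.
    rewrite ht -muln2 expnMn mulnC leq_pmul2r// => /leq_trans; apply.
    by rewrite leq_exp2r.
rewrite big_split/= lerD//.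
  rewrite sum_even_terms => [|t ot]; last by rewrite /f avg_walk_odd// mul0r.
  apply: ler_sum => a _; have am : (a <= m)%N by have := ltn_ord a; rewrite ltnS.
  rewrite /f (_ : n - a.*2.+1 = (m - a).*2)%N; last by rewrite /n; lia.
  apply: ler_pM; [| |exact: hC|by apply: hC; rewrite leq_subr].
    by apply: avg_ge0 => w; exact: loop_ge0.
  by apply: avg_ge0 => w; exact: loop_ge0.
rewrite sumr_const card_ord -[leLHS]mulr_natl.
have -> : 8 * m.+1%:R ^+ 3 * tau * C m.-1 =
   (2 * m.+1%:R) * (m.+1%:R ^+ 2 * (4 * tau * C m.-1)) by ring.
rewrite ler_wpM2r ?mulr_ge0 ?exprn_ge0// -natrM ler_nat /n; lia.
Qed.

(** While [M ^ 3 * tau] is bounded, the error terms of the recursion do not exceed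
    the main one, and the moments grow as for a matrix of bounded norm. The weights
    [k.+1 ^- 2] close the induction on the convolution. *)
Lemma avg_loop_le (M : nat) (G : R) : 0 <= G -> (M%:R) ^+ 3 * tau <= G ->
  forall m u, (m <= M)%N -> avg (fun w => loop w u m) <= (64 * (1 + G)) ^+ m.
Proof.
move=> G0 MG.
set B := 64 * (1 + G).
have B64 : 64 <= B by rewrite /B; lra.
have B0 : 0 <= B by lra.
pose C k := B ^+ k * (k.+1%:R) ^- 2.
have C0 k : 0 <= C k by rewrite mulr_ge0 ?exprn_ge0// invr_ge0 exprn_ge0.
suff main m : (m <= M)%N -> forall k u, (k <= m)%N -> avg (fun w => loop w u k) <= C k.
  move=> m u mM; apply: le_trans (main m mM m u (leqnn m)) _.
  rewrite /C ler_piMr ?exprn_ge0// invf_le1 ?exprn_gt0//.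
  by rewrite exprn_ege1// ler1n.
elim: m => [_ k u|m ih mM k u].
  rewrite leqn0 => /eqP ->; rewrite (@eq_avg _ _ _ (fun=> 1)) ?avg_cst => [|w]; last exact: loop0.
  by rewrite /C expr0 expr1n invr1 mulr1.
rewrite leq_eqVlt => /predU1P[->|]; last by rewrite ltnS; apply: ih; exact: ltnW.
apply: le_trans (loop_recursion C0 (ih (ltnW mM)) u) _.
have t0 := tau_ge0 u.
have m1 : m.+1%:R ^+ 3 * tau <= G.
  by apply: le_trans MG; rewrite ler_wpM2r// lerXn2r ?nnegrE// ler_nat.
have inv_le (x y : nat) : (0 < x)%N -> (m.+2 <= y * x)%N -> x%:R ^- 2 <= y%:R ^+ 2 * m.+2%:R ^- 2 :> R.
  move=> x0 xy; have x0' : 0 < x%:R :> R by rewrite ltr0n.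
  rewrite ler_pdivlMr ?exprn_gt0// ler_pdivrMl ?exprn_gt0// -exprMn mulrC.
  by rewrite lerXn2r ?nnegrE ?mulr_ge0// -natrM ler_nat.
pose s : R := m.+2%:R ^- 2; have s0 : 0 <= s by rewrite invr_ge0 exprn_ge0.
have Bm : 0 <= B ^+ m by rewrite exprn_ge0.
have h1 : \sum_(a < m.+1) C a * C (m - a)%N <= 16 * (B ^+ m * s).
  rewrite mulrCA; apply: le_trans (ler_wpM2l Bm (sum_conv_inv_sqr m)).
  rewrite mulr_sumr; apply: ler_sum => a _; have am : (a <= m)%N by have := ltn_ord a; rewrite ltnS.
  by rewrite /C mulrACA -exprD subnKC.
have h2 : m.*2.+1%:R * tau * C m <= 8 * G * (B ^+ m * s).
  have e1 : m.*2.+1%:R * tau <= 2 * G.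
    apply: (@le_trans _ _ (2 * (m.+1%:R ^+ 3 * tau))); last by rewrite ler_pM2l.
    rewrite mulrA ler_wpM2r// -natrX -natrM ler_nat !expnS expn0 muln1.
    by rewrite -addnn; nia.
  have e2 : C m <= 4 * (B ^+ m * s).
    rewrite /C mulrCA ler_wpM2l//; have := inv_le m.+1 2 isT.
    by rewrite -/s (_ : 2%:R ^+ 2 = 4 :> R); [apply; lia|ring].
  apply: le_trans (ler_pM _ _ e1 e2) _; rewrite ?mulr_ge0//.
  by rewrite le_eqVlt; apply/orP; left; apply/eqP; ring.
have h3 : 8 * m.+1%:R ^+ 3 * tau * C m.-1 <= 32 * G * (B ^+ m * s).
  have e2 : C m.-1 <= 4 * (B ^+ m * s).
    rewrite /C; case: m => [|m'] in s s0 Bm inv_le {ih mM m1 h1 h2} *.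
      have -> : B ^+ 0.-1 / 0.-1.+1%:R ^+ 2 = 1 :> R by rewrite /= expr0 expr1n divr1.
      by have -> : 4 * (B ^+ 0 * s) = 1 by rewrite expr0 /s; field.
    rewrite [m'.+1.-1]/= mulrCA; have := inv_le m'.+1 3 isT; rewrite -/s => h.
    apply: (@le_trans _ _ (B ^+ m' * (9 * s))).
      rewrite ler_wpM2l ?exprn_ge0//; apply: le_trans (h _) _; first by lia.
      by rewrite (_ : 3%:R ^+ 2 = 9 :> R); [|ring].
    rewrite exprS [B * _]mulrC -mulrA ler_wpM2l ?exprn_ge0//.
    have : 0 <= (B - 64) * s by rewrite mulr_ge0// subr_ge0.
    lra.
  rewrite -(mulrA 8); apply: (@le_trans _ _ (8 * G * (4 * (B ^+ m * s)))).
    by apply: ler_pM => //; rewrite ?mulr_ge0 ?exprn_ge0 ?ler_pM2l.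
  by rewrite le_eqVlt; apply/orP; left; apply/eqP; ring.
have : (16 + 40 * G) * (B ^+ m * s) <= B * (B ^+ m * s).
  by rewrite ler_wpM2r ?mulr_ge0// /B; lra.
have -> : C m.+1 = B * (B ^+ m * s) by rewrite /C exprS mulrA.
move=> /(le_trans _); apply; rewrite [leRHS](_ : _ =
  16 * (B ^+ m * s) + 8 * G * (B ^+ m * s) + 32 * G * (B ^+ m * s)); last by ring.
by rewrite !lerD.
Qed.

Section QuadraticForm.
Variables (w : sgn) (z : V -> R).
Let S := \sum_u z u ^+ 2.
Let q k := \sum_v (\sum_u z u * walk w k u v) * z v.

Let S0 : 0 <= S. Proof. by apply: sumr_ge0 => u _; exact: sqr_ge0. Qed.

Let q_double k : q k.*2 = \sum_v (\sum_u z u * walk w k u v) ^+ 2.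
Proof.
rewrite /q -addnn.
transitivity (\sum_v \sum_u \sum_r z u * walk w k u r * (walk w k r v * z v)).
  apply: eq_bigr => v _; rewrite mulr_suml; apply: eq_bigr => u _.
  by rewrite walkD mulr_sumr mulr_suml; apply: eq_bigr => r _; ring.
under eq_bigr do rewrite exchange_big/=.
rewrite exchange_big/=; apply: eq_bigr => r _.
rewrite expr2 mulr_sumr; apply: eq_bigr => v _; rewrite mulr_suml; apply: eq_bigr => u _.
by rewrite [walk w k r v]walk_sym; ring.
Qed.

Let q_sqr k : q k ^+ 2 <= S * q k.*2.
Proof. by rewrite q_double mulrC; exact: cauchy_schwarz_sum. Qed.

Let q_trace k : q k.*2 <= S * \sum_u loop w u k.
Proof.
rewrite q_double; apply: (@le_trans _ _ (\sum_v S * \sum_u walk w k u v ^+ 2)).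
  by apply: ler_sum => v _; exact: cauchy_schwarz_sum.
rewrite -mulr_sumr ler_wpM2l// exchange_big/=.
by apply: ler_sum => u _; rewrite loop_sqr.
Qed.

(** Squaring repeatedly with the Cauchy-Schwarz inequality raises the matrix to the
    power [2 ^ h.+1], whose trace bounds its quadratic form. *)
Lemma quadratic_form_le h :
  (\sum_v (\sum_u z u * smx w u v) * z v) ^+ (2 ^ h.+1) <=
    S ^+ (2 ^ h.+1) * \sum_u loop w u (2 ^ h).
Proof.
have q1 : q 1 = \sum_v (\sum_u z u * smx w u v) * z v.
  by apply: eq_bigr => v _; congr (_ * _); apply: eq_bigr => u _; rewrite walk1.
rewrite -q1.
suff main : q 1 ^+ (2 ^ h.+1) <= S ^+ (2 ^ h.+1).-1 * q (2 ^ h.+1).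
  apply: (le_trans main); rewrite -[X in _ <= S ^+ X * _]prednK ?expn_gt0//.
  rewrite exprSr -mulrA ler_wpM2l ?exprn_ge0// expnS mul2n; exact: q_trace.
elim: h => [|h ih]; first by rewrite expn1 expr1; exact: (q_sqr 1).
rewrite expnS mulnC exprM.
apply: (@le_trans _ _ ((S ^+ (2 ^ h.+1).-1 * q (2 ^ h.+1)) ^+ 2)).
  have q0 : 0 <= q 1 ^+ (2 ^ h.+1) by rewrite expnS exprM exprn_ge0 ?sqr_ge0.
  by rewrite lerXn2r ?nnegrE// (le_trans _ ih).
rewrite exprMn -exprM.
apply: (le_trans (ler_wpM2l _ (q_sqr _))); first exact: exprn_ge0.
rewrite mulrA -exprSr -muln2 le_eqVlt; apply/orP; left; apply/eqP.
by congr (S ^+ _ * _); have := expn_gt0 2 h.+1; lia.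
Qed.

End QuadraticForm.

End Walks.

(** * Comparable levels on Hilbert space *)

Lemma sum_geometric_le {R : realType} (q : R) m : 0 <= q -> q < 1 ->
  \sum_(t < m) q ^+ t <= (1 - q)^-1.
Proof.
move=> q0 q1; rewrite -[leRHS]mul1r ler_pdivlMr ?subr_gt0//.
have -> : (\sum_(t < m) q ^+ t) * (1 - q) = 1 - q ^+ m.
  elim: m => [|m ih]; first by rewrite big_ord0 expr0; ring.
  by rewrite big_ord_recr/= mulrDl ih exprS; ring.
by rewrite gerBl exprn_ge0.
Qed.

Lemma nat_close c t : (c <= t.+1 -> t <= c.+1 -> [|| t == c, t == c.+1 | t == c.-1])%N.
Proof. lia. Qed.

Lemma nat_exponents n k l : (n <= k.+1 -> n <= 2 * l.+1 ->
  n * 18 <= 12 * k + 12 * l + 24)%N.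
Proof. lia. Qed.

Section NearDiagonal.
Context {R : realType}.

(* the root of order 24 lets the powers 6, 12 and 18 be split off below *)
Let r : R := (2^-1) `^ 24^-1.
Let r0 : 0 < r. Proof. exact: powR_gt0. Qed.
Let r1 : r < 1. Proof. exact: half_powR_lt1. Qed.
Let r24 : r ^+ 24 = 2^-1.
Proof. by rewrite -powR_mulrn ?ltW// /r -powRrM mulVf ?powRr1. Qed.

Let Gam : R := ((1 - r ^+ 2) ^- 2) ^+ 3.

Let cube_bound (n : nat) : n%:R ^+ 3 * (r ^+ n) ^+ 6 <= Gam.
Proof.
have q0 : 0 <= r ^+ 2 by rewrite sqr_ge0.
have q1 : r ^+ 2 < 1 by rewrite exprn_ilt1// ltW.
rewrite (_ : (r ^+ n) ^+ 6 = ((r ^+ 2) ^+ n) ^+ 3); last by rewrite -!exprM; congr (_ ^+ _); lia.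
have h0 : 0 <= n%:R * (r ^+ 2) ^+ n by apply: mulr_ge0 => //; exact: exprn_ge0.
have h : n%:R * (r ^+ 2) ^+ n <= (1 - r ^+ 2) ^- 2.
  apply: le_trans (sum_arith_geometric n.+1 q0 q1).
  rewrite big_ord_recr/= -[leLHS]add0r lerD//.
    by apply: sumr_ge0 => i _; apply: mulr_ge0 => //; exact: exprn_ge0.
  by apply: ler_wpM2r; [exact: exprn_ge0|rewrite ler_nat].
by rewrite -exprMn /Gam lerXn2r ?nnegrE// (le_trans h0).
Qed.

(** The levels are themselves grouped dyadically: [tlog k = t] when [k.+1] is of
    the order of [2 ^ t]. *)
Definition tlog k := trunc_log 2 k.+1.

Lemma tlog_bounds k : (2 ^ tlog k <= k.+1 < 2 ^ (tlog k).+1)%N.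
Proof. exact: trunc_log_bounds. Qed.

Let Bc : R := 64 * (1 + Gam).
Let Gam0 : 0 <= Gam.
Proof. by rewrite exprn_ge0// invr_ge0 exprn_ge0// subr_ge0 exprn_ile1// ltW. Qed.

Context (D : nat).
Let R0 : R := Bc * 2 ^+ (2 * D + 2).
Let Cr : R := (1 - r ^+ 6)^-1.
Definition near_diagonal_cst : R := 10 * R0 + 4 * Cr.

Context (I J : finType) (a : I -> J -> R) (i0 : I) (j0 : J).
Hypothesis a_ge0 : forall i j, 0 <= a i j.
Hypothesis a_row : forall i, \sum_j a i j ^+ 2 <= 1.
Hypothesis a_col : forall j, \sum_i a i j ^+ 2 <= 1.
Hypothesis a_four : \sum_i \sum_j a i j ^+ 4 <= 1.
Hypothesis a_near_row : forall k,
  (#|[set i | [exists j, (8^-1 ^+ k < a i j)%R]]| <= 2 ^ (D * k))%N.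
Hypothesis a_near_col : forall k,
  (#|[set j | [exists i, (8^-1 ^+ k < a i j)%R]]| <= 2 ^ (D * k))%N.

Let n t := (2 ^ t)%N.
Let SI t := [set i | [exists j, (8^-1 ^+ (2 * n t) < a i j)%R]].
Let SJ t := [set j | [exists i, (8^-1 ^+ (2 * n t) < a i j)%R]].
(* the bulk of the entries at level [2 ^ t] *)
Let bulk t i j := [&& i \in SI t, j \in SJ t & a i j ^+ 2 <= (r ^+ n t) ^+ 6].
Let at_ t i j : R := if bulk t i j then a i j else 0.
Let V := (I + J)%type.
Let b t (u v : V) : R := match u, v with
  | inl i, inr j => at_ t i j | inr j, inl i => at_ t i j | _, _ => 0 end.
Let e (u v : V) : I * J := match u, v with
  | inl i, inr j => (i, j) | inr j, inl i => (i, j) | _, _ => (i0, j0) end.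

Let at_ge0 t i j : 0 <= at_ t i j. Proof. by rewrite /at_; case: ifP. Qed.
Let at_le t i j : at_ t i j ^+ 2 <= a i j ^+ 2.
Proof. by rewrite /at_; case: ifP => // _; rewrite expr0n sqr_ge0. Qed.
Let b_ge0 t u v : 0 <= b t u v. Proof. by case: u; case: v => * /=. Qed.
Let b_sym t u v : b t u v = b t v u. Proof. by case: u; case: v. Qed.
Let b_diag t u : b t u u = 0. Proof. by case: u. Qed.
Let e_sym u v : e u v = e v u. Proof. by case: u; case: v. Qed.
Let e_inj t u v u' v' : b t u v != 0 -> b t u' v' != 0 -> e u v = e u' v' ->
  (u' = u /\ v' = v) \/ (u' = v /\ v' = u).
Proof.
case: u => [i|j]; case: v => [i'|j'] /=; rewrite ?eqxx//;
  case: u' => [i1|j1]; case: v' => [i2|j2] /=; rewrite ?eqxx// => _ _ [-> ->]; by [left|right].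
Qed.
Let b_row t u : \sum_v b t u v ^+ 2 <= 1.
Proof.
rewrite big_sumType/=; case: u => [i|j] /=.
  rewrite big1 ?add0r; last by move=> *; rewrite expr0n.
  by apply: le_trans (a_row i); apply: ler_sum.
rewrite [X in _ + X]big1 ?addr0; last by move=> *; rewrite expr0n.
by apply: le_trans (a_col j); apply: ler_sum.
Qed.
Let b_tau t u v : b t u v ^+ 2 <= (r ^+ n t) ^+ 6.
Proof.
have h i j : at_ t i j ^+ 2 <= (r ^+ n t) ^+ 6.
  by rewrite /at_; case: ifP => [/and3P[]//|_]; rewrite expr0n !exprn_ge0// ltW.
by case: u; case: v => * /=; rewrite ?h// expr0n !exprn_ge0// ltW.
Qed.

Let lp t w u k := loop (b t) e w u k.

Let live t := [set u : V | match u with inl i => i \in SI t | inr j => j \in SJ t end].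

Let card_live t : (#|live t| <= 2 * 2 ^ (D * (2 * n t)))%N.
Proof.
have -> : live t = [set inl i | i in SI t] :|: [set inr j | j in SJ t].
  apply/setP => -[i|j]; rewrite !inE.
    rewrite mem_imset ?inE; last by move=> ? ? [].
    by rewrite [X in _ || X](_ : _ = false) ?orbF//; apply/negbTE/imsetP => -[].
  rewrite mem_imset ?inE; last by move=> ? ? [].
  by rewrite [X in X || _](_ : _ = false)//; apply/negbTE/imsetP => -[].
apply: leq_trans (leq_card_setU _ _) _.
rewrite mul2n -addnn leq_add//; apply: leq_trans (leq_imset_card _ _) _.
  exact: a_near_row.
exact: a_near_col.
Qed.

Let lp_dead t w u k : (0 < k)%N -> u \notin live t -> lp t w u k = 0.
Proof.
case: k => // k _ hu; rewrite /lp /loop doubleS /=.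
apply: big1 => v _; rewrite /smx (_ : b t u v = 0) ?mul0r//.
by case: u hu => [i|j]; case: v => [i'|j'] //=; rewrite inE /at_ /bulk => /negbTE -> //=;
  rewrite andbF.
Qed.

Let Bc64 : 64 <= Bc. Proof. by rewrite /Bc; have := Gam0; lra. Qed.
Let R01 : 1 <= R0.
Proof.
rewrite /R0 -[leLHS]mulr1 ler_pM//; first by have := Bc64; lra.
by rewrite exprn_ege1// ler1n.
Qed.

Let tr_bound t : avg (fun w => \sum_u lp t w u (n t)) <= R0 ^+ (n t) * (2 * (2^-1) ^+ t).
Proof.
rewrite avg_sum (bigID (mem (live t)))/= [X in _ + X]big1 ?addr0; last first.
  by move=> u hu; rewrite (@eq_avg _ _ _ (fun=> 0)) ?avg_cst// => w; rewrite lp_dead// expn_gt0.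
have main u : avg (fun w => lp t w u (n t)) <= Bc ^+ n t.
  apply: (@avg_loop_le _ _ _ (b t) e ((r ^+ n t) ^+ 6) (b_ge0 t) (b_sym t) (b_diag t) e_sym
    (@e_inj t) (b_row t) (b_tau t) (n t) Gam Gam0 (cube_bound (n t)) (n t) u (leqnn _)).
apply: (le_trans (ler_sum _ (fun u _ => main u))).
rewrite sumr_const -[leLHS]mulr_natl.
apply: (@le_trans _ _ ((2 * 2 ^ (D * (2 * n t)))%:R * Bc ^+ n t)).
  by rewrite ler_wpM2r ?ler_nat// exprn_ge0//; have := Bc64; lra.
have -> : (2 * 2 ^ (D * (2 * n t)))%:R = 2 * 2 ^+ (2 * D * n t) :> R.
  by rewrite natrM natrX (_ : D * (2 * n t) = 2 * D * n t)%N//; ring.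
have -> : R0 ^+ n t = Bc ^+ n t * (2 ^+ (2 * D * n t) * 2 ^+ (2 * n t)).
  by rewrite /R0 exprMn -exprM mulnDl exprD.
have h : 1 <= 2 ^+ (2 * n t) * (2^-1) ^+ t :> R.
  rewrite exprVn ler_pdivlMr ?exprn_gt0// mul1r ler_weXn2l ?ler1n//.
  have := ltn_expl t (isT : 1 < 2)%N; rewrite /n; lia.
have B1 : 0 <= 2 * 2 ^+ (2 * D * n t) * Bc ^+ n t.
  by rewrite !mulr_ge0 ?exprn_ge0//; have := Bc64; lra.
rewrite -[leLHS]mulr1; apply: le_trans (ler_wpM2l B1 h) _.
by rewrite le_eqVlt; apply/orP; left; apply/eqP; ring.
Qed.

Definition near_level l k := (tlog l <= (tlog k).+1)%N && (tlog k <= (tlog l).+1)%N.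

Let T := #|J|.+1.
Let rho t w := (\sum_u lp t w u (n t)) / R0 ^+ n t.

Let lp_ge0 t w u k : 0 <= lp t w u k.
Proof. by apply: loop_ge0; [exact: b_sym|exact: e_sym]. Qed.

Let rho_ge0 t w : 0 <= rho t w.
Proof.
rewrite divr_ge0 ?exprn_ge0 ?(le_trans _ R01)//.
by apply: sumr_ge0 => u _; exact: lp_ge0.
Qed.

Let bulk_bound t w (x : J -> R) (y : I -> R) :
  \sum_i \sum_j at_ t i j * sg w (i, j) * x j * y i <=
  2^-1 * (\sum_j x j ^+ 2 + \sum_i y i ^+ 2) * (R0 * (1 + rho t w)).
Proof.
pose z (u : V) := match u with inl i => y i | inr j => x j end.
have Sz : \sum_u z u ^+ 2 = \sum_j x j ^+ 2 + \sum_i y i ^+ 2.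
  by rewrite big_sumType/= addrC.
have qz : \sum_v (\sum_u z u * smx (b t) e w u v) * z v =
    2 * \sum_i \sum_j at_ t i j * sg w (i, j) * x j * y i.
  rewrite big_sumType/= mulr2n mulrDl mul1r; congr (_ + _).
    apply: eq_bigr => i _; rewrite big_sumType/= big1 ?add0r => [|i' _]; last first.
      by rewrite /smx/= mul0r mulr0.
    by rewrite mulr_suml; apply: eq_bigr => j _; rewrite /smx/=; ring.
  rewrite [RHS]exchange_big/=; apply: eq_bigr => j _; rewrite big_sumType/=.
  rewrite [X in (_ + X) * _]big1 ?addr0 => [|j' _]; last by rewrite /smx/= mul0r mulr0.
  by rewrite mulr_suml; apply: eq_bigr => i _; rewrite /smx/=; ring.
have S0 : 0 <= \sum_u z u ^+ 2 by apply: sumr_ge0 => u _; exact: sqr_ge0.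
suff : \sum_v (\sum_u z u * smx (b t) e w u v) * z v <= (\sum_u z u ^+ 2) * (R0 * (1 + rho t w)).
  by rewrite qz Sz => h; rewrite -[leRHS]mulrA ler_pdivlMl.
have := quadratic_form_le (b_sym t) e_sym w z t; rewrite -/(n t).
set q := \sum_v _; set S := \sum_u z u ^+ 2 => hq.
have R00 : 0 <= R0 by rewrite (le_trans _ R01).
have rho0 := rho_ge0 t w.
rewrite leNgt; apply/negP => hlt.
have c0 : 0 <= S * (R0 * (1 + rho t w)) by rewrite !mulr_ge0// addr_ge0.
have := ltrXn2r (2 ^ t.+1) c0 hlt.
rewrite expn_eq0/=; apply/negP; rewrite -leNgt.
apply: (le_trans hq); rewrite exprMn ler_wpM2l ?exprn_ge0//.
have -> : \sum_u loop (b t) e w u (n t) = R0 ^+ n t * rho t w.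
  by rewrite /rho mulrC divfK// expf_neq0// gt_eqF// (lt_le_trans _ R01).
rewrite [leRHS]exprMn; apply: ler_pM; rewrite ?exprn_ge0//.
  by rewrite ler_weXn2l// /n leq_exp2l.
apply: (@le_trans _ _ (1 + rho t w)); first by rewrite lerDr.
by rewrite -[leLHS]expr1 ler_weXn2l ?lerDl// expn_gt0.
Qed.

Let rest_bound t w (x : J -> R) (y : I -> R) (k : J -> nat) (l : I -> nat) :
  (forall j, 2 ^+ k j * x j ^+ 2 <= 1) -> (forall i, 2 ^+ l i * y i ^+ 2 <= 1) ->
  (forall t, #|[set j | (k j <= t)%N]| <= 2 ^ t.+1)%N ->
  (forall t, #|[set i | (l i <= t)%N]| <= 2 ^ t.+1)%N ->
  \sum_i \sum_j ((tlog (k j) == t) && near_level (l i) (k j))%:R *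
     ((a i j - at_ t i j) * sg w (i, j) * x j * y i) <= 4 * (r ^+ 6) ^+ t.
Proof.
move=> hx hy ck cl.
have r00 := ltW r0; have r11 := ltW r1.
pose Rw := [set i | (l i <= (4 * n t).-1)%N]; pose Cl := [set j | (k j <= (2 * n t).-1)%N].
have cRw : (#|Rw| <= 2 ^ (4 * n t))%N.
  by apply: leq_trans (cl _) _; rewrite prednK// muln_gt0 expn_gt0.
have cCl : (#|Cl| <= 2 ^ (2 * n t))%N.
  by apply: leq_trans (ck _) _; rewrite prednK// muln_gt0 expn_gt0.
have xr j : `|x j| <= r ^+ (12 * k j).
  rewrite -(@ler_pXn2r _ 2) ?nnegrE ?exprn_ge0// real_normK ?num_real//.
  rewrite -exprM (_ : 12 * k j * 2 = 24 * k j)%N; last by ring.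
  by rewrite exprM r24 exprVn -[leRHS]mul1r ler_pdivlMr ?exprn_gt0// mulrC.
have yr i : `|y i| <= r ^+ (12 * l i).
  rewrite -(@ler_pXn2r _ 2) ?nnegrE ?exprn_ge0// real_normK ?num_real//.
  rewrite -exprM (_ : 12 * l i * 2 = 24 * l i)%N; last by ring.
  by rewrite exprM r24 exprVn -[leRHS]mul1r ler_pdivlMr ?exprn_gt0// mulrC.
have a1 i j : a i j <= 1.
  rewrite -(@ler_pXn2r _ 2)// ?nnegrE// expr1n; apply: le_trans (a_row i).
  by rewrite (bigD1 j)//= lerDl; apply: sumr_ge0 => j' _; exact: sqr_ge0.
(* outside the bulk, an entry is either tiny, among at most [2 ^ (6 * n t)] cells that
   count, or large enough to be paid for by the fourth powers *)
pose far : R := (8^-1) ^+ (2 * n t) * (2 * (r ^+ n t) ^+ 18).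
pose big_ i j : R := a i j ^+ 4 * (2 * (r ^+ n t) ^+ 6).
have cell i j : ((tlog (k j) == t) && near_level (l i) (k j))%:R *
     ((a i j - at_ t i j) * sg w (i, j) * x j * y i) <=
     ((i \in Rw) && (j \in Cl))%:R * far + big_ i j.
  have far0 : 0 <= far by rewrite !mulr_ge0 ?exprn_ge0.
  have big0 : 0 <= big_ i j by rewrite !mulr_ge0 ?exprn_ge0.
  case: (boolP (_ && _)) => [/andP[/eqP kt nl]|_]; last by rewrite mul0r addr_ge0// mulr_ge0.
  rewrite mul1r; have /andP[k1 k2] := tlog_bounds (k j); have /andP[l1 l2] := tlog_bounds (l i).
  move: nl k1 k2; rewrite /near_level kt => /andP[lt tl] k1 k2.
  have hk : (n t <= (k j).+1)%N by [].
  have hl : (n t <= 2 * (l i).+1)%N.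
    apply: (@leq_trans (2 ^ (tlog (l i)).+1)); first by rewrite leq_exp2l.
    by rewrite expnS leq_mul2l.
  have -> : (i \in Rw) && (j \in Cl).
    rewrite !inE; apply/andP; split.
      have h : (2 ^ (tlog (l i)).+1 <= 4 * n t)%N.
        by rewrite (_ : 4 * n t = 2 ^ t.+2)%N ?leq_exp2l// !expnS mulnA.
      by rewrite -ltnS prednK ?muln_gt0 ?expn_gt0//; exact: leq_trans (ltnW l2) h.
    by rewrite -ltnS prednK ?muln_gt0 ?expn_gt0// (leq_trans (ltnW k2))// expnS.
  rewrite mul1r /at_; case: (boolP (bulk t i j)) => hb.
    by rewrite subrr !mul0r addr_ge0.
  rewrite subr0; apply: le_trans (ler_norm _) _.
  rewrite !normrM normr_sg1 mulr1 (ger0_norm (a_ge0 _ _)) -mulrA.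
  have xy : `|x j| * `|y i| <= 2 * (r ^+ n t) ^+ 18.
    have : `|x j| * `|y i| * r ^+ 24 <= (r ^+ n t) ^+ 18.
      apply: (@le_trans _ _ (r ^+ (12 * k j) * r ^+ (12 * l i) * r ^+ 24)).
        by rewrite ler_wpM2r ?exprn_ge0// ler_pM.
      by rewrite -!exprD -exprM ler_wiXn2l//; exact: nat_exponents.
    by rewrite r24; lra.
  apply: (@le_trans _ _ (a i j * (2 * (r ^+ n t) ^+ 18))); first by rewrite ler_wpM2l.
  have r18 : 0 <= 2 * (r ^+ n t) ^+ 18 by rewrite mulr_ge0 ?exprn_ge0.
  move: hb; rewrite /bulk !negb_and -!ltNge orbA => /orP[hf|hb].
    have af : a i j <= (8^-1) ^+ (2 * n t).
      by move: hf; rewrite !inE => /orP[]/existsPn h; rewrite leNgt; [exact: (h j)|exact: (h i)].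
    by apply: (le_trans (ler_wpM2r r18 af)); rewrite -/far lerDl.
  apply: (@le_trans _ _ (big_ i j)); last by rewrite lerDr.
  have a4 : (r ^+ n t) ^+ 12 <= a i j ^+ 4.
    have -> : (r ^+ n t) ^+ 12 = ((r ^+ n t) ^+ 6) ^+ 2 by rewrite -[RHS]exprM.
    have -> : a i j ^+ 4 = (a i j ^+ 2) ^+ 2 by rewrite -[RHS]exprM.
    by rewrite lerXn2r ?nnegrE ?exprn_ge0// ltW.
  rewrite /big_ (_ : (r ^+ n t) ^+ 18 = (r ^+ n t) ^+ 12 * (r ^+ n t) ^+ 6); last by rewrite -exprD.
  rewrite [leLHS](_ : _ = a i j * (r ^+ n t) ^+ 12 * (2 * (r ^+ n t) ^+ 6)); last by ring.
  rewrite ler_wpM2r ?mulr_ge0 ?exprn_ge0//.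
  by apply: le_trans a4; rewrite ler_piMl ?exprn_ge0.
apply: (@le_trans _ _ (\sum_i \sum_j (((i \in Rw) && (j \in Cl))%:R * far + big_ i j))).
  by apply: ler_sum => i _; apply: ler_sum => j _.
under eq_bigr do rewrite big_split/=.
rewrite big_split/=.
have s1 : \sum_i \sum_j ((i \in Rw) && (j \in Cl))%:R * far <= 2 * (r ^+ n t) ^+ 6.
  have -> : \sum_i \sum_j ((i \in Rw) && (j \in Cl))%:R * far = (#|Cl| * #|Rw|)%:R * far.
    transitivity (\sum_(i in Rw) \sum_(j in Cl) far); last first.
      by rewrite !sumr_const -mulrnA mulr_natl.
    rewrite [RHS]big_mkcond; apply: eq_bigr => i _; case: ifP => _ /=; last first.
      by rewrite big1// => j _; rewrite mul0r.
    by rewrite [RHS]big_mkcond; apply: eq_bigr => j _; case: ifP; rewrite ?mul1r ?mul0r.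
  apply: (@le_trans _ _ ((2 ^ (6 * n t))%:R * far)).
    rewrite ler_wpM2r ?mulr_ge0 ?exprn_ge0// ler_nat.
    by rewrite (_ : (6 * n t)%N = (2 * n t + 4 * n t)%N); [rewrite expnD leq_mul|rewrite -mulnDl].
  have -> : (2 ^ (6 * n t))%:R * far = 2 * (r ^+ n t) ^+ 18.
    rewrite /far mulrA natrX.
    have -> : 2 ^+ (6 * n t) * (8^-1) ^+ (2 * n t) = 1 :> R; last by rewrite mul1r.
    rewrite exprM (exprM _ 2) -exprMn (_ : 2 ^+ 6 * 8^-1 ^+ 2 = 1 :> R) ?expr1n//.
    by field.
  by rewrite ler_wpM2l// -!exprM ler_wiXn2l//; lia.
have s2 : \sum_i \sum_j big_ i j <= 2 * (r ^+ n t) ^+ 6.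
  under eq_bigr do rewrite -mulr_suml.
  by rewrite -mulr_suml ler_piMl// mulr_ge0 ?exprn_ge0.
apply: le_trans (lerD s1 s2) _.
have : (r ^+ n t) ^+ 6 <= (r ^+ 6) ^+ t.
  by rewrite -!exprM ler_wiXn2l// [leqRHS]mulnC leq_mul2l/= ltnW// ltn_expl.
lra.
Qed.

(** At the scale [2 ^ t] only a matrix of dimension exponential in [2 ^ t], with
    exponentially small entries, matters. Moments of order [2 ^ t] of such a matrix
    see its dimension only through a constant factor, and the deviation of
    its norm has a mean summable in [t]. Each row meets at most three scales. *)
Lemma near_diagonal_bound : exists N : {ffun I * J -> bool} -> R,
  [/\ forall w, 0 <= N w, avg N <= near_diagonal_cst &
   forall w (x : J -> R) (y : I -> R) (k : J -> nat) (l : I -> nat),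
     \sum_j x j ^+ 2 <= 1 -> \sum_i y i ^+ 2 <= 1 ->
     (forall j, 2 ^+ k j * x j ^+ 2 <= 1) -> (forall i, 2 ^+ l i * y i ^+ 2 <= 1) ->
     (forall j, (k j <= #|J|)%N) ->
     (forall t, #|[set j | (k j <= t)%N]| <= 2 ^ t.+1)%N ->
     (forall t, #|[set i | (l i <= t)%N]| <= 2 ^ t.+1)%N ->
     \sum_i \sum_j (near_level (l i) (k j))%:R *
        (a i j * sg w (i, j) * x j * y i) <= N w].
Proof.
have R00 : 0 <= R0 by rewrite (le_trans _ R01).
have r61 : r ^+ 6 < 1 by rewrite exprn_ilt1// ltW.
have r60 : 0 <= r ^+ 6 by rewrite exprn_ge0// ltW.
have Cr0 : 0 <= Cr by rewrite invr_ge0 subr_ge0 ltW.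
have geo m : \sum_(t < m) (r ^+ 6) ^+ t <= Cr.
  exact: sum_geometric_le.
exists (fun w => 2 * R0 * (1 + \sum_(t < T) rho t w) + 4 * Cr); split.
- move=> w; rewrite addr_ge0 ?mulr_ge0// addr_ge0//.
  by apply: sumr_ge0 => t _; exact: rho_ge0.
- rewrite avgD avg_cst avgZ avgD avg_cst avg_sum /near_diagonal_cst lerD2r.
  have : \sum_(t < T) avg (rho t) <= 4.
    apply: (@le_trans _ _ (\sum_(t < T) 2 * (2^-1) ^+ t)); last first.
      by rewrite -mulr_sumr; have := sum_geometric_half (R := R) T; lra.
    apply: ler_sum => t _; rewrite /rho.
    rewrite (@eq_avg _ _ _ (fun w => (R0 ^+ n t)^-1 * \sum_u lp t w u (n t))); last by move=> w; rewrite mulrC.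
    by rewrite avgZ ler_pdivrMl ?exprn_gt0 ?(lt_le_trans _ R01)//; exact: tr_bound.
  nra.
move=> w x y k l sx sy hx hy kJ ck cl.
pose X t j := (tlog (k j) == t)%:R * x j.
pose Y t i := ((tlog (l i) <= t.+1)%N && (t <= (tlog (l i)).+1)%N)%:R * y i.
have kT j : (tlog (k j) < T)%N.
  rewrite ltnS (leq_trans _ (kJ j))// -ltnS.
  have /andP[h _] := tlog_bounds (k j); apply: leq_trans h; exact: ltn_expl.
have split_t : \sum_i \sum_j (near_level (l i) (k j))%:R * (a i j * sg w (i, j) * x j * y i) =
   \sum_(t < T) (\sum_i \sum_j at_ t i j * sg w (i, j) * X t j * Y t i +
     \sum_i \sum_j ((tlog (k j) == t) && near_level (l i) (k j))%:R *
     ((a i j - at_ t i j) * sg w (i, j) * x j * y i)).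
  under [RHS]eq_bigr do rewrite -big_split/=.
  rewrite [RHS]exchange_big/=; apply: eq_bigr => i _.
  under [RHS]eq_bigr do rewrite -big_split/=.
  rewrite [RHS]exchange_big/=; apply: eq_bigr => j _.
  rewrite (bigD1 (Ordinal (kT j)))//= [X in _ = _ + X]big1 ?addr0; last first.
    move=> t; rewrite -val_eqE/= => tk; rewrite /X eq_sym (negbTE tk)/=.
    by rewrite !mul0r mulr0 mul0r addr0.
  rewrite /X /Y eqxx/= -/(near_level _ _); case: near_level => /=; ring.
rewrite split_t big_split/=; apply: lerD; last first.
  apply: (@le_trans _ _ (\sum_(t < T) 4 * (r ^+ 6) ^+ t)).
    by apply: ler_sum => t _; exact: rest_bound.
  by rewrite -mulr_sumr ler_wpM2l.
set Srho := \sum_(t < T) rho t w.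
have rS (t : 'I_T) : rho t w <= Srho.
  by rewrite /Srho (bigD1 t)//= lerDl; apply: sumr_ge0 => t' _; exact: rho_ge0.
have Srho0 : 0 <= Srho by apply: sumr_ge0 => t _; exact: rho_ge0.
have sq0 (K : finType) (f : K -> R) : 0 <= \sum_i f i ^+ 2.
  by apply: sumr_ge0 => i _; exact: sqr_ge0.
apply: (@le_trans _ _ (\sum_(t < T) 2^-1 * (\sum_j X t j ^+ 2 + \sum_i Y t i ^+ 2) * (R0 * (1 + Srho)))).
  apply: ler_sum => t _; apply: le_trans (bulk_bound _ _ _ _) _.
  by rewrite ler_wpM2l ?mulr_ge0 ?addr_ge0// ler_wpM2l// lerD2l.
rewrite -mulr_suml -mulr_sumr big_split/=.
have SX : \sum_(t < T) \sum_j X t j ^+ 2 <= 1.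
  rewrite exchange_big/=; apply: le_trans sx; apply: ler_sum => j _.
  rewrite (bigD1 (Ordinal (kT j)))//= /X eqxx mul1r big1 ?addr0// => t.
  by rewrite -val_eqE/= eq_sym => /negbTE ->; rewrite mul0r expr0n.
have SY : \sum_(t < T) \sum_i Y t i ^+ 2 <= 3.
  rewrite exchange_big/=; apply: (@le_trans _ _ (\sum_i 3 * y i ^+ 2)); last first.
    by rewrite -mulr_sumr; lra.
  apply: ler_sum => i _; set c := tlog (l i).
  have one (m : nat) : \sum_(t < T) (t == m :> nat)%:R <= 1 :> R.
    case: (ltnP m T) => mT.
      by rewrite (bigD1 (Ordinal mT))//= eqxx big1 ?addr0// => t; rewrite -val_eqE/= => /negbTE ->.
    by rewrite big1// => t _; rewrite (ltn_eqF (leq_trans (ltn_ord t) mT)).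
  apply: (@le_trans _ _ (\sum_(t < T) ((t == c :> nat)%:R + (t == c.+1 :> nat)%:R
      + (t == c.-1 :> nat)%:R) * y i ^+ 2)).
    apply: ler_sum => t _; rewrite /Y exprMn ler_wpM2r ?sqr_ge0//.
    case: (boolP (_ && _)) => [/andP[h1 h2]|_]; last by rewrite expr0n/= !addr_ge0.
    have : [|| t == c :> nat, t == c.+1 :> nat | t == c.-1 :> nat] by exact: nat_close.
    rewrite expr1n; case: eqP => _; case: eqP => _; case: eqP => _ //= _; lra.
  rewrite -mulr_suml !big_split/= ler_wpM2r ?sqr_ge0//.
  have := one c; have := one c.+1; have := one c.-1; lra.
have : 0 <= R0 * (1 + Srho) by rewrite mulr_ge0// addr_ge0.
move: SX SY; set A := \sum_(t < T) _; set B := \sum_(t < T) _; set Q := R0 * _ => h1 h2 h3.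
have -> : 2 * R0 * (1 + Srho) = 2 * Q by rewrite -[LHS]mulrA.
have : 0 <= (4 - (A + B)) * Q by rewrite mulr_ge0//; lra.
lra.
Qed.

End NearDiagonal.

(** * The bilinear form *)

Section HalfBound.
Context {R : realType}.

Definition transp_sign (I J : finType) (w : {ffun I * J -> bool}) : {ffun J * I -> bool} :=
  [ffun s => w (s.2, s.1)].

Lemma avg_transp (I J : finType) (f : {ffun J * I -> bool} -> R) :
  avg (fun w : {ffun I * J -> bool} => f (transp_sign w)) = avg f.
Proof.
rewrite /avg !card_prod mulnC; congr (_ / _).
rewrite [RHS](reindex (@transp_sign I J))//.
exists (@transp_sign J I) => w _; apply/ffunP => -[i j]; by rewrite !ffunE.
Qed.

Lemma sg_transp (I J : finType) (w : {ffun I * J -> bool}) i j :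
  sg (transp_sign w) (j, i) = sg w (i, j) :> R.
Proof. by rewrite /sg ffunE. Qed.

(** A level gap proportional to the level beats the linear factor. *)
Lemma slope_const (c : R) : c < 1 -> exists CL : nat, forall l k : nat,
  l%:R <= c * k%:R -> (k.+1 * 2 ^ l <= CL * 2 ^ k)%N.
Proof.
move=> c1; set q := (2^-1 : R) `^ (1 - c).
have q0 : 0 <= q by exact: powR_ge0.
have q1 : q < 1 by apply: half_powR_lt1; rewrite subr_gt0.
have B0 : 0 <= (1 - q) ^- 2 by rewrite invr_ge0 sqr_ge0.
exists (Num.bound ((1 - q) ^- 2)) => l k lk.
rewrite -(ler_nat R) !natrM !natrX.
have h1 : k.+1%:R * q ^+ k <= (1 - q) ^- 2.
  apply: le_trans (sum_arith_geometric k.+1 q0 q1); rewrite big_ord_recr/= lerDr.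
  by apply: sumr_ge0 => i _; apply: mulr_ge0 => //; exact: exprn_ge0.
have h2 : 2 ^+ l <= q ^+ k * 2 ^+ k :> R.
  rewrite /q -half_powRX -[2 ^+ l]powR_mulrn//.
  apply: (@le_trans _ _ (2 `^ (c * k%:R))); first by apply: ler_powR => //; rewrite ler1n.
  rewrite exprVn powRV ?exprn_ge0// -[2 ^+ k in X in X^-1]powR_mulrn// -powRrM.
  rewrite -[X in _ <= _ * X]powR_mulrn// -powRN -powRD; last by rewrite pnatr_eq0 implybT.
  by apply: ler_powR; rewrite ?ler1n// le_eqVlt; apply/orP; left; apply/eqP; ring.
apply: (@le_trans _ _ (k.+1%:R * (q ^+ k * 2 ^+ k))); first by rewrite ler_wpM2l.
rewrite mulrA ler_wpM2r ?exprn_ge0//; apply: (le_trans h1).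
exact: ltW (archi_boundP B0).
Qed.

(** Each row with an entry above [8 ^- k] spends at least [2 ^- (6 s k)] of the power
    sum. *)
Lemma near_count (I J : finType) (a : I -> J -> R) (s : R) (D : nat) k :
  (forall i j, 0 <= a i j) -> 0 < s -> 6 * s <= D%:R ->
  \sum_i \sum_j a i j `^ (2 * s) <= 1 ->
  (#|[set i | [exists j, (8^-1 ^+ k < a i j)%R]]| <= 2 ^ (D * k))%N.
Proof.
move=> a0 s0 sD ha; set A := [set i | _].
rewrite -(ler_nat R) natrX.
have t0 : 0 < (8^-1 ^+ k : R) by rewrite exprn_gt0.
have h : #|A|%:R * (8^-1 ^+ k) `^ (2 * s) <= 1.
  apply: le_trans ha; rewrite mulr_natl -sumr_const.
  rewrite [leRHS](bigID (mem A))/= -[leLHS]addr0 lerD//; last first.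
    by apply: sumr_ge0 => i _; apply: sumr_ge0 => j _; exact: powR_ge0.
  apply: ler_sum => i; rewrite inE => /existsP[j ij].
  rewrite (bigD1 j)//= -[leLHS]addr0 lerD//; last by apply: sumr_ge0 => *; exact: powR_ge0.
  by apply: ler_wpowR; [rewrite mulr_ge0// ltW|rewrite ltW|rewrite ltW].
have e8 : (8^-1 ^+ k : R) `^ (2 * s) = (2 `^ (6 * s * k%:R))^-1.
  rewrite exprVn powRV ?exprn_ge0//; congr (_^-1).
  have -> : 8 = 2 `^ 3%:R :> R by rewrite powR_mulrn//; ring.
  rewrite -[(_ `^ _) ^+ k]powR_mulrn ?powR_ge0// -!powRrM; congr (_ `^ _); ring.
move: h; rewrite e8 ler_pdivrMr ?powR_gt0// mul1r => /le_trans; apply.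
rewrite -powR_mulrn//; apply: ler_powR; first by rewrite ler1n.
by rewrite natrM ler_wpM2r.
Qed.

Lemma sqr_sum_le1 (I : finType) (y : I -> R) (q : R) : 0 < q -> q <= 2 ->
  \sum_i `|y i| `^ q <= 1 -> \sum_i y i ^+ 2 <= 1.
Proof.
move=> q0 q2 hy.
have y1 i : `|y i| <= 1 by exact: coord_le1 hy.
apply: le_trans hy; apply: ler_sum => i _.
have [->|yn0] := eqVneq (y i) 0; first by rewrite expr0n normr0/= powR_ge0.
rewrite -real_normK ?num_real// -powR_mulrn//.
by apply: ger_powR => //; rewrite normr_gt0 yn0 y1.
Qed.

Lemma balanced_sum (p g : R) (D K : nat) : 0 < g + p^-1 - 1 ->
  \sum_(k < K) 2 * ((2^-1) ^+ k) `^ p^-1 * Num.sqrt (balanced_entropy D k 0) *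
     (2 * Num.sqrt (2 ^+ k) * ((2^-1) ^+ k) `^ g)
  <= 4 * Num.sqrt (2 * (4 * D + 13)%:R) * (1 - (2^-1) `^ (g + p^-1 - 1)) ^- 2 :> R.
Proof.
move=> k0; set ka := g + p^-1 - 1.
have q0 : 0 <= (2^-1 : R) `^ ka by exact: powR_ge0.
have q1 : (2^-1 : R) `^ ka < 1 by exact: half_powR_lt1.
have s0 : 0 <= 4 * Num.sqrt (2 * (4 * D + 13)%:R) :> R by rewrite mulr_ge0 ?sqrtr_ge0.
apply: le_trans (ler_wpM2l s0 (sum_arith_geometric K q0 q1)).
rewrite mulr_sumr; apply: ler_sum => k _.
have sE : Num.sqrt (balanced_entropy D k 0) =
    Num.sqrt (2 * (4 * D + 13)%:R) * Num.sqrt k.+1%:R * Num.sqrt (2 ^+ k) :> R.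
  rewrite -!sqrtrM ?mulr_ge0 ?ler0n//; congr Num.sqrt.
  by rewrite /balanced_entropy addn0 !natrM natrX exprS; ring.
have sq2 : Num.sqrt (2 ^+ k) ^+ 2 = 2 ^+ k :> R by rewrite sqr_sqrtr ?exprn_ge0.
have sk : Num.sqrt k.+1%:R <= k.+1%:R :> R.
  rewrite -[leRHS]ger0_norm// -sqrtr_sqr ler_wsqrtr// expr2 ler_peMl//.
  by rewrite ler1n.
have hE : ((2^-1) ^+ k) `^ p^-1 * ((2^-1) ^+ k) `^ g * 2 ^+ k = ((2^-1) `^ ka) ^+ k :> R.
  rewrite -half_powRX /ka (_ : g + p^-1 - 1 = p^-1 + g - 1); last by ring.
  have hk : 0 < (2^-1 : R) ^+ k by rewrite exprn_gt0.
  rewrite powRD; last by apply/implyP => _; rewrite gt_eqF.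
  rewrite powRD; last by apply/implyP => _; rewrite gt_eqF.
  by rewrite powR_inv1 ?ltW// exprVn invrK.
rewrite sE.
rewrite [leLHS](_ : _ = 4 * Num.sqrt (2 * (4 * D + 13)%:R) * (Num.sqrt k.+1%:R *
   (((2^-1) ^+ k) `^ p^-1 * ((2^-1) ^+ k) `^ g * Num.sqrt (2 ^+ k) ^+ 2))); last by ring.
by rewrite sq2 hE ler_wpM2l// ler_wpM2r// exprn_ge0.
Qed.

Lemma half_powR_le (c d : R) (k l : nat) : 0 <= d -> c * k%:R <= l%:R ->
  ((2^-1 : R) ^+ l) `^ d <= ((2^-1) ^+ k) `^ (c * d).
Proof.
have e (m : nat) (t : R) : ((2^-1 : R) ^+ m) `^ t = 2^-1 `^ (m%:R * t).
  by rewrite -[X in X `^ t]powR_mulrn ?invr_ge0// -powRrM.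
move=> d0 kl; rewrite !e; apply: ger_powR.
  by rewrite invr_gt0 ltr0n invf_le1 ?ltr0n// ler1n.
by rewrite mulrA (mulrC _ c) ler_wpM2r.
Qed.

(** Unless [al = be = 2], comparable levels come with an exponential gain that pays
    for their crude description; the cells with [l] below [c * k] are unbalanced.
    The relation [F] selects the cells where the columns are the finer ones, the
    others being treated after transposition. *)
Lemma half_bound (al be p q : R) (D : nat) :
  2 <= al -> 2 <= be -> (2 < al) || (2 < be) -> 0 < p -> 0 < q ->
  p^-1 + al^-1 = 1 -> q^-1 + be^-1 = 1 ->
  exists2 C : R, 0 <= C &
  forall (I J : finType) (a : I -> J -> R) (F : nat -> nat -> bool),
    (forall i j, 0 <= a i j) -> (forall i, \sum_j a i j `^ al <= 1) ->
    (forall j, \sum_i a i j `^ be <= 1) ->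
    (forall k, #|[set i | [exists j, (8^-1 ^+ k < a i j)%R]]| <= 2 ^ (D * k))%N ->
    (forall k, #|[set j | [exists i, (8^-1 ^+ k < a i j)%R]]| <= 2 ^ (D * k))%N ->
    (forall l k, F l k -> (l <= k)%N) ->
  exists N : {ffun I * J -> bool} -> R,
  [/\ forall w, 0 <= N w, avg N <= C &
   forall w (x : J -> R) (y : I -> R),
     \sum_j `|x j| `^ p <= 1 -> \sum_i `|y i| `^ q <= 1 ->
     \sum_i \sum_j (F (level (fun i => `|y i| `^ q) i) (level (fun j => `|x j| `^ p) j))%:R *
        (a i j * sg w (i, j) * x j * y i) <= N w].
Proof.
move=> al2 be2 ab p0 q0 pal qbe.
have al0 : 0 < al by lra.
have be0 : 0 < be by lra.
have q2 : q <= 2.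
  have : 2^-1 <= q^-1.
    have : be^-1 <= 2^-1 by rewrite lef_pV2 ?posrE.
    by lra.
  by rewrite lef_pV2 ?posrE.
have [c [g [c1 kap hG]]] : exists c g : R, [/\ c < 1, 0 < g + p^-1 - 1 &
   forall (I J : finType) (a : I -> J -> R) (y : I -> R) (l : I -> nat) (k : nat) (J0 : {set J})
     (P : pred I),
    (forall i j, 0 <= a i j) -> (forall i, \sum_j a i j `^ al <= 1) ->
    (forall j, \sum_i a i j `^ be <= 1) -> (#|J0| <= 2 ^ k.+1)%N ->
    \sum_i `|y i| `^ q <= 1 -> (forall i, `|y i| <= ((2^-1) ^+ l i) `^ q^-1) ->
    (forall i, P i -> c * k%:R <= (l i)%:R) ->
    \sum_(i | P i) \sum_(j in J0) y i ^+ 2 * a i j ^+ 2 <=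
      (2 * Num.sqrt (2 ^+ k) * ((2^-1) ^+ k) `^ g) ^+ 2].
  have hk k : 0 < (2^-1 : R) ^+ k by rewrite exprn_gt0.
  have sqE k g' : (2 * Num.sqrt (2 ^+ k) * ((2^-1) ^+ k) `^ g') ^+ 2 =
      4 * (2 ^+ k * ((2^-1) ^+ k) `^ (2 * g')) :> R.
    rewrite !exprMn sqr_sqrtr ?exprn_ge0// -[_ ^+ 2 in X in _ * X = _]powR_mulrn ?powR_ge0//.
    by rewrite -powRrM (mulrC g'); ring.
  have [be22|be22] := ltP 2 be.
    (* rows of level at least [k / 2] have a small norm in [l 2], since [q < 2] *)
    pose de := 1 - 2 * be^-1.
    have de0 : 0 < de.
      have : be^-1 < 2^-1 by rewrite ltf_pV2 ?posrE.
      by rewrite /de; lra.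
    exists 2^-1, (al^-1 + de / 4); split; [lra|by lra|].
    move=> I J a y l k J0 P a0 arow acol cJ hy yl Pl.
    rewrite sqE.
    have -> : 2 * (al^-1 + de / 4) = al^-1 * 2 + de / 2 by field; rewrite gt_eqF.
    rewrite powRD; last by apply/implyP => _; rewrite gt_eqF.
    set z := ((2^-1) ^+ k) `^ al^-1.
    have z0 : 0 < z by rewrite powR_gt0.
    have zal : z `^ al = (2^-1) ^+ k by rewrite -powRrM mulVf ?powRr1 ?gt_eqF// ltW.
    have -> : ((2^-1) ^+ k) `^ (al^-1 * 2) = z ^+ 2 by rewrite powRrM powR_mulrn// ltW.
    have aj i : \sum_(j in J0) a i j ^+ 2 <= 3 * (2 ^+ k * z ^+ 2).
      apply: (@le_trans _ _ (\sum_(j in J0) z ^+ 2 * (1 + 2 ^+ k * a i j `^ al))).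
        apply: ler_sum => j _; have := le_sqr_powR (a0 i j) z0 al2.
        by rewrite zal exprVn invrK.
      rewrite -mulr_sumr big_split/= -mulr_sumr mulrCA mulrA [leRHS]mulrC.
      rewrite ler_wpM2l ?sqr_ge0// sumr_const -[_ *+ _]mulr_natl mulr1.
      have h1 : #|J0|%:R <= 2 * 2 ^+ k :> R by rewrite -exprS -natrX ler_nat.
      have h2 : 2 ^+ k * \sum_(j in J0) a i j `^ al <= 2 ^+ k.
        rewrite ler_piMr ?exprn_ge0//; apply: le_trans (arow i).
        rewrite [leRHS](bigID (mem J0))/= lerDl; apply: sumr_ge0 => *; exact: powR_ge0.
      lra.
    have yi i : P i -> y i ^+ 2 <= `|y i| `^ q * ((2^-1) ^+ k) `^ (de / 2).
      move=> Pi; have [->|yn0] := eqVneq (y i) 0.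
        by rewrite expr0n/= mulr_ge0 ?powR_ge0.
      have -> : y i ^+ 2 = `|y i| `^ q * `|y i| `^ (2 - q).
        rewrite -powRD; last by apply/implyP => _; rewrite normr_eq0.
        by rewrite subrKC -real_normK ?num_real// powR_mulrn.
      rewrite ler_wpM2l ?powR_ge0//.
      apply: (@le_trans _ _ ((((2^-1) ^+ l i) `^ q^-1) `^ (2 - q))).
        by apply: ler_wpowR => //; lra.
      rewrite -powRrM (_ : q^-1 * (2 - q) = de); last first.
        rewrite /de mulrBr mulVf ?gt_eqF//; have : q^-1 = 1 - be^-1 by lra.
        by move=> ->; ring.
      by apply: le_trans (half_powR_le (ltW de0) (Pl i Pi)) _; rewrite mulrC.
    apply: (@le_trans _ _ (\sum_(i | P i) (`|y i| `^ q * ((2^-1) ^+ k) `^ (de / 2)) *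
       (3 * (2 ^+ k * z ^+ 2)))).
      apply: ler_sum => i Pi; rewrite -mulr_sumr; apply: ler_pM; rewrite ?sqr_ge0 ?yi//.
      by apply: sumr_ge0 => j _; exact: sqr_ge0.
    rewrite -!mulr_suml.
    have hP : \sum_(i | P i) `|y i| `^ q <= 1.
      apply: le_trans hy; rewrite [leRHS](bigID P)/= lerDl.
      by apply: sumr_ge0 => *; exact: powR_ge0.
    set W := ((2^-1) ^+ k) `^ (de / 2) in hP *; have W0 : 0 <= W by exact: powR_ge0.
    have Q0 : 0 <= 2 ^+ k * z ^+ 2 by rewrite mulr_ge0 ?exprn_ge0 ?(ltW z0).
    rewrite -mulrA; apply: (@le_trans _ _ (1 * (W * (3 * (2 ^+ k * z ^+ 2))))).
      by rewrite ler_wpM2r// mulr_ge0// mulr_ge0.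
    have : 0 <= W * (2 ^+ k * z ^+ 2) by rewrite mulr_ge0.
    by rewrite [X in _ <= 4 * X]mulrA [X in _ <= 4 * X]mulrC; lra.
  (* here the coordinates of [y] themselves are small, and the columns of [a] are
     square summable *)
  have beE : be = 2 by lra.
  have al22 : 2 < al by move: ab; rewrite beE ltxx orbF.
  have ali : al^-1 < 2^-1 by rewrite ltf_pV2 ?posrE.
  have qE : q = 2.
    have : q^-1 = 2^-1 by rewrite beE in qbe; lra.
    by move=> h; rewrite -[q]invrK h invrK.
  exists (2^-1 + al^-1), (4^-1 + al^-1 / 2); split; [by lra|by lra|].
  move=> I J a y l k J0 P a0 arow acol cJ hy yl Pl.
  rewrite sqE.
  have -> : 2 * (4^-1 + al^-1 / 2) = 2^-1 + al^-1 by field; rewrite gt_eqF.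
  set W := ((2^-1) ^+ k) `^ (2^-1 + al^-1); have W0 : 0 <= W by exact: powR_ge0.
  have yi i : P i -> y i ^+ 2 <= W.
    move=> Pi; apply: (@le_trans _ _ ((((2^-1) ^+ l i) `^ q^-1) ^+ 2)).
      by rewrite -real_normK ?num_real// lerXn2r ?nnegrE ?powR_ge0.
    rewrite -powR_mulrn ?powR_ge0// -powRrM qE mulVf ?pnatr_eq0//.
    by apply: le_trans (half_powR_le ler01 (Pl i Pi)) _; rewrite mulr1.
  rewrite exchange_big/=.
  apply: (@le_trans _ _ (\sum_(j in J0) W)).
    apply: ler_sum => j _; apply: (@le_trans _ _ (\sum_(i | P i) W * a i j ^+ 2)).
      by apply: ler_sum => i Pi; rewrite ler_wpM2r ?sqr_ge0 ?yi.
    rewrite -mulr_sumr ler_piMr//; apply: le_trans (acol j).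
    rewrite [leRHS](bigID P)/= -[leLHS]addr0 lerD//; last by apply: sumr_ge0 => *; exact: powR_ge0.
    by apply: ler_sum => i _; rewrite beE powR_mulrn.
  rewrite sumr_const -[leLHS]mulr_natl.
  apply: (@le_trans _ _ ((2 * 2 ^+ k) * W)).
    by rewrite ler_wpM2r// -exprS -natrX ler_nat.
  have : 0 <= 2 ^+ k * W by rewrite mulr_ge0 ?exprn_ge0.
  by rewrite -mulrA; lra.
have [CL hCL] := slope_const c1.
pose Cu : R := 8 * CL%:R + 420 * Num.sqrt ((D + 4) * (2 * CL) + 8)%:R * (1 - (2^-1) `^ al^-1) ^- 2.
pose Cb : R := 4 * Num.sqrt (2 * (4 * D + 13)%:R) * (1 - (2^-1) `^ (g + p^-1 - 1)) ^- 2.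
have Cb0 : 0 <= Cb by rewrite !mulr_ge0 ?sqrtr_ge0// invr_ge0 sqr_ge0.
exists (Cu + (16 + 7 * Cb)).
  have Cu0 : 0 <= Cu.
    have h1 : 0 <= 8 * CL%:R :> R by rewrite -natrM ler0n.
    have h2 : 0 <= 420 * Num.sqrt ((D + 4) * (2 * CL) + 8)%:R :> R.
      by apply: mulr_ge0; [rewrite ler0n|exact: sqrtr_ge0].
    by apply: (addr_ge0 h1); apply: (mulr_ge0 h2); rewrite invr_ge0 sqr_ge0.
  by apply: (addr_ge0 Cu0); apply: addr_ge0; [rewrite ler0n|apply: mulr_ge0 => //; rewrite ler0n].
move=> I J a F a0 arow acol nr nc Fle.
pose low l k := l%:R <= c * k%:R :> R.
pose U l k := F l k && low l k; pose W l k := F l k && ~~ low l k.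
have [|N1 [N10 aN1 bN1]] := @unbalanced_bound R al p D CL al2 p0 pal I J a U a0 arow nr.
  by move=> l k /andP[_]; exact: hCL.
have a1 i j : a i j <= 1 by exact: sum_powR_le1 al0 (a0 i) (arow i).
have [|N2 [N20 aN2 bN2]] := @balanced_bound R p D p0 I J a W a0 a1 nr nc.
  by move=> l k /andP[/Fle].
exists (fun w => N1 w + (16 + Cb * N2 w)); split.
- by move=> w; rewrite addr_ge0// addr_ge0// mulr_ge0.
- rewrite avgD lerD// avgD avg_cst avgZ lerD2l mulrC.
  by rewrite ler_wpM2r.
move=> w x y hx hy.
pose l := level (fun i => `|y i| `^ q); pose k := level (fun j => `|x j| `^ p).
have y2 : \sum_i y i ^+ 2 <= 1 by exact: sqr_sum_le1 q0 q2 hy.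
have cl t : (#|[set i | (l i <= t)%N]| <= 2 ^ t.+1)%N by exact: card_level_le.
have h1 := bN1 w x y l hx y2 cl.
have G0 m : 0 <= 2 * Num.sqrt (2 ^+ m) * ((2^-1) ^+ m) `^ g.
  by rewrite !mulr_ge0 ?sqrtr_ge0 ?powR_ge0.
have h2 := bN2 w x y l (fun m => 2 * Num.sqrt (2 ^+ m) * ((2^-1) ^+ m) `^ g) hx y2 cl G0.
have -> : \sum_i \sum_j (F (l i) (k j))%:R * (a i j * sg w (i, j) * x j * y i) =
  \sum_i \sum_j (U (l i) (k j))%:R * (a i j * sg w (i, j) * x j * y i) +
  \sum_i \sum_j (W (l i) (k j))%:R * (a i j * sg w (i, j) * x j * y i).
  rewrite -big_split/=; apply: eq_bigr => i _; rewrite -big_split/=; apply: eq_bigr => j _.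
  by rewrite -mulrDl -natrD /U /W; case: (F _ _); case: (low _ _).
apply: lerD => //; apply: (le_trans (h2 _)).
  move=> m J0 cJ; apply: (hG I J a y l m J0 (fun i => W (l i) m)) => //.
    by move=> i; exact: level_coord.
  by move=> i /andP[_]; rewrite /low -ltNge => /ltW.
rewrite lerD2l mulrC ler_wpM2r//; exact: balanced_sum.
Qed.

End HalfBound.

Section SignForm.
Context {R : realType}.

(** Levels that are not comparable on the doubly logarithmic scale are already
    unbalanced: [k] is then at least twice [l]. *)
Lemma tlog_gap l k : ((tlog l).+2 <= tlog k)%N -> (k.+1 * 2 ^ l <= 2 * 2 ^ k)%N.
Proof.
move=> lk; have /andP[_ hl] := tlog_bounds l; have /andP[hk _] := tlog_bounds k.
have h : (2 * l.+1 < k.+1)%N.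
  apply: leq_trans hk; apply: (@leq_trans (2 * 2 ^ (tlog l).+1)).
    by rewrite ltn_pmul2l.
  by rewrite -expnS leq_exp2l.
have h2 : (k.+1 <= 2 * (k - l))%N by lia.
have lk' : (l <= k)%N by lia.
rewrite -[in X in (_ <= X)%N](subnK lk') expnD mulnA leq_mul2r; apply/orP; right.
by apply: (leq_trans h2); rewrite leq_mul2l/= ltnW// ltn_expl.
Qed.

Lemma near_level_cases l k :
  (near_level l k + ((tlog l).+2 <= tlog k) + ((tlog k).+2 <= tlog l))%N = 1%N.
Proof. by rewrite /near_level; case: leqP; case: leqP; case: leqP; case: leqP => //=; lia. Qed.

Lemma sqr_powR (x : R) : `|x| `^ 2 = x ^+ 2.
Proof. by rewrite powR_mulrn// real_normK ?num_real. Qed.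

(** Without exponential gain, only levels within a bounded factor of each other are
    treated as comparable, by the moment method; all others are unbalanced. *)
Lemma sign_form_bound2 (D : nat) : exists2 C : R, 0 <= C &
  forall (I J : finType) (a : I -> J -> R),
    (forall i j, 0 <= a i j) -> (forall i, \sum_j a i j ^+ 2 <= 1) ->
    (forall j, \sum_i a i j ^+ 2 <= 1) -> \sum_i \sum_j a i j ^+ 4 <= 1 ->
    (forall k, #|[set i | [exists j, (8^-1 ^+ k < a i j)%R]]| <= 2 ^ (D * k))%N ->
    (forall k, #|[set j | [exists i, (8^-1 ^+ k < a i j)%R]]| <= 2 ^ (D * k))%N ->
  exists N : {ffun I * J -> bool} -> R,
  [/\ forall w, 0 <= N w, avg N <= C &
   forall w (x : J -> R) (y : I -> R),
     \sum_j x j ^+ 2 <= 1 -> \sum_i y i ^+ 2 <= 1 ->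
     \sum_i \sum_j a i j * sg w (i, j) * x j * y i <= N w].
Proof.
pose Cu : R := 8 * 2%:R + 420 * Num.sqrt ((D + 4) * (2 * 2) + 8)%:R * (1 - (2^-1) `^ 2^-1) ^- 2.
exists (Num.max 0 (Cu + (near_diagonal_cst (R := R) D + Cu))); first by rewrite le_max lexx.
move=> I J a a0 arow acol afour nr nc.
have [i0 _|I0] := pickP (fun _ : I => true); last first.
  exists (fun=> 0); split => //; first by rewrite avg_cst le_max lexx.
  by move=> w x y _ _; rewrite big1// => i; have := I0 i.
have [j0 _|J0] := pickP (fun _ : J => true); last first.
  exists (fun=> 0); split => //; first by rewrite avg_cst le_max lexx.
  by move=> w x y _ _; rewrite big1// => i _; rewrite big1// => j; have := J0 j.
pose U l k := ((tlog l).+2 <= tlog k)%N.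
have two : (2^-1 + 2^-1 = 1 :> R) by field.
have p0 : 0 < (2 : R) by [].
have arow' i : \sum_j a i j `^ 2 <= 1.
  by under eq_bigr do rewrite powR_mulrn//; exact: arow.
have acol' j : \sum_i a i j `^ 2 <= 1.
  by under eq_bigr do rewrite powR_mulrn//; exact: acol.
have [|N1 [N10 aN1 bN1]] := @unbalanced_bound R 2 2 D 2 (lexx _) p0 two I J a U a0 arow' nr.
  by move=> l k; exact: tlog_gap.
have [||N2 [N20 aN2 bN2]] := @unbalanced_bound R 2 2 D 2 (lexx _) p0 two J I
   (fun j i => a i j) U _ acol' nc => //.
  by move=> l k; exact: tlog_gap.
have [N3 [N30 aN3 bN3]] := @near_diagonal_bound R D I J a i0 j0 a0 arow acol afour nr nc.
exists (fun w => N1 w + (N3 w + N2 (transp_sign w))); split.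
- by move=> w; rewrite addr_ge0// addr_ge0.
- rewrite avgD avgD (avg_transp N2) le_max; apply/orP; right.
  by apply: lerD => //; apply: lerD.
move=> w x y hx hy.
have hx' : \sum_j `|x j| `^ 2 <= 1 by under eq_bigr do rewrite sqr_powR.
have hy' : \sum_i `|y i| `^ 2 <= 1 by under eq_bigr do rewrite sqr_powR.
pose k := level (fun j => `|x j| `^ 2); pose l := level (fun i => `|y i| `^ 2).
have ck t : (#|[set j | (k j <= t)%N]| <= 2 ^ t.+1)%N by exact: card_level_le.
have cl t : (#|[set i | (l i <= t)%N]| <= 2 ^ t.+1)%N by exact: card_level_le.
have lev (K : finType) (z : K -> R) u : \sum_u `|z u| `^ 2 <= 1 ->
    2 ^+ level (fun u => `|z u| `^ 2) u * z u ^+ 2 <= 1.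
  move=> hz; have := @level_coord R 2 p0 K z u hz; set v := level _ _ => zu.
  have v0 : 0 <= (2^-1 : R) ^+ v by rewrite exprn_ge0.
  have : `|z u| ^+ 2 <= (((2^-1 : R) ^+ v) `^ 2^-1) ^+ 2 by rewrite lerXn2r ?nnegrE ?powR_ge0.
  rewrite real_normK ?num_real// -[leRHS]powR_mulrn ?powR_ge0// -powRrM mulVf// powRr1//.
  by rewrite exprVn -[leRHS]mul1r ler_pdivlMr ?exprn_gt0// mulrC.
have h1 := bN1 w x y l hx' hy cl.
have h2 := bN2 (transp_sign w) y x k hy' hx ck.
have h3 := bN3 w x y k l hx hy (fun j => lev J x j hx') (fun i => lev I y i hy')
  (fun j => level_lt _ j) ck cl.
apply: le_trans (lerD h1 (lerD h3 h2)).
rewrite [X in _ <= _ + (_ + X)]exchange_big/= -!big_split/= le_eqVlt; apply/orP; left; apply/eqP.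
apply: eq_bigr => i _; rewrite -!big_split/=; apply: eq_bigr => j _.
rewrite sg_transp -/(k) -/(l).
have := near_level_cases (l i) (k j) => /(congr1 (fun n : nat => n%:R : R)).
rewrite !natrD /U => h; transitivity (1%:R * (a i j * sg w (i, j) * x j * y i)); first by rewrite mul1r.
by rewrite -h; ring.
Qed.

(** One variable [N] for all [x] and [y]: a supremum over an infinite set is thus
    integrated without being formed. *)
Lemma sign_form_bound (al be p q : R) :
  2 <= al -> 2 <= be -> 0 < p -> 0 < q -> p^-1 + al^-1 = 1 -> q^-1 + be^-1 = 1 ->
  exists2 C : R, 0 <= C &
  forall (I J : finType) (a : I -> J -> R),
    (forall i j, 0 <= a i j) -> (forall i, \sum_j a i j `^ al <= 1) ->
    (forall j, \sum_i a i j `^ be <= 1) ->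
    \sum_i \sum_j a i j `^ (2 * Num.max al be) <= 1 ->
  exists N : {ffun I * J -> bool} -> R,
  [/\ forall w, 0 <= N w, avg N <= C &
   forall w (x : J -> R) (y : I -> R),
     \sum_j `|x j| `^ p <= 1 -> \sum_i `|y i| `^ q <= 1 ->
     \sum_i \sum_j a i j * sg w (i, j) * x j * y i <= N w].
Proof.
move=> al2 be2 p0 q0 pal qbe; set s := Num.max al be.
have s0 : 0 < s by rewrite lt_max (lt_le_trans _ al2).
pose D := Num.bound (6 * s).
have sD : 6 * s <= D%:R by apply/ltW/archi_boundP; rewrite mulr_ge0// ltW.
have [ab|] := boolP ((2 < al) || (2 < be)); last first.
  rewrite negb_or -!leNgt => /andP[al2' be2'].
  have alE : al = 2 by apply/le_anti/andP.
  have beE : be = 2 by apply/le_anti/andP.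
  have half (t : R) : t^-1 + 2^-1 = 1 -> t = 2.
    by move=> h; have : t^-1 = 2^-1 by [lra]; move=> h'; rewrite -[t]invrK h' invrK.
  have pE : p = 2 by apply: half; rewrite -[X in _ + X^-1]alE.
  have qE : q = 2 by apply: half; rewrite -[X in _ + X^-1]beE.
  have [C C0 hC] := sign_form_bound2 D; exists C => // I J a a0 arow acol afour.
  have nr k := near_count k a0 s0 sD afour.
  have nc k : (#|[set j | [exists i, (8^-1 ^+ k < a i j)%R]]| <= 2 ^ (D * k))%N.
    by apply: (@near_count R J I (fun j i => a i j) s) => //; rewrite exchange_big.
  have r2 i : \sum_j a i j ^+ 2 <= 1.
    by have := arow i; rewrite alE; under eq_bigr do rewrite powR_mulrn//.
  have c2 j : \sum_i a i j ^+ 2 <= 1.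
    by have := acol j; rewrite beE; under eq_bigr do rewrite powR_mulrn//.
  have f4 : \sum_i \sum_j a i j ^+ 4 <= 1.
    move: afour; rewrite /s alE beE maxxx -natrM.
    by under eq_bigr do under eq_bigr do rewrite powR_mulrn//.
  have [N [N0 aN bN]] := hC I J a a0 r2 c2 f4 nr nc.
  exists N; split => // w x y; rewrite pE qE => hx hy; apply: bN.
    by move: hx; under eq_bigr do rewrite sqr_powR.
  by move: hy; under eq_bigr do rewrite sqr_powR.
have [C1 C10 h1] := half_bound D al2 be2 ab p0 q0 pal qbe.
have ba : (2 < be) || (2 < al) by rewrite orbC.
have [C2 C20 h2] := half_bound D be2 al2 ba q0 p0 qbe pal.
exists (C1 + C2); first exact: addr_ge0.
move=> I J a a0 arow acol amax.
have nr k := near_count k a0 s0 sD amax.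
have nc k : (#|[set j | [exists i, (8^-1 ^+ k < a i j)%R]]| <= 2 ^ (D * k))%N.
  by apply: (@near_count R J I (fun j i => a i j) s) => //; rewrite exchange_big.
have [//|N1 [N10 aN1 bN1]] := h1 I J a leq a0 arow acol nr nc.
have [//||N2 [N20 aN2 bN2]] := h2 J I (fun j i => a i j) ltn _ acol arow nc nr.
  by move=> l k /ltnW.
exists (fun w => N1 w + N2 (transp_sign w)); split.
- by move=> w; rewrite addr_ge0.
- by rewrite avgD (avg_transp N2) lerD.
move=> w x y hx hy.
apply: le_trans (lerD (bN1 w x y hx hy) (bN2 (transp_sign w) y x hy hx)).
rewrite [X in _ <= _ + X]exchange_big/= -big_split/= le_eqVlt; apply/orP; left; apply/eqP.
apply: eq_bigr => i _; rewrite -big_split/=; apply: eq_bigr => j _.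
rewrite sg_transp; set l := level _ i; set k := level _ j.
rewrite ltnNge; case: (l <= k)%N => /=; ring.
Qed.

End SignForm.

(** * The operator norm *)

Section OperatorNorm.
Context {R : realType}.
Implicit Types (r al be : R) (m n : nat).

Lemma lpnorm0 r n : 0 < r -> lpnorm r%:E (0 : 'cV[R]_n) = 0.
Proof.
move=> r0; rewrite /lpnorm big1 ?powR0 ?invr_eq0 ?gt_eqF// => i _.
by rewrite mxE normr0 powR0// gt_eqF.
Qed.

Lemma lpnorm_ge0 r n (x : 'cV[R]_n) : 0 <= lpnorm r%:E x.
Proof. exact: powR_ge0. Qed.

Lemma lpnorm_le1 r n (x : 'cV[R]_n) : 0 < r -> lpnorm r%:E x <= 1 ->
  \sum_i `|x i 0| `^ r <= 1.
Proof.
move=> r0; apply: powR_le1; last by rewrite invr_gt0.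
by apply: sumr_ge0 => *; exact: powR_ge0.
Qed.

Lemma opnorm_le (p q c : R) m n (M : 'M[R]_(m, n)) : 0 < p -> 0 < q ->
  (forall x : 'cV_n, lpnorm p%:E x <= 1 -> lpnorm q%:E (M *m x) <= c) ->
  opnorm p%:E q%:E M <= c.
Proof.
move=> p0 q0 h; apply: ge_sup.
  have h0 : lpnorm p%:E (0 : 'cV[R]_n) <= 1 by rewrite lpnorm0.
  by exists (lpnorm q%:E (M *m (0 : 'cV_n))); exists 0.
by move=> _ [x hx <-]; exact: h.
Qed.

(** The extremal functional of Hölder's inequality. *)
Lemma lpnorm_dual r n (z : 'cV[R]_n) : 1 < r -> exists2 y : 'I_n -> R,
  \sum_i `|y i| `^ (r / (r - 1)) <= 1 & lpnorm r%:E z = \sum_i y i * z i 0.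
Proof.
move=> r1; have r0 : 0 < r by exact: lt_trans ltr01 r1.
have e0 : r / (r - 1) != 0 by rewrite gt_eqF// divr_gt0// subr_gt0.
set L := lpnorm r%:E z; have L0 : 0 <= L := lpnorm_ge0 r z.
have Lr : L `^ r = \sum_i `|z i 0| `^ r.
  by rewrite -powRrM mulVf ?gt_eqF// powRr1//; apply: sumr_ge0 => *; exact: powR_ge0.
have [L00|Ln0] := eqVneq L 0.
  exists (fun=> 0); last by rewrite L00 big1// => i _; rewrite mul0r.
  by rewrite big1// => i _; rewrite normr0 powR0.
have Lgt0 : 0 < L by rewrite lt_def Ln0.
exists (fun i => Num.sg (z i 0) * (`|z i 0| / L) `^ (r - 1)).
  apply: (@le_trans _ _ (\sum_i (`|z i 0| / L) `^ r)); last first.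
    under eq_bigr do rewrite powRM ?invr_ge0// powRV//.
    by rewrite -mulr_suml -Lr divff// gt_eqF// powR_gt0.
  apply: ler_sum => i _; rewrite normrM (ger0_norm (powR_ge0 _ _)).
  have [->|zn0] := eqVneq (z i 0) 0.
    by rewrite sgr0 !normr0 mul0r [leLHS]powR0 ?powR_ge0.
  rewrite normr_sg zn0 mul1r -powRrM mulrCA divff ?mulr1// subr_eq0 gt_eqF//.
have -> : \sum_i Num.sg (z i 0) * (`|z i 0| / L) `^ (r - 1) * z i 0 =
    \sum_i L * (`|z i 0| / L) `^ r.
  apply: eq_bigr => i _; have [->|zn0] := eqVneq (z i 0) 0.
    by rewrite mulr0 normr0 mul0r powR0 ?mulr0// gt_eqF.
  have e : (`|z i 0| / L) `^ r = (`|z i 0| / L) `^ (r - 1) * (`|z i 0| / L).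
    rewrite -[X in _ = _ * X]powRr1 ?divr_ge0// -powRD ?subrK//.
    by apply/implyP => _; rewrite mulf_neq0 ?invr_eq0 ?normr_eq0.
  rewrite e; set X := _ `^ (r - 1); transitivity (X * (Num.sg (z i 0) * z i 0)); first by ring.
  by rewrite -normrEsg; field.
rewrite -mulr_sumr.
under eq_bigr do rewrite powRM ?invr_ge0// powRV//.
by rewrite -mulr_suml -Lr divff ?mulr1// gt_eqF// powR_gt0.
Qed.

Definition signed m n (M : 'M[R]_(m, n)) (w : {ffun 'I_m * 'I_n -> bool}) : 'M[R]_(m, n) :=
  \matrix_(i, j) (sg w (i, j) * M i j).

(** The operator norm under random signs: the signs of the entries are absorbed
    into the random ones, and the norm is turned into a bilinear form by duality. *)
Lemma sign_opnorm_bound al be : 2 <= al -> 2 <= be -> exists2 C : R, 0 <= C &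
  forall m n (M : 'M[R]_(m, n)) (S : R), 0 < S ->
    (forall i, \sum_j `|M i j| `^ al <= S `^ al) ->
    (forall j, \sum_i `|M i j| `^ be <= S `^ be) ->
    \sum_i \sum_j `|M i j| `^ (2 * Num.max al be) <= S `^ (2 * Num.max al be) ->
  avg (fun w => opnorm (al / (al - 1))%:E be%:E (signed M w)) <= C * S.
Proof.
move=> al2 be2.
have conj (t : R) : 2 <= t -> 0 < t / (t - 1) /\ (t / (t - 1))^-1 + t^-1 = 1.
  move=> t2; have t1 : 0 < t - 1 by lra.
  have t0 : 0 < t by lra.
  split; first exact: divr_gt0.
  by field; rewrite !gt_eqF.
have [p0 pal] := conj _ al2; have [q0 qbe] := conj _ be2.
have [C C0 hC] := sign_form_bound al2 be2 p0 q0 pal qbe.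
exists C => // m n M S S0 row col tot.
have al0 : 0 < al by lra.
have be0 : 0 < be by lra.
pose a i j := `|M i j| / S.
have a0 i j : 0 <= a i j by rewrite divr_ge0// ltW.
have aE t i j : a i j `^ t = (S `^ t)^-1 * `|M i j| `^ t.
  by rewrite /a powRM ?invr_ge0 ?(ltW S0)// powRV ?(ltW S0)// mulrC.
have [|||N [N0 aN bN]] := hC 'I_m 'I_n a a0.
- move=> i; under eq_bigr do rewrite aE.
  by rewrite -mulr_sumr ler_pdivrMl ?powR_gt0// mulr1.
- move=> j; under eq_bigr do rewrite aE.
  by rewrite -mulr_sumr ler_pdivrMl ?powR_gt0// mulr1.
- under eq_bigr do (under eq_bigr do rewrite aE; rewrite -mulr_sumr).
  by rewrite -mulr_sumr ler_pdivrMl ?powR_gt0// mulr1.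
pose v : {ffun 'I_m * 'I_n -> bool} := [ffun s => M s.1 s.2 < 0].
apply: (@le_trans _ _ (avg (fun w => S * N [ffun s => v s (+) w s]))); last first.
  by rewrite avgZ (avg_flip v) mulrC ler_wpM2r// ltW.
apply: avg_le => w; apply: opnorm_le => // x hx.
set w' := [ffun s => _].
have [y hy ->] := lpnorm_dual (signed M w *m x) (lt_le_trans (ltr1n R 2 : 1 < 2) be2).
apply: (@le_trans _ _ (S * \sum_i \sum_j a i j * sg w' (i, j) * x j 0 * y i)); last first.
  by rewrite ler_wpM2l ?(ltW S0)//; apply: bN => //; exact: lpnorm_le1.
rewrite mulr_sumr le_eqVlt; apply/orP; left; apply/eqP; apply: eq_bigr => i _.
rewrite mulr_sumr mxE mulr_sumr; apply: eq_bigr => j _; rewrite mxE.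
have e : M i j = (-1) ^+ v (i, j) * (S * a i j).
  by rewrite /a [S * _]mulrC divfK ?gt_eqF// ffunE/= -realEsign ?num_real.
rewrite [M i j in LHS]e.
have -> : sg w' (i, j) = sg w (i, j) * (-1) ^+ v (i, j) :> R.
  by rewrite /sg [w' _]ffunE signr_addb mulrC.
ring.
Qed.

End OperatorNorm.

Section Duality.
Context {R : realType} (p q : R).
Hypothesis p_gt0 : 0 < p.
Hypothesis q_gt1 : 1 < q.
Let q' := q / (q - 1).
Let q_gt0 : 0 < q. Proof. exact: lt_trans ltr01 q_gt1. Qed.
Let q'_gt0 : 0 < q'. Proof. by rewrite divr_gt0// subr_gt0. Qed.
Let q_q' : q'^-1 + q^-1 = 1.
Proof. by rewrite /q'; field; rewrite !gt_eqF// subr_gt0. Qed.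

Lemma lpnorm_holder n (y : 'I_n -> R) (z : 'cV[R]_n) : \sum_i `|y i| `^ q' <= 1 ->
  \sum_i y i * z i 0 <= lpnorm q%:E z.
Proof.
move=> hy; set L := lpnorm q%:E z; have L0 : 0 <= L := lpnorm_ge0 q z.
have Lq : L `^ q = \sum_i `|z i 0| `^ q.
  by rewrite -powRrM mulVf ?gt_eqF// powRr1//; apply: sumr_ge0 => *; exact: powR_ge0.
have [L00|Ln0] := eqVneq L 0.
  rewrite L00 big1// => i _; suff -> : z i 0 = 0 by rewrite mulr0.
  move: Lq; rewrite L00 powR0 ?gt_eqF// => /esym/eqP; rewrite psumr_eq0; last first.
    by move=> *; exact: powR_ge0.
  by move=> /allP/(_ i (mem_index_enum i))/=; rewrite powR_eq0 normr_eq0 => /andP[/eqP].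
have Lgt0 : 0 < L by rewrite lt_def Ln0.
rewrite -(ler_pM2r (_ : 0 < L^-1)) ?invr_gt0// divff// mulr_suml.
apply: (@le_trans _ _ (\sum_i (`|y i| `^ q' / q' + (`|z i 0| / L) `^ q / q))).
  apply: ler_sum => i _; rewrite -mulrA.
  apply: (@le_trans _ _ (`|y i| * (`|z i 0| / L))).
    by apply: le_trans (ler_norm _) _; rewrite !normrM normfV (ger0_norm L0).
  by apply: conjugate_powR => //; rewrite divr_ge0.
rewrite big_split/= -!mulr_suml.
have -> : \sum_i (`|z i 0| / L) `^ q = 1.
  under eq_bigr do rewrite powRM ?invr_ge0// powRV//.
  by rewrite -mulr_suml -Lq divff// gt_eqF// powR_gt0.
rewrite -[leRHS]q_q' mul1r lerD2r -[leRHS]mul1r ler_wpM2r// invr_ge0 ltW//.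
Qed.

Lemma opnorm_le_form m n (M : 'M[R]_(m, n)) (c : R) :
  (forall (x : 'I_n -> R) (y : 'I_m -> R), (forall j, `|x j| <= 1) -> (forall i, `|y i| <= 1) ->
     \sum_j `|x j| `^ p <= 1 -> \sum_i `|y i| `^ q' <= 1 ->
     \sum_i \sum_j y i * M i j * x j <= c) ->
  opnorm p%:E q%:E M <= c.
Proof.
move=> h; apply: opnorm_le => // x /(lpnorm_le1 p_gt0) hx.
have [y hy ->] := lpnorm_dual (M *m x) q_gt1.
apply: le_trans (h (fun j => x j 0) y _ _ hx hy); last 2 first.
- by move=> j; exact: coord_le1 p_gt0 hx.
- by move=> i; exact: coord_le1 q'_gt0 hy.
rewrite le_eqVlt; apply/orP; left; apply/eqP; apply: eq_bigr => i _.
by rewrite mxE mulr_sumr; apply: eq_bigr => j _; rewrite mulrA.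
Qed.

Lemma form_le_opnorm m n (M : 'M[R]_(m, n)) (x : 'I_n -> R) (y : 'I_m -> R) :
  \sum_j `|x j| `^ p <= 1 -> \sum_i `|y i| `^ q' <= 1 ->
  \sum_i \sum_j y i * M i j * x j <= opnorm p%:E q%:E M.
Proof.
move=> hx hy; pose xv : 'cV[R]_n := \col_j x j.
have xv1 : lpnorm p%:E xv <= 1.
  rewrite /lpnorm; under eq_bigr do rewrite mxE.
  by rewrite -[leRHS](powR1l (p^-1)); apply: ler_wpowR => //; [rewrite invr_ge0 ltW|
    apply: sumr_ge0 => *; exact: powR_ge0].
apply: (@le_trans _ _ (lpnorm q%:E (M *m xv))).
  apply: le_trans (lpnorm_holder (M *m xv) hy).
  rewrite le_eqVlt; apply/orP; left; apply/eqP; apply: eq_bigr => i _.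
  by rewrite mxE mulr_sumr; apply: eq_bigr => j _; rewrite mxE mulrA.
apply: ub_le_sup; last by exists xv.
exists ((\sum_i (\sum_j `|M i j|) `^ q) `^ q^-1) => _ [z hz <-].
have z1 j : `|z j 0| <= 1 by exact: coord_le1 p_gt0 (lpnorm_le1 p_gt0 hz).
apply: ler_wpowR; rewrite ?invr_ge0 ?(ltW q_gt0)//.
  by apply: sumr_ge0 => *; exact: powR_ge0.
apply: ler_sum => i _; apply: ler_wpowR; rewrite ?(ltW q_gt0)// mxE.
apply: le_trans (ler_norm_sum _ _ _) _; apply: ler_sum => j _.
by rewrite normrM ler_piMr.
Qed.

End Duality.

(** * Convex Lipschitz functions of finitely many variables *)

Section ConvexLipschitz.
Context {R : realType} (E : finType).
Implicit Types (Phi : (E -> R) -> R) (K : R) (x y : E -> R).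

(** The class in which symmetrization takes place. Nonnegativity lets all integrals
    be taken in the extended nonnegative reals. *)
Definition convex_lipschitz K Phi := [/\ forall x, 0 <= Phi x,
  forall x y, Phi x <= Phi y + K * \sum_e `|x e - y e| &
  forall (t : R) x y, 0 <= t <= 1 ->
     Phi (fun e => t * x e + (1 - t) * y e) <= t * Phi x + (1 - t) * Phi y].

Lemma convex_lipschitz_scale K Phi (c : E -> R) (B : R) : 0 <= K -> (forall e, `|c e| <= B) ->
  convex_lipschitz K Phi -> convex_lipschitz (K * B) (fun x => Phi (fun e => c e * x e)).
Proof.
move=> K0 cB [P0 Plip Pcv]; split.
- by move=> x.
- move=> x y; apply: (le_trans (Plip _ (fun e => c e * y e))); rewrite lerD2l -mulrA.
  rewrite ler_wpM2l// mulr_sumr; apply: ler_sum => e _.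
  by rewrite -mulrBr normrM ler_wpM2r.
- move=> t x y t01; have := Pcv t (fun e => c e * x e) (fun e => c e * y e) t01.
  by congr (Phi _ <= _); apply/funext => e; ring.
Qed.

Lemma convex_lipschitz_avg (S : finType) K (Phi : {ffun S -> bool} -> (E -> R) -> R) :
  (forall w, convex_lipschitz K (Phi w)) ->
  convex_lipschitz K (fun x => avg (fun w => Phi w x)).
Proof.
move=> h; split.
- by move=> x; apply: avg_ge0 => w; case: (h w).
- move=> x y; rewrite -[X in _ + X](@avg_cst R S) -avgD.
  by apply: avg_le => w; case: (h w).
- move=> t x y t01; rewrite -!avgZ -avgD.
  by apply: avg_le => w; case: (h w) => _ _; exact.
Qed.

Definition upd x e (z : R) : E -> R := fun e' => if e' == e then z else x e'.

(** The incremental ratio at 0 in the direction [e]; it depends only on the other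
    coordinates of [x]. *)
Definition slope Phi e (d : R) x := (Phi (upd x e d) - Phi (upd x e 0)) / d.

Lemma slope_le K Phi e d x : 0 < d -> convex_lipschitz K Phi -> `|slope Phi e d x| <= K.
Proof.
move=> d0 [_ Plip _]; rewrite /slope normrM normfV (gtr0_norm d0) ler_pdivrMr//.
have sumE (a b : R) : \sum_e' `|upd x e a e' - upd x e b e'| = `|a - b|.
  rewrite (bigD1 e)//= /upd eqxx big1 ?addr0// => e' /negbTE ->.
  by rewrite subrr normr0.
rewrite ler_norml; have := Plip (upd x e d) (upd x e 0); have := Plip (upd x e 0) (upd x e d).
rewrite !sumE sub0r subr0 normrN (gtr0_norm d0); lra.
Qed.

(** By convexity the value at [x e] is at most the mean of those at [2 * x e] and 0,
    and the value at 0 at most a tangent evaluated at [- (2 * x e)]. A chord of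
    small length [d] stands for the tangent, which costs the last term. *)
Lemma le_symmetrized K Phi e d x : 0 < d -> convex_lipschitz K Phi ->
  Phi x <= (Phi (upd x e (2 * x e)) + Phi (upd x e (- (2 * x e)))) / 2
           + slope Phi e d x * x e + K * d.
Proof.
move=> d0 PP; have := slope_le e x d0 PP; case: PP => _ Plip Pcv.
rewrite ler_norml => /andP[sl1 sl2].
pose phi z := Phi (upd x e z).
have cv (t a b : R) : 0 <= t <= 1 -> phi (t * a + (1 - t) * b) <= t * phi a + (1 - t) * phi b.
  move=> t01; apply: le_trans (Pcv t (upd x e a) (upd x e b) t01).
  rewrite le_eqVlt; apply/orP; left; apply/eqP; congr Phi; apply/funext => e'; rewrite /upd.
  by case: eqP => // _; ring.
have K0 : 0 <= K by lra.
have lip (a : R) : phi 0 <= phi a + K * `|a|.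
  have := Plip (upd x e 0) (upd x e a).
  rewrite (bigD1 e)//= /upd eqxx big1 ?addr0; last by move=> e' /negbTE ->; rewrite subrr normr0.
  by rewrite sub0r normrN.
have xE : Phi x = phi (x e).
  by congr Phi; apply/funext => e'; rewrite /upd; case: eqP => // ->.
set k := slope Phi e d x.
have kE : phi d = phi 0 + k * d by rewrite /k /slope divfK ?gt_eqF// /phi subrKC.
rewrite -/(phi _) -/(phi (- _)) xE; move: (x e) => z.
have h1 : phi z <= (phi (2 * z) + phi 0) / 2.
  have := cv 2^-1 (2 * z) 0; rewrite (_ : 2^-1 * _ + _ = z); last by field.
  by move=> h; apply: le_trans (h _) _; lra.
suff h2 : phi 0 <= phi (- (2 * z)) + 2 * k * z + 2 * K * d by lra.
have [z0|z0] := leP 0 z.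
  have := cv (d / (2 * z + d)) (- (2 * z)) d.
  have zd : 0 < 2 * z + d by lra.
  rewrite (_ : _ / _ * _ + _ = 0); last by field; rewrite gt_eqF.
  move=> h; have {}h : phi 0 * (2 * z + d) <= d * phi (- (2 * z)) + 2 * z * phi d.
    rewrite -ler_pdivlMr//; apply: (le_trans (h _)).
      by rewrite divr_ge0 ?(ltW d0) ?(ltW zd)// ler_pdivrMr// mul1r; lra.
    by rewrite le_eqVlt; apply/orP; left; apply/eqP; field; rewrite gt_eqF.
  rewrite kE in h.
  have : d * phi 0 <= d * (phi (- (2 * z)) + 2 * k * z) by lra.
  by rewrite ler_pM2l//; have := mulr_ge0 K0 (ltW d0); lra.
have := mulr_ge0 K0 (ltW d0) => Kd.
have [td|td] := leP d (- (2 * z)).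
  have t0 : 0 < - (2 * z) by lra.
  have := cv (d / (- (2 * z))) (- (2 * z)) 0.
  rewrite (_ : _ / _ * _ + _ = d); last by field; apply/negP => /eqP; lra.
  move=> h; have {}h : phi d * (- (2 * z)) <= d * phi (- (2 * z)) + (- (2 * z) - d) * phi 0.
    rewrite -ler_pdivlMr//; apply: (le_trans (h _)).
      by rewrite divr_ge0 ?(ltW d0) ?(ltW t0)// ler_pdivrMr// mul1r.
    by rewrite le_eqVlt; apply/orP; left; apply/eqP; field; apply/negP => /eqP; lra.
  rewrite kE in h.
  have : d * phi 0 <= d * (phi (- (2 * z)) + 2 * k * z) by lra.
  by rewrite ler_pM2l//; lra.
have t0 : 0 < - (2 * z) by lra.
have := lip (- (2 * z)); rewrite gtr0_norm//.
have : K * (- (2 * z)) <= K * d by rewrite ler_wpM2l// ltW.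
have : k * (- (2 * z)) <= K * (- (2 * z)) by rewrite ler_wpM2r// ltW.
by lra.
Qed.

End ConvexLipschitz.

Lemma opnorm_convex_lipschitz {R : realType} (p q : R) m n : 0 < p -> 1 < q ->
  convex_lipschitz 1 (fun x : 'I_m * 'I_n -> R => opnorm p%:E q%:E (\matrix_(i, j) x (i, j))).
Proof.
move=> p0 q1; have q0 : 0 < q by exact: lt_trans ltr01 q1.
have q'0 : 0 < q / (q - 1) by rewrite divr_gt0// subr_gt0.
have formE (x : 'I_m * 'I_n -> R) (u : 'I_n -> R) (v : 'I_m -> R) :
  \sum_i \sum_j v i * (\matrix_(i, j) x (i, j)) i j * u j = \sum_i \sum_j v i * x (i, j) * u j.
  by apply: eq_bigr => i _; apply: eq_bigr => j _; rewrite mxE.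
split.
- move=> x; apply: le_trans (@form_le_opnorm _ p q p0 q1 m n _ (fun=> 0) (fun=> 0) _ _).
  + by rewrite big1// => i _; rewrite big1// => j _; rewrite mulr0.
  + by rewrite big1// => i _; rewrite normr0 powR0// gt_eqF.
  + by rewrite big1// => i _; rewrite normr0 powR0// gt_eqF.
- move=> x y; apply: opnorm_le_form => // u v u1 v1 hu hv.
  have := form_le_opnorm p0 q1 (\matrix_(i, j) y (i, j)) hu hv.
  rewrite !formE mul1r => h; rewrite -lerBlDl; apply: le_trans (lerB (lexx _) h) _.
  rewrite -sumrB (eq_bigl (fun=> true))//.
  rewrite [leRHS](_ : _ = \sum_i \sum_j `|x (i, j) - y (i, j)|); last first.
    by rewrite pair_big/=; apply: eq_bigr => -[].
  apply: ler_sum => i _; rewrite -sumrB; apply: ler_sum => j _.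
  rewrite -mulrBl -mulrBr; apply: le_trans (ler_norm _) _; rewrite !normrM.
  apply: (@le_trans _ _ (`|v i| * `|x (i, j) - y (i, j)|)).
    by rewrite ler_piMr// mulr_ge0.
  by rewrite ler_piMl.
- move=> t x y /andP[t0 t1]; apply: opnorm_le_form => // u v u1 v1 hu hv.
  have hx := form_le_opnorm p0 q1 (\matrix_(i, j) x (i, j)) hu hv.
  have hy := form_le_opnorm p0 q1 (\matrix_(i, j) y (i, j)) hu hv.
  have t1' : 0 <= 1 - t by rewrite subr_ge0.
  apply: le_trans (lerD (ler_wpM2l t0 hx) (ler_wpM2l t1' hy)).
  rewrite !formE !mulr_sumr -big_split/= le_eqVlt; apply/orP; left; apply/eqP.
  apply: eq_bigr => i _; rewrite !mulr_sumr -big_split/=; apply: eq_bigr => j _.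
  rewrite mxE; ring.
Qed.

End FiniteDimensional.
Import FiniteDimensional.

Local Open Scope classical_set_scope.
Local Open Scope ring_scope.

(** * Measurability and independence *)

(** The set where a continuous function of the entries exceeds [c] is a countable
    union of boxes with rational centres. *)
Lemma lipschitz_measurable d (T : measurableType d) (R : realType) (E : finType) (K : R)
  (Phi : (E -> R) -> R) (Z : E -> T -> R) :
  (forall x y, Phi x <= Phi y + K * \sum_e `|x e - y e|) ->
  (forall e, measurable_fun setT (Z e)) ->
  measurable_fun setT (fun t => Phi (fun e => Z e t)).
Proof.
move=> lip mZ.
pose box (q : {ffun E -> rat}) (k : nat) : set (E -> R) :=
  [set x | forall e, `|x e - ratr (q e)| < k.+1%:R^-1].
move=> _; apply: (measurability _ (RGenOInfty.measurableE R)) => //.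
move=> /= _ [_ [c ->] <-]; rewrite setTI preimage_itvoy.
pose good (q : {ffun E -> rat}) (k : nat) := box q k `<=` [set x | c < Phi x].
rewrite [X in measurable X](_ : _ = \bigcup_s
   [set t | good s.1 s.2 /\ box s.1 s.2 (fun e => Z e t)]); last first.
  apply/seteqP; split => t /=; last by move=> [s _ [gs bs]]; exact: gs.
  move=> ct; set x := fun e => Z e t in ct *.
  pose K' := `|K| * (2 * #|E|%:R) + 1.
  have K'0 : 0 < K' by rewrite ltr_wpDl// mulr_ge0// mulr_ge0.
  have g0 : 0 < (Phi x - c) / K' by rewrite divr_gt0// subr_gt0.
  have [k kg] : exists k : nat, k.+1%:R^-1 < (Phi x - c) / K'.
    exists (Num.bound ((Phi x - c) / K')^-1); rewrite -[ltRHS]invrK ltf_pV2 ?posrE ?invr_gt0//.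
    by apply: lt_le_trans (archi_boundP _) _; rewrite ?invr_ge0 ?(ltW g0)// ler_nat.
  have dk : 0 < k.+1%:R^-1 :> R by rewrite invr_gt0.
  have /choice[q qP] : forall e, exists r : rat, `|x e - ratr r| < k.+1%:R^-1.
    have hx e : x e - k.+1%:R^-1 < x e + k.+1%:R^-1 by rewrite ltrD2l gtrN.
    move=> e; have [r] := rat_in_itvoo (hx e).
    rewrite in_itv/= => /andP[h1 h2]; exists r; rewrite ltr_norml.
    by move: (_^-1) h1 h2 => dd h1 h2; lra.
  exists ([ffun e => q e], k) => //; split; last by move=> e /=; rewrite ffunE; exact: qP.
  move=> y /= hy; have := lip x y.
  have : K * \sum_e `|x e - y e| <= `|K| * (2 * #|E|%:R) * k.+1%:R^-1.
    apply: (@le_trans _ _ (`|K| * \sum_e `|x e - y e|)).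
      by rewrite ler_wpM2r ?ler_norm// sumr_ge0.
    rewrite -mulrA ler_wpM2l// (_ : 2 * _ * _ = \sum_(e : E) 2 * k.+1%:R^-1); last first.
      by rewrite sumr_const -[RHS]mulr_natl; ring.
    apply: ler_sum => e _; have := hy e; rewrite ffunE => h1; have h2 := qP e.
    rewrite (_ : x e - y e = (x e - ratr (q e)) - (y e - ratr (q e))); last by ring.
    by apply: le_trans (ler_normB _ _) _; move: (_^-1) h1 h2 => dd h1 h2; lra.
  have : `|K| * (2 * #|E|%:R) * k.+1%:R^-1 <= K' * k.+1%:R^-1.
    by rewrite ler_wpM2r ?(ltW dk)// lerDl.
  by move: kg; rewrite ltr_pdivlMr// mulrC; move: (_^-1) => dd; lra.
apply: countable_bigcupT_measurable => // -[q k] /=.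
have [gs|ngs] := pselect (good q k); last first.
  by rewrite (_ : [set t | _] = set0)//; apply/seteqP; split => // t [].
rewrite (_ : [set t | _] = \bigcap_(e in [set: E])
    (Z e @^-1` `]ratr (q e) - k.+1%:R^-1, ratr (q e) + k.+1%:R^-1[)).
  apply: fin_bigcap_measurable => // e _; rewrite -[X in measurable X]setTI.
  exact: mZ.
apply/seteqP; split => t /=.
  by move=> [_ h] e _ /=; have := h e; rewrite in_itv/= ltr_norml; move: (_^-1) => dd; lra.
by move=> h; split=> // e; have := h e I; rewrite /= in_itv/= ltr_norml; move: (_^-1) => dd; lra.
Qed.

(** Families indexed by [E] are carried over to tuples, where the product
    sigma-algebra lives. *)

Section Tuples.
Context {R : realType} {E : finType}.

Definition pack (f : E -> R) : #|E|.-tuple R := [tuple f (enum_val k) | k < #|E|].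

Definition unpack (u : #|E|.-tuple R) (e : E) : R := tnth u (enum_rank e).

Lemma packK : cancel pack unpack.
Proof. by move=> f; apply/funext => e; rewrite /unpack tnth_mktuple enum_rankK. Qed.

Lemma measurable_unpack e : measurable_fun setT (unpack ^~ e).
Proof. exact: measurable_tnth. Qed.

Lemma measurable_pack d (T : measurableType d) (Z : E -> T -> R) :
  (forall e, measurable_fun setT (Z e)) -> measurable_fun setT (fun t => pack (Z ^~ t)).
Proof.
move=> mZ; apply/measurable_fun_tnthP => i.
rewrite (_ : _ \o _ = Z (enum_val i)); first exact: mZ.
by apply/funext => t /=; rewrite tnth_mktuple.
Qed.

Definition cylinders : set (set (#|E|.-tuple R)) :=
  [set A | exists2 B : E -> set R, (forall e, measurable (B e)) &
     A = [set u | forall e, B e (unpack u e)]].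

Lemma measurable_cylinders : @measurable _ (#|E|.-tuple R) = <<s cylinders >>.
Proof.
apply/seteqP; split.
  apply: smallest_sub; first exact: smallest_sigma_algebra.
  rewrite -bigcup_seq => A [i _ [Y mY <-]]; apply: sub_sigma_algebra.
  exists (fun e => if e == enum_val i then Y else setT); first by move=> e; case: ifP.
  apply/seteqP; split => u /=.
    move=> [_ uY] e; case: eqP => // ->.
    by rewrite /unpack enum_valK.
  move=> h; split => //; have := h (enum_val i).
  by rewrite eqxx /unpack enum_valK.
apply: smallest_sub; first exact: sigma_algebra_measurable.
move=> _ [B mB ->]; rewrite (_ : [set u | _] = \bigcap_(e in [set: E]) (unpack ^~ e @^-1` B e)).
  apply: fin_bigcap_measurable => // e _; rewrite -[X in measurable X]setTI.
  exact: measurable_unpack.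
by apply/seteqP; split => u /= h e; [move=> _; exact: h|exact: h].
Qed.

End Tuples.

Section Independence.
Context d (T : measurableType d) (R : realType) (P : probability T R) (E : finType).
Context (X : E -> {RV P >-> R}).
Hypothesis X_indep : mutually_independent X.

(** With 0 in place of the entry [e] the index set is kept, and so are sums of
    functions that vanish at 0. *)
Definition others (e : E) (w : T) : E -> R := upd (X ^~ w) e 0.

Lemma measurable_others e e' : measurable_fun setT (fun w => others e w e').
Proof.
rewrite /others /upd; case: eqP => _; first exact: measurable_cst.
exact: measurable_funPT.
Qed.

(** Cylinders form a pi-system generating the product sigma-algebra, on which the
    identity is the hypothesis of independence, used for all the entries and for
    all but [e]. *)
Lemma indep_others e (A : set R) (B : #|E|.-tuple R -> Prop) :
  measurable A -> measurable (B : set _) ->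
  (P ((X e @^-1` A) `&` [set w | B (pack (others e w))]) =
   P (X e @^-1` A) * P [set w | B (pack (others e w))])%E.
Proof.
move=> mA; move: B.
have mU : measurable_fun setT (fun w => pack (others e w)).
  by apply: measurable_pack => e'; exact: measurable_others.
pose U : {mfun T >-> #|E|.-tuple R} :=
  HB.pack (fun w => pack (others e w)) (isMeasurableFun.Build _ _ _ _ _ mU).
have mXA : measurable (X e @^-1` A) by rewrite -[X in measurable X]setTI; exact: measurable_funPT.
pose m1 : {measure set _ -> \bar R} := pushforward (mrestr P mXA) U.
have fXA : P (X e @^-1` A) \is a fin_num by exact: fin_num_measure.
have cA0 : (0 <= fine (P (X e @^-1` A)))%R by rewrite fine_ge0.
pose m2 : {measure set _ -> \bar R} := mscale (NngNum cA0) (distribution P U).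
suff m12 B : measurable B -> m1 mU B = m2 B.
  move=> B mB; have := m12 B mB.
  rewrite /m1 /m2 /= /mscale /distribution /pushforward /mrestr/= fineK// /distribution /pushforward setIC => ->.
  by [].
move: B; apply: (@measure_unique _ _ _ cylinders (fun=> setT)).
- exact: measurable_cylinders.
- move=> _ _ [B1 mB1 ->] [B2 mB2 ->].
  exists (fun e => B1 e `&` B2 e); first by move=> e'; exact: measurableI.
  apply/seteqP; split => u /=; first by move=> [h1 h2] e'; split.
  by move=> h; split => e'; have [] := h e'.
- move=> _; exists (fun=> setT) => //.
  by apply/seteqP; split.
- by apply/seteqP; split => // u _; exists 0%N.
- move=> _ [B mB ->]; rewrite /m1 /m2 /= /mscale /distribution /pushforward /mrestr/= fineK// /distribution /pushforward.
  have [B0|nB0] := pselect (B e 0); last first.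
    rewrite (_ : U @^-1` _ = set0) ?set0I ?measure0 ?mule0//.
    apply/seteqP; split => // w /= /(_ e).
    by rewrite packK /others /upd eqxx.
  pose J := finset.setC (finset.set1 e).
  have JE e' : (e' \in J) = (e' != e) by rewrite finset.inE finset.in_set1.
  have restE : U @^-1` [set u | forall e', B e' (unpack u e')] =
     \bigcap_(i in [set` J]) X i @^-1` B i.
    apply/seteqP; split => w /=.
      by move=> h i /=; rewrite JE => /negbTE ie; have := h i; rewrite packK /others /upd ie.
    move=> h e'; rewrite packK /others /upd; case: eqP => [->//|/eqP e'e].
    by apply: h => /=; rewrite JE.
  have hJ := X_indep (J := J) (B := B) (fun i _ => mB i).
  have mB' i : i \in finset.setTfor E -> measurable (if i == e then A else B i).
    by move=> _; case: ifP.
  have hT := X_indep (B := fun i => if i == e then A else B i) mB'.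
  rewrite restE hJ -[X in P X](_ : \bigcap_(i in [set` finset.setTfor E]) X i @^-1` (if i == e then A else B i) = _); last first.
    apply/seteqP; split => w /= h.
      split; last by have := h e; rewrite /= eqxx finset.inE; exact.
      by move=> i /=; rewrite JE => /negbTE ie; have := h i; rewrite /= ie finset.inE; exact.
    by move=> i _ /=; case: eqP => [->|/eqP ie]; [case: h|apply: h.1; rewrite /= JE].
  rewrite hT (bigD1 e) ?finset.inE//= eqxx; congr (_ * _)%E.
  apply: eq_big => i; first by rewrite !finset.inE.
  by move=> /andP[_ /negbTE ->].
- move=> _; rewrite /m1 /= /pushforward /mrestr/= setTI.
  by rewrite (le_lt_trans (probability_le1 _ _)) ?ltry.
Qed.

(** The joint law of an entry and of the others is a product measure, to which
    Tonelli applies. *)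
Lemma ge0_integral_indep e (f : R -> R) (h : (E -> R) -> R) :
  measurable_fun setT f -> measurable_fun setT (fun u => h (unpack u)) ->
  (forall x, 0 <= f x) -> (forall u, 0 <= h u) ->
  (\int[P]_w (f (X e w) * h (others e w))%:E =
   \int[P]_w (f (X e w))%:E * \int[P]_w (h (others e w))%:E)%E.
Proof.
move=> mf mh f0 h0.
have mU : measurable_fun setT (fun w => pack (others e w)).
  by apply: measurable_pack => e'; exact: measurable_others.
pose U : {mfun T >-> #|E|.-tuple R} :=
  HB.pack (fun w => pack (others e w)) (isMeasurableFun.Build _ _ _ _ _ mU).
have mXU : measurable_fun setT (fun w => (X e w, U w)).
  by apply/measurable_fun_pairP; split => //; exact: measurable_funPT.
pose XU : {mfun T >-> (R * #|E|.-tuple R)%type} :=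
  HB.pack (fun w => (X e w, U w)) (isMeasurableFun.Build _ _ _ _ _ mXU).
pose F (z : R * #|E|.-tuple R) : \bar R := (f z.1 * h (unpack z.2))%:E.
have mF : measurable_fun setT F.
  apply/measurable_EFinP; apply: measurable_funM.
    by apply: measurableT_comp => //; exact: measurable_fst.
  by apply: (measurableT_comp mh); exact: measurable_snd.
have F0 z : (0 <= F z)%E by rewrite lee_fin mulr_ge0.
transitivity (\int[distribution P XU]_z F z)%E.
  rewrite ge0_integral_distribution//; apply: eq_integral => w _ /=.
  by rewrite /F/= packK.
transitivity (\int[(distribution P (X e) \x distribution P U)%E]_z F z)%E.
  apply: eq_measure_integral => B mB _; apply/esym.
  apply: product_measure_unique => // A1 B1 mA1 mB1.
  exact: indep_others.
rewrite fubini_tonelli1//=.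
rewrite /fubini_F/=.
under eq_integral.
  move=> x _; rewrite /F/=.
  under eq_integral do rewrite EFinM.
  rewrite ge0_integralZl//; [|exact/measurable_EFinP|by move=> u _; rewrite lee_fin|by rewrite lee_fin].
  over.
rewrite ge0_integralZr//; last 3 first.
- exact/measurable_EFinP.
- by move=> x _; rewrite lee_fin.
- by apply: integral_ge0 => u _; rewrite lee_fin.
rewrite ge0_integral_distribution; [|exact/measurable_EFinP|by move=> x; rewrite lee_fin].
rewrite ge0_integral_distribution; [|exact/measurable_EFinP|by move=> x; rewrite lee_fin].
by congr (_ * _)%E; apply: eq_integral => w _ /=; rewrite packK.
Qed.

End Independence.

(** * Symmetrization *)

Section NonnegativeIntegrals.
Context d (T : measurableType d) (R : realType) (P : probability T R).
Implicit Types f g : T -> R.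

Lemma probability_integral_cst (c : R) : (\int[P]_w c%:E = c%:E)%E.
Proof.
rewrite integral_cst//; transitivity (c%:E * 1)%E; last by rewrite mule1.
by congr (_ * _)%E; exact: probability_setT.
Qed.

Lemma le_integral_EFin f g : measurable_fun setT f -> measurable_fun setT g ->
  (forall w, 0 <= f w) -> (forall w, f w <= g w) ->
  (\int[P]_w (f w)%:E <= \int[P]_w (g w)%:E)%E.
Proof.
move=> mf mg f0 fg; apply: ge0_le_integral => //.
- by move=> w _; rewrite lee_fin.
- exact/measurable_EFinP.
- exact/measurable_EFinP.
- by move=> w _; rewrite lee_fin.
Qed.

Lemma integralZ_EFin (K : R) f : 0 <= K -> measurable_fun setT f -> (forall w, 0 <= f w) ->
  (\int[P]_w (K * f w)%:E = K%:E * \int[P]_w (f w)%:E)%E.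
Proof.
move=> K0 mf f0; under eq_integral do rewrite EFinM.
by rewrite ge0_integralZl//; [exact/measurable_EFinP|move=> w _; rewrite lee_fin].
Qed.

Lemma integralD_EFin f g : measurable_fun setT f -> measurable_fun setT g ->
  (forall w, 0 <= f w) -> (forall w, 0 <= g w) ->
  (\int[P]_w (f w + g w)%:E = \int[P]_w (f w)%:E + \int[P]_w (g w)%:E)%E.
Proof.
move=> mf mg f0 g0; under eq_integral do rewrite EFinD.
by rewrite ge0_integralD//; try exact/measurable_EFinP; move=> w _; rewrite lee_fin.
Qed.

Lemma integral_sum_EFin (I : Type) (s : seq I) (f : I -> T -> R) :
  (forall i, measurable_fun setT (f i)) -> (forall i w, 0 <= f i w) ->
  (\int[P]_w (\sum_(i <- s) f i w)%:E = \sum_(i <- s) \int[P]_w (f i w)%:E)%E.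
Proof.
move=> mf f0; rewrite -ge0_integral_sum//.
- by apply: eq_integral => w _; rewrite sumEFin.
- by move=> i; exact/measurable_EFinP.
- by move=> i w _; rewrite lee_fin.
Qed.

End NonnegativeIntegrals.

Section Symmetrization.
Context d (T : measurableType d) (R : realType) (P : probability T R) (E : finType).
Context (X : E -> {RV P >-> R}).
Hypothesis X_indep : mutually_independent X.
Hypothesis X_centered : forall e, centered (X e).

Lemma centered_parts e : exists m : R,
  (\int[P]_w (Num.max (X e w) 0)%:E = m%:E)%E /\ (\int[P]_w (Num.max (- X e w) 0)%:E = m%:E)%E.
Proof.
have [iX EX] := X_centered e.
have hp : (\int[P]_w (Num.max (X e w) 0)%:E = \int[P]_w ((EFin \o X e)^\+ w))%E.
  by apply: eq_integral => w _; rewrite funeposE/= EFin_max.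
have hn : (\int[P]_w (Num.max (- X e w) 0)%:E = \int[P]_w ((EFin \o X e)^\- w))%E.
  by apply: eq_integral => w _; rewrite funenegE/= EFin_max EFinN.
have fp := integrable_pos_fin_num measurableT iX.
have fn := integrable_neg_fin_num measurableT iX.
exists (fine (\int[P]_w ((EFin \o X e)^\- w))%E).
rewrite hp hn fineK//; split => //.
move: EX; rewrite unlock integralE => /eqP; rewrite sube_eq ?add0e; first by move/eqP.
  by [].
by rewrite fin_num_adde_defl.
Qed.

Lemma convex_lipschitz_measurable K Phi d' (T' : measurableType d') (Z : E -> T' -> R) :
  convex_lipschitz K Phi -> (forall e, measurable_fun setT (Z e)) ->
  measurable_fun setT (fun t => Phi (Z ^~ t)).
Proof. by move=> [_ lip _] mZ; exact: lipschitz_measurable lip mZ. Qed.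

Lemma measurable_upd (e : E) (f : R -> R) d' (T' : measurableType d') (Z : E -> T' -> R) :
  measurable_fun setT f ->
  (forall e, measurable_fun setT (Z e)) ->
  forall e', measurable_fun setT (fun t => upd (Z ^~ t) e (f (Z e t)) e').
Proof.
move=> mf mZ e'; rewrite /upd; case: eqP => _; last exact: mZ.
by apply: measurableT_comp => //; exact: mZ.
Qed.

(** The linear term of [le_symmetrized] has mean zero, since the slope is a function
    of the other entries. Positive and negative parts are kept on the side of the
    inequality where they are added, so that only integrals of nonnegative functions
    occur. *)
Lemma symmetrize_entry K (Phi : (E -> R) -> R) e : convex_lipschitz K Phi ->
  (\int[P]_w (Phi (X ^~ w))%:E <=
   \int[P]_w ((Phi (upd (X ^~ w) e (2 * X e w)) +
               Phi (upd (X ^~ w) e (- (2 * X e w)))) / 2)%:E)%E.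
Proof.
move=> PP; have [P0 _ _] := PP.
have K0 : 0 <= K by apply: le_trans (slope_le e (fun=> 0) ltr01 PP).
have mX e' : measurable_fun setT (X e') by exact: measurable_funPT.
pose F w := (Phi (upd (X ^~ w) e (2 * X e w)) + Phi (upd (X ^~ w) e (- (2 * X e w)))) / 2.
have F0 w : 0 <= F w by rewrite divr_ge0// addr_ge0.
have mupd (f : R -> R) : measurable_fun setT f ->
    measurable_fun setT (fun w => Phi (upd (X ^~ w) e (f (X e w)))).
  by move=> mf; apply: (convex_lipschitz_measurable PP) => e'; exact: (measurable_upd e mf mX).
have mF : measurable_fun setT F.
  apply: measurable_funM => //; apply: measurable_funD.
    by apply: (mupd (fun z => 2 * z)); exact: measurable_funM.
  by apply: (mupd (fun z => - (2 * z))); apply: measurableT_comp => //; exact: measurable_funM.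
apply/lee_addgt0Pr => eps eps0.
pose dl := eps / (K + 1).
have K1 : 0 < K + 1 by rewrite ltr_wpDl.
have dl0 : 0 < dl by rewrite divr_gt0.
have Kdl : K * dl <= eps.
  by rewrite /dl mulrCA ler_piMr ?(ltW eps0)// ler_pdivrMr// mul1r lerDl.
pose h (u : E -> R) := slope Phi e dl u + K.
have h0 u : 0 <= h u.
  by have := slope_le e u dl0 PP; rewrite ler_norml => /andP[+ _]; rewrite /h; lra.
have mh : measurable_fun setT (fun u => h (unpack u)).
  have mu (z : R) : measurable_fun setT (fun u : #|E|.-tuple R => Phi (upd (unpack u) e z)).
    apply: (@convex_lipschitz_measurable K Phi _ _ (fun e' u => upd (unpack u) e z e')) => // e'.
    apply: (@measurable_upd e (fun=> z) _ _ (fun e' u => unpack u e')) => // e''.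
    exact: measurable_unpack.
  apply: measurable_funD => //; apply: measurable_funM => //.
  exact: measurable_funB.
have hE w : h (X ^~ w) = h (others X e w).
  have uu z : upd (others X e w) e z = upd (X ^~ w) e z.
    by apply/funext => e'; rewrite /others /upd; case: eqP.
  by rewrite /h /slope !uu.
have mho : measurable_fun setT (fun w => h (others X e w)).
  rewrite (_ : (fun w => _) = (fun u => h (unpack u)) \o (fun w => pack (others X e w))); last first.
    by apply/funext => w /=; rewrite packK.
  by apply: measurableT_comp => //; apply: measurable_pack => e'; exact: measurable_others.
have mp : measurable_fun setT (fun z : R => Num.max z 0) by exact: measurable_maxr.
have mn : measurable_fun setT (fun z : R => Num.max (- z) 0).
  by apply: measurable_maxr => //; exact: measurableT_comp.
have p0 z : 0 <= Num.max z 0 :> R by rewrite le_max lexx orbT.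
have Ip := ge0_integral_indep X_indep e mp mh p0 h0.
have In := ge0_integral_indep X_indep e mn mh (fun z => p0 (- z)) h0.
have [m [hm hm']] := centered_parts e.
have Hfin : (\int[P]_w (h (others X e w))%:E \is a fin_num)%E.
  rewrite ge0_fin_numE; last by apply: integral_ge0 => w _; rewrite lee_fin.
  apply: (@le_lt_trans _ _ (\int[P]_w (2 * K)%:E)%E).
    apply: ge0_le_integral => //.
    - by move=> w _; rewrite lee_fin.
    - exact/measurable_EFinP.
    - move=> w _; rewrite lee_fin; have := slope_le e (others X e w) dl0 PP.
      by rewrite ler_norml => /andP[_]; rewrite /h; lra.
  by rewrite probability_integral_cst ltry.
have mXp : measurable_fun setT (fun w => Num.max (X e w) 0) by exact: measurable_maxr.
have mXn : measurable_fun setT (fun w => Num.max (- X e w) 0).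
  by apply: measurable_maxr => //; exact: measurableT_comp.
have key : (\int[P]_w (Phi (X ^~ w) +
      (Num.max (- X e w) 0 * h (others X e w) + K * Num.max (X e w) 0))%:E <=
   \int[P]_w (F w + (Num.max (X e w) 0 * h (others X e w) + K * Num.max (- X e w) 0) + eps)%:E)%E.
  apply: ge0_le_integral => //.
  - by move=> w _; rewrite lee_fin !addr_ge0// mulr_ge0.
  - apply/measurable_EFinP; apply: measurable_funD; first exact: (convex_lipschitz_measurable PP).
    by apply: measurable_funD; apply: measurable_funM.
  - apply/measurable_EFinP; apply: measurable_funD => //; apply: measurable_funD => //.
    by apply: measurable_funD; apply: measurable_funM.
  move=> w _; rewrite lee_fin -hE /h; have := le_symmetrized e (X ^~ w) dl0 PP.
  rewrite -/(F w); set k := slope _ _ _ _; set z := X e w.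
  have : z = Num.max z 0 - Num.max (- z) 0.
    have [z0|/ltW z0] := leP 0 z.
      by rewrite max_r ?oppr_le0// subr0.
    by rewrite max_l ?oppr_ge0// sub0r opprK.
  by move: (Num.max z 0) (Num.max (- z) 0) => zp zn ->; nra.
move: key.
have cint f := @integralZ_EFin _ T R P K f K0; have dint := @integralD_EFin _ T R P.
have mM (f g : T -> R) : measurable_fun setT f -> measurable_fun setT g ->
  measurable_fun setT (fun w => f w * g w) by exact: measurable_funM.
have mD (f g : T -> R) : measurable_fun setT f -> measurable_fun setT g ->
  measurable_fun setT (fun w => f w + g w) by exact: measurable_funD.
have mc (c : R) : measurable_fun setT (fun _ : T => c) by exact: measurable_cst.
have mPhi : measurable_fun setT (fun w => Phi (X ^~ w)).
  exact: (convex_lipschitz_measurable PP).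
have mA1 := mM _ _ mXn mho; have mA2 := mM _ _ mXp mho.
have mB1 := mM _ _ (mc K) mXp; have mB2 := mM _ _ (mc K) mXn.
have A10 w : 0 <= Num.max (- X e w) 0 * h (others X e w) by rewrite mulr_ge0.
have A20 w : 0 <= Num.max (X e w) 0 * h (others X e w) by rewrite mulr_ge0.
have B10 w : 0 <= K * Num.max (X e w) 0 by rewrite mulr_ge0.
have B20 w : 0 <= K * Num.max (- X e w) 0 by rewrite mulr_ge0.
rewrite dint//; [|exact: mD|by move=> w; rewrite addr_ge0].
rewrite [X in (_ + X <= _)%E]dint//.
rewrite dint//; [|exact: mD _ _ mF (mD _ _ mA2 mB2)|by move=> w; rewrite !addr_ge0|by move=> w; exact: ltW].
rewrite dint//; [|exact: mD|by move=> w; rewrite addr_ge0].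
rewrite [X in (_ <= _ + X + _)%E]dint//.
rewrite !cint// hm hm' In Ip hm hm' probability_integral_cst.
move: Hfin => /fineK <-; set H := fine _; rewrite -!EFinM -EFinD.
by rewrite addeAC leeD2rE.
Qed.

(** Random signs on the entries of [s] only. *)
Definition half_symmetrized (Phi : (E -> R) -> R) (s : seq E) (x : E -> R) : R :=
  avg (fun v : {ffun E -> bool} => Phi (fun e => (if e \in s then 2 * sg v e else 1) * x e)).

Lemma half_symmetrized_convex K Phi s : 0 <= K -> convex_lipschitz K Phi ->
  convex_lipschitz (K * 2) (half_symmetrized Phi s).
Proof.
move=> K0 PP; apply: convex_lipschitz_avg => v; apply: convex_lipschitz_scale => // e.
by case: ifP => _; rewrite ?normrM ?normr1 ?normr_sg1 ?mulr1 ?(ger0_norm (ler0n _ _)) ?ler1n.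
Qed.

Lemma half_symmetrized_cons Phi s e x : e \notin s ->
  (half_symmetrized Phi s (upd x e (2 * x e)) +
   half_symmetrized Phi s (upd x e (- (2 * x e)))) / 2 = half_symmetrized Phi (e :: s) x.
Proof.
move=> es.
pose G (b : bool) (v : {ffun E -> bool}) := Phi (fun e' =>
  (if e' \in s then 2 * sg v e' else if e' == e then 2 * (-1) ^+ b else 1) * x e').
have G1 (b : bool) : half_symmetrized Phi s (upd x e (2 * (-1) ^+ b * x e)) = avg (G b).
  apply: eq_avg => v; congr Phi; apply/funext => e'; rewrite /upd.
  by have [->|//] := eqVneq e' e; rewrite (negbTE es) mul1r.
have G2 : half_symmetrized Phi (e :: s) x = avg (fun v => G (v e) v).
  apply: eq_avg => v; congr Phi; apply/funext => e'; rewrite inE.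
  by have [->|] := eqVneq e' e; rewrite ?(negbTE es)//=; case: ifP.
pose fl : {ffun E -> bool} := [ffun e' => e' == e].
have Gf b (v : {ffun E -> bool}) : G b [ffun e' => fl e' (+) v e'] = G b v.
  congr Phi; apply/funext => e'; case: ifP => // e's; congr (_ * _ * _).
  rewrite /sg !ffunE; case: eqP => // ee; by rewrite -ee e's in es.
have G3 : avg (fun v => G (v e) v) = avg (fun v => G (~~ v e) v).
  rewrite -(avg_flip fl); apply: eq_avg => v; rewrite Gf !ffunE eqxx.
  by case: (v e).
have := G1 false; have := G1 true; rewrite expr1 expr0 mulr1 mulrN1 mulNr => -> ->.
have : avg (G false) + avg (G true) = avg (fun v => G (v e) v) + avg (fun v => G (~~ v e) v).
  by rewrite -!avgD; apply: eq_avg => v; case: (v e) => //=; rewrite addrC.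
rewrite -G3 G2 => ->; by field.
Qed.

(** The factor 2 comes from [le_symmetrized], used once for each entry. *)
Lemma symmetrization K (Phi : (E -> R) -> R) : 0 <= K -> convex_lipschitz K Phi ->
  (\int[P]_w (Phi (X ^~ w))%:E <=
   \int[P]_w (avg (fun v : {ffun E -> bool} => Phi (fun e => 2 * sg v e * X e w)))%:E)%E.
Proof.
move=> K0 PP.
suff step s : uniq s ->
    (\int[P]_w (Phi (X ^~ w))%:E <= \int[P]_w (half_symmetrized Phi s (X ^~ w))%:E)%E.
  apply: le_trans (step (enum E) (enum_uniq _)) _.
  rewrite le_eqVlt; apply/orP; left; apply/eqP; apply: eq_integral => w _; congr (_%:E).
  by apply: eq_avg => v; congr Phi; apply/funext => e; rewrite mem_enum.
elim: s => [_|e s IHs /= /andP[es us]].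
  rewrite le_eqVlt; apply/orP; left; apply/eqP; apply: eq_integral => w _; congr (_%:E).
  rewrite /half_symmetrized -[LHS](@avg_cst R E); apply: eq_avg => v; congr Phi.
  by apply/funext => e /=; rewrite mul1r.
apply: (le_trans (IHs us)).
have PH := half_symmetrized_convex s K0 PP.
apply: (le_trans (symmetrize_entry e PH)).
rewrite le_eqVlt; apply/orP; left; apply/eqP; apply: eq_integral => w _; congr (_%:E).
exact: half_symmetrized_cons.
Qed.

End Symmetrization.

(** * Sums of independent nonnegative variables *)

Section PowerSums.
Context {R : realType}.

Lemma powRD_le (a b r : R) : 0 <= a -> 0 <= b -> 0 <= r ->
  (a + b) `^ r <= 2 `^ r * (a `^ r + b `^ r).
Proof.
move=> a0 b0 r0.
have main (u v : R) : 0 <= u -> u <= v -> (u + v) `^ r <= 2 `^ r * (u `^ r + v `^ r).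
  move=> u0 uv; have v0 := le_trans u0 uv.
  apply: (@le_trans _ _ ((2 * v) `^ r)); first by apply: ler_wpowR; rewrite ?addr_ge0//; lra.
  by rewrite powRM// ler_wpM2l ?powR_ge0// lerDr powR_ge0.
have [ab|/ltW ba] := leP a b; first exact: main.
by rewrite addrC [X in _ <= _ * X]addrC; exact: main.
Qed.

Lemma powR_sum_le (I : Type) (s : seq I) (y : I -> R) (r : R) : 0 < r -> (forall i, 0 <= y i) ->
  (\sum_(i <- s) y i) `^ r <= (2 `^ r) ^+ size s * \sum_(i <- s) y i `^ r.
Proof.
move=> r0 y0; elim: s => [|i s IHs].
  by rewrite !big_nil powR0 ?gt_eqF// mulr0.
have S0 : 0 <= \sum_(i <- s) y i by apply: sumr_ge0 => *.
have Sr0 : 0 <= \sum_(i <- s) y i `^ r by apply: sumr_ge0 => *; exact: powR_ge0.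
have two : 1 <= 2 `^ r by have := ler_powR (ler1n R 2 : 1 <= 2) (ltW r0); rewrite powRr0.
rewrite !big_cons/= exprS -mulrA; apply: (le_trans (powRD_le _ _ (ltW r0))) => //.
rewrite ler_wpM2l ?powR_ge0// mulrDr lerD//.
by rewrite ler_peMl ?powR_ge0// exprn_ege1.
Qed.

End PowerSums.

Section TailOfSums.
Context d (T : measurableType d) (R : realType) (P : probability T R) (E : finType).
Context (X : E -> {RV P >-> R}).
Hypothesis X_indep : mutually_independent X.
Context (f : R -> R) (t : R).
Hypothesis f_meas : measurable_fun setT f.
Hypothesis f_ge0 : forall x, 0 <= f x.
Hypothesis f_0 : f 0 = 0.
Hypothesis t_gt0 : 0 < t.

(** With [S] the sum and [g] the excess to the power [t], the mean of [S * g S] is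
    expanded over the summands. In each term [g S] is compared with its value
    without the summand, which is independent of it, and with the power of the
    summand. The independent parts add up to at most [2 ^ t * mu] times the mean of
    [g S], which is what was subtracted from [S]. *)
Lemma sum_excess_le (s : seq E) (mu : R) : uniq s -> 0 <= mu ->
  (\sum_(e <- s) \int[P]_w (f (X e w))%:E <= mu%:E)%E ->
  (\int[P]_w ((Num.max (\sum_(e <- s) f (X e w) - 2 `^ t * mu) 0) `^ (t + 1))%:E <=
   (2 `^ t)%:E * \sum_(e <- s) \int[P]_w (f (X e w) `^ (t + 1))%:E)%E.
Proof.
move=> us mu0 hmu; set c := 2 `^ t; have c0 : 0 < c by rewrite powR_gt0.
have t1 : 0 < t + 1 by rewrite addr_gt0.
pose S w := \sum_(e <- s) f (X e w).
pose ex z := Num.max (z - c * mu) 0; pose g z := ex z `^ t.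
have ex0 z : 0 <= ex z by rewrite le_max lexx orbT.
have g0 z : 0 <= g z by exact: powR_ge0.
have S0 w : 0 <= S w by apply: sumr_ge0.
have mX e : measurable_fun setT (X e) by exact: measurable_funPT.
have mY e : measurable_fun setT (fun w => f (X e w)) by exact: measurableT_comp.
have mYr r e : measurable_fun setT (fun w => f (X e w) `^ r).
  by apply: (measurableT_comp (measurable_powR r)).
have mS : measurable_fun setT S by exact: measurable_sum.
have mex : measurable_fun setT ex by apply: measurable_maxr => //; exact: measurable_funB.
have mg : measurable_fun setT g by apply: (measurableT_comp (measurable_powR t)).
have mexS r : measurable_fun setT (fun w => ex (S w) `^ r).
  by apply: (measurableT_comp (measurable_powR r)); exact: measurableT_comp.
have mgS : measurable_fun setT (fun w => g (S w)) by exact: measurableT_comp.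
have Mge0 : (0 <= \sum_(e <- s) \int[P]_w (f (X e w) `^ (t + 1))%:E)%E.
  by apply: sume_ge0 => e _; apply: integral_ge0 => w _; rewrite lee_fin powR_ge0.
have [Minf|Mfin] := eqVneq (\sum_(e <- s) \int[P]_w (f (X e w) `^ (t + 1))%:E)%E +oo%E.
  by rewrite Minf gt0_muley ?leey// lte_fin.
have {Mfin} : (\sum_(e <- s) \int[P]_w (f (X e w) `^ (t + 1))%:E)%E \is a fin_num.
  by rewrite ge0_fin_numE// ltey.
set M := (\sum_(e <- s) _)%E => Mfin.
have Gfin : (\int[P]_w (g (S w))%:E)%E \is a fin_num.
  rewrite ge0_fin_numE; last by apply: integral_ge0 => w _; rewrite lee_fin.
  pose C := (2 `^ (t + 1)) ^+ size s.
  have C0 : 0 <= C by rewrite exprn_ge0// powR_ge0.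
  have mC : measurable_fun setT (fun w => C * \sum_(e <- s) f (X e w) `^ (t + 1)).
    by apply: measurable_funM => //; exact: measurable_sum.
  have s0 w : 0 <= \sum_(e <- s) f (X e w) `^ (t + 1) by apply: sumr_ge0 => *; exact: powR_ge0.
  apply: (@le_lt_trans _ _ (\int[P]_w (1 + C * \sum_(e <- s) f (X e w) `^ (t + 1))%:E)%E).
    apply: le_integral_EFin => //; first exact: measurable_funD.
    move=> w; apply: (@le_trans _ _ (1 + S w `^ (t + 1))); last first.
      by rewrite lerD2l; apply: powR_sum_le.
    apply: (@le_trans _ _ (S w `^ t)).
      apply: ler_wpowR; rewrite ?(ltW t_gt0)//.
      by rewrite ge_max S0 andbT gerBl mulr_ge0// ltW.
    have [S1|/ltW S1] := leP (S w) 1.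
      apply: (@le_trans _ _ 1); last by rewrite lerDl powR_ge0.
      by rewrite -(powR1l t); apply: ler_wpowR => //; exact: ltW.
    apply: (@le_trans _ _ (S w `^ (t + 1))); last by rewrite lerDr.
    by apply: ler_powR => //; rewrite lerDl.
  rewrite integralD_EFin//; last by move=> w; exact: mulr_ge0.
  rewrite probability_integral_cst integralZ_EFin//; last exact: measurable_sum.
  rewrite integral_sum_EFin//; last by move=> *; exact: powR_ge0.
  by rewrite -/M -(fineK Mfin) -EFinM -EFinD ltry.
have dec e w : e \in s -> S w = f (X e w) + \sum_(e' <- s) f (others X e w e').
  move=> es; rewrite /S (bigD1_seq e)//=; congr (_ + _).
  rewrite [RHS](bigD1_seq e)//= {1}/others /upd eqxx f_0 add0r.
  by apply: eq_bigr => e' /negbTE; rewrite /others /upd => ->.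
pose So e w := \sum_(e' <- s) f (others X e w e').
have mSo e : measurable_fun setT (So e).
  by apply: measurable_sum => e'; apply: measurableT_comp => //; exact: measurable_others.
have So0 e w : 0 <= So e w by apply: sumr_ge0.
have mgSo e : measurable_fun setT (fun w => g (So e w)) by exact: measurableT_comp.
have exmono u v : u <= v -> ex u <= ex v.
  by move=> uv; rewrite /ex ge_max !le_max lerD2r uv lexx orbT.
have ge_g e w : e \in s -> g (So e w) <= g (S w).
  move=> es; apply: ler_wpowR; rewrite ?(ltW t_gt0)//; apply: exmono.
  by rewrite (dec e w es) lerDr.
have gS e w : e \in s -> f (X e w) * g (S w) <=
    c * (f (X e w) * g (So e w) + f (X e w) `^ (t + 1)).
  move=> es; rewrite powRD; last by rewrite gt_eqF.
  rewrite powRr1// [X in _ * (_ + X)]mulrC -mulrDr mulrCA ler_wpM2l//.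
  apply: le_trans (powRD_le _ _ (ltW t_gt0)) => //.
  apply: ler_wpowR; rewrite ?(ltW t_gt0)// (dec e w es) /ex ge_max; apply/andP; split.
    have : So e w - c * mu <= Num.max (So e w - c * mu) 0 by rewrite le_max lexx.
    by rewrite -/(So e w); move: (Num.max _ _) => v; lra.
  exact: addr_ge0 (ex0 _) (f_ge0 _).
have exE w : ex (S w) `^ (t + 1) + c * mu * g (S w) = S w * g (S w).
  have [h|h] := leP (S w - c * mu) 0.
    by rewrite /g /ex (max_r h) !powR0 ?gt_eqF// !mulr0 addr0.
  rewrite powRD; last by rewrite gt_eqF.
  by rewrite powRr1// -/(g _) mulrC -mulrDl /ex (max_l (ltW h)) subrK.
have cmu0 : 0 <= c * mu by rewrite mulr_ge0// ltW.
have key : (\int[P]_w (ex (S w) `^ (t + 1) + c * mu * g (S w))%:E <=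
  \int[P]_w (\sum_(e <- s) c * (f (X e w) * g (So e w) + f (X e w) `^ (t + 1)))%:E)%E.
  apply: le_integral_EFin.
  - by apply: measurable_funD => //; exact: measurable_funM.
  - apply: measurable_sum => e; apply: measurable_funM => //; apply: measurable_funD => //.
    exact: measurable_funM.
  - by move=> w; rewrite addr_ge0 ?powR_ge0// mulr_ge0.
  move=> w; rewrite exE mulr_suml big_seq [leRHS]big_seq; apply: ler_sum => e es; exact: gS.
move: key; rewrite integralD_EFin//; last 3 first.
- exact: measurable_funM.
- by move=> w; exact: powR_ge0.
- by move=> w; rewrite mulr_ge0.
rewrite (integralZ_EFin P cmu0 mgS)// integral_sum_EFin; last 2 first.
- move=> e; apply: measurable_funM => //; apply: measurable_funD => //.
  exact: measurable_funM.
- by move=> e w; rewrite mulr_ge0 ?(ltW c0)// addr_ge0 ?powR_ge0// mulr_ge0.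
have term e : e \in s ->
  (\int[P]_w (c * (f (X e w) * g (So e w) + f (X e w) `^ (t + 1)))%:E <=
   c%:E * (\int[P]_w (f (X e w))%:E * \int[P]_w (g (S w))%:E +
     \int[P]_w (f (X e w) `^ (t + 1))%:E))%E.
  move=> es; have mYg : measurable_fun setT (fun w => f (X e w) * g (So e w)) by exact: measurable_funM.
  rewrite integralZ_EFin ?(ltW c0)//; last 2 first.
  - exact: measurable_funD.
  - by move=> w; rewrite addr_ge0 ?powR_ge0// mulr_ge0.
  rewrite integralD_EFin//; last 2 first.
  - by move=> w; rewrite mulr_ge0.
  - by move=> w; exact: powR_ge0.
  apply: lee_wpmul2l; first by rewrite lee_fin ltW.
  apply: leeD => //.
  have mh : measurable_fun setT (fun u => g (\sum_(e' <- s) f (unpack u e'))).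
    apply: measurableT_comp => //; apply: measurable_sum => e'; apply: measurableT_comp => //.
    exact: measurable_unpack.
  have := ge0_integral_indep X_indep e f_meas (h := fun u => g (\sum_(e' <- s) f (u e'))) mh f_ge0.
  move=> /(_ (fun u => g0 _)) ->; apply: lee_wpmul2l.
    by apply: integral_ge0 => w _; rewrite lee_fin.
  apply: (@le_integral_EFin _ T R P (fun w => g (So e w)) (fun w => g (S w)) (mgSo e) mgS) => w //.
  exact: (ge_g e w es).
set G := (\int[P]_w (g (S w))%:E)%E in Gfin term *.
have G0 : (0 <= G)%E by apply: integral_ge0 => w _; rewrite lee_fin.
move=> /le_trans h; have {h} : (\int[P]_w (ex (S w) `^ (t + 1))%:E + (c * mu)%:E * G <=
    c%:E * (mu%:E * G + M))%E.
  apply: h; apply: (@le_trans _ _ (c%:E * ((\sum_(e <- s) \int[P]_w (f (X e w))%:E) * G + M))%E).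
    rewrite ge0_sume_distrl; last by move=> e _; apply: integral_ge0 => w _; rewrite lee_fin.
    rewrite /M -big_split/= ge0_sume_distrr; last first.
      move=> e _; apply: adde_ge0.
        by apply: mule_ge0 => //; apply: integral_ge0 => w _; rewrite lee_fin.
      by apply: integral_ge0 => w _; rewrite lee_fin powR_ge0.
    by rewrite big_seq [X in (_ <= X)%E]big_seq; apply: lee_sum => e es; exact: term.
  apply: lee_wpmul2l; first by rewrite lee_fin ltW.
  by apply: leeD => //; exact: lee_wpmul2r.
rewrite -(fineK Gfin) -(fineK Mfin) -!EFinM.

rewrite (_ : c * (mu * fine G + fine M) = c * fine M + c * mu * fine G); last by ring.
by rewrite EFinD leeD2rE.
Qed.

Lemma sum_excess_inj_le (J : finType) (phi : J -> E) (mu : R) : injective phi -> 0 <= mu ->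
  (\sum_j \int[P]_w (f (X (phi j) w))%:E <= mu%:E)%E ->
  (\int[P]_w ((Num.max (\sum_j f (X (phi j) w) - 2 `^ t * mu) 0) `^ (t + 1))%:E <=
   (2 `^ t)%:E * \sum_j \int[P]_w (f (X (phi j) w) `^ (t + 1))%:E)%E.
Proof.
move=> phi_inj mu0 hmu; pose s := [seq phi j | j <- index_enum J].
have us : uniq s by rewrite map_inj_uniq ?index_enum_uniq.
have := @sum_excess_le s mu us mu0; rewrite /s !big_map => /(_ hmu).
by under eq_integral do rewrite big_map.
Qed.

End TailOfSums.

(** * The expected norm of a random matrix *)

Section RandomMatrix.
Context {R : realType} (al be : R).
Hypothesis al_ge2 : 2 <= al.
Hypothesis be_ge2 : 2 <= be.
Let s2 := 2 * Num.max al be.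
Let al0 : 0 < al. Proof. exact: lt_le_trans al_ge2. Qed.
Let be0 : 0 < be. Proof. exact: lt_le_trans be_ge2. Qed.
Let s20 : 0 < s2. Proof. by rewrite mulr_gt0// lt_max al0. Qed.
Let p := al / (al - 1).
Let p0 : 0 < p. Proof. by rewrite divr_gt0// subr_gt0 (lt_le_trans _ al_ge2)// ltr1n. Qed.
Let be1 : 1 < be. Proof. by rewrite (lt_le_trans _ be_ge2)// ltr1n. Qed.

(** The part of each row sum up to [c] times its mean is deterministic; the excess
    is at most the [s2 / r]-th root of the sum [V] of all the excesses. *)
Lemma excess_row (I J : finType) (x : I -> J -> R) (r c a V : R) : 2 <= r -> r < s2 -> 1 <= c -> 0 <= a ->
  \sum_i Num.max (\sum_j `|x i j| `^ r - c * a `^ r) 0 `^ (s2 / r) <= V ->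
  forall i, \sum_j `|2 * x i j| `^ r <= (4 * (c * a + V `^ s2^-1)) `^ r.
Proof.
move=> r2 rs c1 a0 hV i.
have r0 : 0 < r by exact: lt_le_trans r2.
have z0 : 0 <= Num.max (\sum_j `|x i j| `^ r - c * a `^ r) 0 by rewrite le_max lexx orbT.
have zV : Num.max (\sum_j `|x i j| `^ r - c * a `^ r) 0 `^ (s2 / r) <= V.
  apply: le_trans hV; rewrite (bigD1 i)//= lerDl; apply: sumr_ge0 => *; exact: powR_ge0.
have V0 : 0 <= V by exact: le_trans (powR_ge0 _ _) zV.
set Y := V `^ s2^-1; have Y0 : 0 <= Y by exact: powR_ge0.
have zY : Num.max (\sum_j `|x i j| `^ r - c * a `^ r) 0 <= Y `^ r.
  have -> : Y `^ r = V `^ (r / s2) by rewrite /Y -powRrM mulrC.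
  apply: le_trans (ler_wpowR (ltW (divr_gt0 r0 s20)) (powR_ge0 _ _) zV).
  by rewrite -powRrM mulrA divfK ?gt_eqF// divff ?gt_eqF// powRr1.
have ca : c * a `^ r <= (c * a) `^ r.
  rewrite powRM// ?(le_trans ler01)// ler_wpM2r ?powR_ge0//.
  rewrite -[leLHS]powRr1 ?(le_trans ler01)//; apply: ler_powR => //.
  by apply: le_trans r2; rewrite ler1n.
have ca0 : 0 <= c * a by rewrite mulr_ge0// (le_trans ler01).
under eq_bigr do rewrite normrM (ger0_norm (ler0n _ 2)) powRM//.
rewrite -mulr_sumr -[4](_ : 2 * 2 = _); last by ring.
rewrite -mulrA [leRHS]powRM ?mulr_ge0 ?addr_ge0// ler_wpM2l ?powR_ge0//.
rewrite powRM ?addr_ge0//.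
have h1 : (c * a) `^ r <= (c * a + Y) `^ r by apply: ler_wpowR; rewrite ?(ltW r0)// lerDl.
have h2 : Y `^ r <= (c * a + Y) `^ r by apply: ler_wpowR; rewrite ?(ltW r0)// lerDr.
have h3 : 2 <= 2 `^ r.
  rewrite -[leLHS]powRr1//; apply: ler_powR; first by rewrite ler1n.
  by apply: le_trans r2; rewrite ler1n.
have h4 : \sum_j `|x i j| `^ r - c * a `^ r <= Y `^ r.
  by apply: le_trans zY; rewrite le_max lexx.
apply: (@le_trans _ _ (2 * (c * a + Y) `^ r)); first lra.
by rewrite ler_wpM2r ?powR_ge0.
Qed.

(** Tangent-like bound for the concave root: the expectation of the root needs only
    the expectation of [V]. *)
Lemma root_le_linear (V T0 G : R) : 0 < T0 -> T0 <= V -> G `^ s2 = T0 -> 0 < G -> 1 <= s2 ->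
  V `^ s2^-1 <= G / T0 * V.
Proof.
move=> T00 TV GT G0 s21.
have GE : G = T0 `^ s2^-1 by rewrite -GT -powRrM divff ?gt_eqF// powRr1// ltW.
have VT : 1 <= V / T0 by rewrite ler_pdivlMr// mul1r.
have -> : V = T0 * (V / T0) by rewrite mulrC divfK ?gt_eqF.
rewrite powRM ?(ltW T00)// ?(le_trans ler01)// -GE.
rewrite -mulrA ler_wpM2l ?(ltW G0)// mulrA mulVf ?gt_eqF// mul1r.
rewrite -[leRHS]powRr1 ?(le_trans ler01)//; apply: ler_powR => //.
by rewrite invf_le1.
Qed.

(** The deterministic bound is applied to every realization of the matrix with the
    random size [S], whose mean is bounded by [sum_excess_le]. *)
Lemma expectation_opnorm_bound : exists2 C : R, 0 < C &
  forall (m n : nat) (d : measure_display) (T : measurableType d) (P : probability T R)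
    (X : 'I_m -> 'I_n -> {RV P >-> R}) (a b G : R),
  mutually_independent (fun ij : 'I_m * 'I_n => X ij.1 ij.2) ->
  (forall i j, centered (X i j)) -> 0 <= a -> 0 <= b -> 0 <= G ->
  (forall i, \sum_j \int[P]_w (`|X i j w| `^ al)%:E <= (a `^ al)%:E)%E ->
  (forall j, \sum_i \int[P]_w (`|X i j w| `^ be)%:E <= (b `^ be)%:E)%E ->
  (\sum_i \sum_j \int[P]_w (`|X i j w| `^ s2)%:E <= (G `^ s2)%:E)%E ->
  (\int[P]_w (opnorm p%:E be%:E (\matrix_(i, j) X i j w))%:E <= (C * (a + b + G))%:E)%E.
Proof.
have [C C0 hC] := sign_opnorm_bound al_ge2 be_ge2.
have al_s : al < s2.
  have : al <= Num.max al be by rewrite le_max lexx.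
  by rewrite /s2; move: (Num.max al be) al0 => mx; lra.
have be_s : be < s2.
  have : be <= Num.max al be by rewrite le_max lexx orbT.
  by rewrite /s2; move: (Num.max al be) be0 => mx; lra.
pose ta := s2 / al - 1; pose tb := s2 / be - 1.
have ta0 : 0 < ta by rewrite subr_gt0 ltr_pdivlMr// mul1r.
have tb0 : 0 < tb by rewrite subr_gt0 ltr_pdivlMr// mul1r.
pose ca := 2 `^ ta; pose cb := 2 `^ tb.
have ca1 : 1 <= ca by have := ler_powR (ler1n R 2 : 1 <= 2) (ltW ta0); rewrite powRr0.
have cb1 : 1 <= cb by have := ler_powR (ler1n R 2 : 1 <= 2) (ltW tb0); rewrite powRr0.
pose c := ca + cb + 2.
exists (C * (4 * c) + 1).
  by rewrite ltr_wpDl// !mulr_ge0// /c; lra.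
move=> m n d T P X a b G X_indep X_cent a0 b0 G0 hrow hcol htot.
pose E := ('I_m * 'I_n)%type.
pose Xe (e : E) := X e.1 e.2.
have Xe_cent e : centered (Xe e) by exact: X_cent.
pose Phi (x : E -> R) := opnorm p%:E be%:E (\matrix_(i, j) x (i, j)).
have PP : convex_lipschitz 1 Phi by exact: opnorm_convex_lipschitz.
apply: (@le_trans _ _ (\int[P]_w (Phi (Xe ^~ w))%:E)%E); first by [].
apply: (le_trans (symmetrization X_indep Xe_cent ler01 PP)).
apply/lee_addgt0Pr => eps eps0.
have c0 : 0 < C * (4 * c) + 1 by rewrite ltr_wpDl// !mulr_ge0// /c; lra.
pose G' := G + eps / (C * (4 * c) + 1).
have G'0 : 0 < G' by rewrite ltr_wpDl// divr_gt0.
pose T0 := G' `^ s2.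
have T00 : 0 < T0 by rewrite powR_gt0.
(* excesses of the row and column sums; [T0] keeps their sum [V] away from 0, where
   the root is steep *)
pose ZA w := \sum_i Num.max (\sum_j `|X i j w| `^ al - ca * a `^ al) 0 `^ (s2 / al).
pose ZB w := \sum_j Num.max (\sum_i `|X i j w| `^ be - cb * b `^ be) 0 `^ (s2 / be).
pose ZG w := \sum_i \sum_j `|X i j w| `^ s2.
have ZA0 w : 0 <= ZA w by apply: sumr_ge0 => *; exact: powR_ge0.
have ZB0 w : 0 <= ZB w by apply: sumr_ge0 => *; exact: powR_ge0.
have ZG0 w : 0 <= ZG w by apply: sumr_ge0 => *; apply: sumr_ge0 => *; exact: powR_ge0.
pose V w := ZA w + (ZB w + (ZG w + T0)).
have VT w : T0 <= V w by rewrite /V; have := ZA0 w; have := ZB0 w; have := ZG0 w; lra.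
have V0 w : 0 < V w by exact: lt_le_trans (VT w).
pose S w := 4 * (ca * a + cb * b + V w `^ s2^-1).
have Y0 w : 0 < V w `^ s2^-1 by rewrite powR_gt0.
have caa : 0 <= ca * a by rewrite mulr_ge0// (le_trans ler01).
have cbb : 0 <= cb * b by rewrite mulr_ge0// (le_trans ler01).
have mX i j : measurable_fun setT (X i j) by exact: measurable_funPT.
have mpow r i j : measurable_fun setT (fun w => `|X i j w| `^ r).
  by apply: (measurableT_comp (measurable_powR r)); exact: measurableT_comp.
have mex r q (x : T -> R) : measurable_fun setT x ->
   measurable_fun setT (fun w => Num.max (x w - q) 0 `^ r).
  move=> mx; apply: (measurableT_comp (measurable_powR r)); apply: measurable_maxr => //.
  exact: measurable_funB.
have mexA i : measurable_fun setT
    (fun w => Num.max (\sum_j `|X i j w| `^ al - ca * a `^ al) 0 `^ (s2 / al)).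
  by apply: mex; exact: measurable_sum.
have mexB j : measurable_fun setT
    (fun w => Num.max (\sum_i `|X i j w| `^ be - cb * b `^ be) 0 `^ (s2 / be)).
  by apply: mex; exact: measurable_sum.
have mZA : measurable_fun setT ZA by exact: measurable_sum.
have mZB : measurable_fun setT ZB by exact: measurable_sum.
have mZG : measurable_fun setT ZG by apply: measurable_sum => i; exact: measurable_sum.
have mV2 : measurable_fun setT (fun w => ZG w + T0) by exact: measurable_funD.
have mV1 : measurable_fun setT (fun w => ZB w + (ZG w + T0)) by exact: measurable_funD.
have mV : measurable_fun setT V by exact: measurable_funD.
have pointwise w : avg (fun v : {ffun E -> bool} => Phi (fun e => 2 * sg v e * Xe e w)) <= C * S w.
  have -> : avg (fun v : {ffun E -> bool} => Phi (fun e => 2 * sg v e * Xe e w)) =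
     avg (fun v => opnorm p%:E be%:E (signed (\matrix_(i, j) (2 * X i j w)) v)).
    apply: eq_avg => v; rewrite /Phi; congr opnorm; apply/matrixP => i j; rewrite !mxE /Xe/=.
    by rewrite mulrA [X in X * _]mulrC.
  have S0 : 0 < S w by rewrite /S mulr_gt0//; have := Y0 w; lra.
  apply: hC => //.
  - move=> i; under eq_bigr do rewrite mxE.
    have hV : ZA w <= V w by rewrite /V lerDl; have := ZB0 w; have := ZG0 w; lra.
    apply: (le_trans (@excess_row _ _ (fun i j => X i j w) _ _ _ _ al_ge2 al_s ca1 a0 hV i)).
    apply: ler_wpowR; rewrite ?(ltW al0)// /S; first by rewrite mulr_ge0// addr_ge0// ltW.
    lra.
  - move=> j; under eq_bigr do rewrite mxE.
    have hV : ZB w <= V w by rewrite /V; have := ZA0 w; have := ZG0 w; lra.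
    apply: (le_trans (@excess_row _ _ (fun j i => X i j w) _ _ _ _ be_ge2 be_s cb1 b0 hV j)).
    apply: ler_wpowR; rewrite ?(ltW be0)// /S; first by rewrite mulr_ge0// addr_ge0// ltW.
    lra.
  - apply: (@le_trans _ _ ((2 * V w `^ s2^-1) `^ s2)).
      rewrite powRM ?(ltW (Y0 w))// -powRrM mulVf ?gt_eqF// powRr1 ?(ltW (V0 w))//.
      apply: (@le_trans _ _ (2 `^ s2 * ZG w)).
        rewrite /ZG mulr_sumr; apply: ler_sum => i _; rewrite mulr_sumr; apply: ler_sum => j _.
        by rewrite mxE normrM (ger0_norm (ler0n _ 2)) powRM.
      by rewrite ler_wpM2l ?powR_ge0// /V; have := ZA0 w; have := ZB0 w; lra.
    apply: ler_wpowR; rewrite ?(ltW s20)//; first by rewrite mulr_ge0// ltW.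
    by rewrite /S; have := Y0 w; lra.
have lin w : C * S w <= C * (4 * (ca * a + cb * b)) + C * (4 * (G' / T0)) * V w.
  rewrite -mulrA -mulrDr ler_wpM2l// /S mulrDr lerD2l -mulrA ler_wpM2l//.
  by apply: root_le_linear => //; apply: ltW; apply: lt_trans al_s; rewrite (lt_le_trans _ al_ge2)// ltr1n.
have L0 : 0 <= C * (4 * (G' / T0)) by rewrite mulr_ge0// mulr_ge0// divr_ge0 ?(ltW G'0) ?(ltW T00).
have K0 : 0 <= C * (4 * (ca * a + cb * b)) by rewrite !mulr_ge0// addr_ge0.
have PPavg : convex_lipschitz (1 * 2) (fun x : E -> R =>
    avg (fun v : {ffun E -> bool} => Phi (fun e => 2 * sg v e * x e))).
  apply: convex_lipschitz_avg => v; apply: convex_lipschitz_scale => // e.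
  by rewrite normrM normr_sg1 mulr1 ger0_norm.
apply: (@le_trans _ _ (\int[P]_w (C * (4 * (ca * a + cb * b)) + C * (4 * (G' / T0)) * V w)%:E)%E).
  apply: le_integral_EFin.
  - by apply: (convex_lipschitz_measurable PPavg) => e; exact: mX.
  - by apply: measurable_funD => //; exact: measurable_funM.
  - by move=> w; case: PPavg.
  - by move=> w; exact: le_trans (pointwise w) (lin w).
have Zsum : (\int[P]_w (V w)%:E <= (c * T0)%:E)%E.
  rewrite integralD_EFin//; last by move=> w; rewrite !addr_ge0// ltW.
  rewrite integralD_EFin//; last by move=> w; rewrite addr_ge0// ltW.
  rewrite integralD_EFin//; last by move=> w; exact: ltW.
  rewrite probability_integral_cst.
  have htot' : (\sum_i \sum_j \int[P]_w (`|X i j w| `^ s2)%:E <= T0%:E)%E.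
    apply: (le_trans htot); rewrite lee_fin; apply: ler_wpowR; rewrite ?(ltW s20)//.
    by rewrite lerDl divr_ge0// ltW.
  have hZG : (\int[P]_w (ZG w)%:E <= T0%:E)%E.
    rewrite integral_sum_EFin.
    - apply: le_trans htot'; rewrite le_eqVlt; apply/orP; left; apply/eqP.
      by apply: eq_bigr => i _; rewrite integral_sum_EFin// => *; exact: powR_ge0.
    - by move=> i; exact: measurable_sum.
    - by move=> i w; apply: sumr_ge0 => *; exact: powR_ge0.
  have mabs r : measurable_fun setT (fun x : R => `|x| `^ r).
    by apply: (measurableT_comp (measurable_powR r)).
  have hZA : (\int[P]_w (ZA w)%:E <= (ca * T0)%:E)%E.
    rewrite integral_sum_EFin//; last by move=> *; exact: powR_ge0.
    apply: (@le_trans _ _ (\sum_i ca%:E * \sum_j \int[P]_w (`|X i j w| `^ s2)%:E)%E).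
      apply: lee_sum => i _.
      have inj : injective (fun j : 'I_n => (i, j)) by move=> j1 j2 /= [->].
      have f0 : `|0 : R| `^ al = 0 by rewrite normr0 powR0// gt_eqF.
      have h := @sum_excess_inj_le _ T R P _ Xe X_indep (fun x => `|x| `^ al) ta (mabs al)
        (fun x => powR_ge0 _ _) f0 ta0 _ (fun j => (i, j)) (a `^ al) inj (powR_ge0 _ _)
        (hrow i).
      apply: le_trans; last first.
        apply: (le_trans h); apply: lee_wpmul2l; first by rewrite lee_fin powR_ge0.
        apply: lee_sum => j _; rewrite le_eqVlt; apply/orP; left; apply/eqP.
        by apply: eq_integral => w _; rewrite -powRrM subrK mulrCA divff ?mulr1// gt_eqF.
      by rewrite le_eqVlt; apply/orP; left; apply/eqP; rewrite subrK.
    rewrite -ge0_sume_distrr; last first.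
      by move=> i _; apply: sume_ge0 => j _; apply: integral_ge0 => w _; rewrite lee_fin powR_ge0.
    by rewrite EFinM; apply: lee_wpmul2l => //; rewrite lee_fin (le_trans ler01).
  have hZB : (\int[P]_w (ZB w)%:E <= (cb * T0)%:E)%E.
    rewrite integral_sum_EFin//; last by move=> *; exact: powR_ge0.
    apply: (@le_trans _ _ (\sum_j cb%:E * \sum_i \int[P]_w (`|X i j w| `^ s2)%:E)%E).
      apply: lee_sum => j _.
      have inj : injective (fun i : 'I_m => (i, j)) by move=> i1 i2 /= [->].
      have f0 : `|0 : R| `^ be = 0 by rewrite normr0 powR0// gt_eqF.
      have h := @sum_excess_inj_le _ T R P _ Xe X_indep (fun x => `|x| `^ be) tb (mabs be)
        (fun x => powR_ge0 _ _) f0 tb0 _ (fun i => (i, j)) (b `^ be) inj (powR_ge0 _ _)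
        (hcol j).
      apply: le_trans; last first.
        apply: (le_trans h); apply: lee_wpmul2l; first by rewrite lee_fin powR_ge0.
        apply: lee_sum => i _; rewrite le_eqVlt; apply/orP; left; apply/eqP.
        by apply: eq_integral => w _; rewrite -powRrM subrK mulrCA divff ?mulr1// gt_eqF.
      by rewrite le_eqVlt; apply/orP; left; apply/eqP; rewrite subrK.
    rewrite -ge0_sume_distrr; last first.
      by move=> j _; apply: sume_ge0 => i _; apply: integral_ge0 => w _; rewrite lee_fin powR_ge0.
    rewrite exchange_big EFinM; apply: lee_wpmul2l => //; rewrite lee_fin (le_trans ler01)//.
  apply: (le_trans (leeD hZA (leeD hZB (leeD hZG (lexx _))))).
  by rewrite -!EFinD lee_fin /c; lra.
rewrite integralD_EFin//; last 2 first.
- exact: measurable_funM.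
- by move=> w; apply: mulr_ge0 => //; exact: ltW.
rewrite probability_integral_cst integralZ_EFin//; last by move=> w; exact: ltW.
apply: (@le_trans _ _ ((C * (4 * (ca * a + cb * b)))%:E + (C * (4 * (G' / T0)))%:E * (c * T0)%:E)%E).
  by apply: leeD => //; apply: lee_wpmul2l => //; rewrite lee_fin.
rewrite -EFinM -!EFinD lee_fin.
have -> : C * (4 * (G' / T0)) * (c * T0) = C * (4 * c) * G' by field; rewrite gt_eqF.
have epsE : (C * (4 * c) + 1) * G' = (C * (4 * c) + 1) * G + eps.
  by rewrite /G' mulrDr [X in _ + X]mulrC divfK ?gt_eqF.
have h1 : C * (4 * c) * G' <= (C * (4 * c) + 1) * G' by rewrite ler_wpM2r ?(ltW G'0)// lerDl.
have h2 : C * (4 * (ca * a + cb * b)) <= C * (4 * c) * (a + b).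
  rewrite -mulrA ler_wpM2l// -mulrA ler_wpM2l// /c.
  have := mulr_ge0 (le_trans ler01 ca1) b0; have := mulr_ge0 (le_trans ler01 cb1) a0; lra.
have : 0 <= a + b by rewrite addr_ge0.
lra.
Qed.

End RandomMatrix.

Lemma le_poweR_inv (R : realType) (y : \bar R) (r a : R) : 0 < r -> (0 <= y)%E ->
  (y `^ r^-1 <= a%:E)%E -> (y <= (a `^ r)%:E)%E.
Proof.
move=> r0 y0 ya; rewrite -[y]poweRe1// -[1](@mulVf _ r) ?gt_eqF// poweRrM -poweR_EFin.
have yr0 : (0 <= y `^ r^-1)%E by exact: poweR_ge0.
by apply: gt0_ler_poweR => //; rewrite ?ltW// in_itv/= ?leey ?andbT// (le_trans yr0).
Qed.

Lemma hoelder_conjugate_real (R : realType) (p : \bar R) (al : R) : 2 <= al ->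
  hoelder_conjugate p = al%:E -> p = (al / (al - 1))%:E.
Proof.
move=> al2 pal; rewrite -[p]hoelder_conjugateK pal /hoelder_conjugate/=.
have al0 : al != 0 by rewrite gt_eqF// (lt_le_trans _ al2).
have al1 : al - 1 != 0 by rewrite gt_eqF// subr_gt0 (lt_le_trans _ al2)// ltr1n.
by rewrite eqe (negbTE al0) -EFinB inver (negbTE al1).
Qed.

Section OpnormBound.
Local Open Scope ereal_scope.

(** The form from which both estimates follow. When a term on the right is infinite
    there is nothing to prove. *)
Lemma expectation_opnorm_le (R : realType) (p : \bar R) (al be : R) : (2 <= al)%R -> (2 <= be)%R ->
  hoelder_conjugate p = al%:E ->
  exists2 C : R, (0 < C)%R &
  forall (m n : nat) (d : measure_display) (T : measurableType d) (P : probability T R)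
    (X : 'I_m -> 'I_n -> {RV P >-> R}),
  mutually_independent (fun ij : 'I_m * 'I_n => X ij.1 ij.2) ->
  (forall i j, centered (X i j)) ->
  'E_P[fun w => opnorm p be%:E (\matrix_(i < m, j < n) X i j w)%R] <= C%:E *
  (\big[maxe/0]_(i < m) (\sum_(j < n) 'E_P[fun w => (`|X i j w| `^ al)%R]) `^ al^-1
   + \big[maxe/0]_(j < n) (\sum_(i < m) 'E_P[fun w => (`|X i j w| `^ be)%R]) `^ be^-1
   + (\sum_(i < m) \sum_(j < n) 'E_P[fun w => (`|X i j w| `^ (2 * Num.max al be))%R])
       `^ (2 * Num.max al be)^-1).
Proof.
move=> al2 be2 /(hoelder_conjugate_real al2) ->.
have [C C0 hC] := expectation_opnorm_bound al2 be2; exists C => // m n d T P X X_indep X_cent.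
have al0 : (0 < al)%R by exact: lt_le_trans al2.
have be0 : (0 < be)%R by exact: lt_le_trans be2.
set s2 := (2 * Num.max al be)%R in hC *.
have s20 : (0 < s2)%R by rewrite mulr_gt0// lt_max al0.
have EE (f : T -> R) : 'E_P[f] = \int[P]_w (f w)%:E by rewrite unlock.
have Eabs0 r i j : 0 <= 'E_P[fun w => (`|X i j w| `^ r)%R].
  by rewrite EE; apply: integral_ge0 => w _; rewrite lee_fin powR_ge0.
set A := \big[maxe/0]_i _; set B := \big[maxe/0]_j _; set G := (\sum_i _) `^ _.
have A0 : 0 <= A by exact: bigmax_ge_id.
have B0 : 0 <= B by exact: bigmax_ge_id.
have G0 : 0 <= G by exact: poweR_ge0.
have nNy (x : \bar R) : 0 <= x -> x != -oo by move=> x0; rewrite gt_eqF// (lt_le_trans ltNy0).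
have Ny (x : \bar R) : 0 <= x -> x \isn't a fin_num -> x = +oo.
  by move=> x0; rewrite ge0_fin_numE// -leNgt leye_eq => /eqP.
have Cy : C%:E * +oo = +oo by rewrite gt0_muley// lte_fin.
have AB0 : 0 <= A + B by exact: adde_ge0.
have [Afin|h] := boolP (A \is a fin_num); last first.
  by rewrite (Ny _ A0 h) addye ?nNy// addye ?nNy// Cy leey.
have [Bfin|h] := boolP (B \is a fin_num); last first.
  by rewrite (Ny _ B0 h) addey ?nNy// addye ?nNy// Cy leey.
have [Gfin|h] := boolP (G \is a fin_num); last first.
  by rewrite (Ny _ G0 h) addey ?nNy// Cy leey.
rewrite -(fineK Afin) -(fineK Bfin) -(fineK Gfin) -!EFinD -EFinM EE.
apply: hC => //.
- exact: fine_ge0.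
- exact: fine_ge0.
- exact: fine_ge0.
- move=> i; under eq_bigr do rewrite -EE.
  apply: le_poweR_inv => //; first by apply: sume_ge0.
  by rewrite fineK//; apply: (le_bigmax _ (fun i => (\sum_j 'E_P[fun w => (`|X i j w| `^ al)%R]) `^ al^-1)).
- move=> j; under eq_bigr do rewrite -EE.
  apply: le_poweR_inv => //; first by apply: sume_ge0.
  by rewrite fineK//; apply: (le_bigmax _ (fun j => (\sum_i 'E_P[fun w => (`|X i j w| `^ be)%R]) `^ be^-1)).
- under eq_bigr do under eq_bigr do rewrite -EE.
  apply: le_poweR_inv => //; last by rewrite fineK.
  by apply: sume_ge0 => i _; apply: sume_ge0.
Qed.

End OpnormBound.

Theorem corollary14 (R : realType) (p : \bar R) (pstar q : R)
    (p_ge1 : (1 <= p)%E) (p_conj : hoelder_conjugate p = pstar%:E)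
    (pstar_ge2 : 2 <= pstar) (q_ge2 : 2 <= q) :
  (exists C : R, 0 < C /\
    forall (m n : nat) (d : measure_display) (T : measurableType d)
      (P : probability T R) (X : 'I_m -> 'I_n -> {RV P >-> R}),
    mutually_independent (fun ij : 'I_m * 'I_n => X ij.1 ij.2) ->
    (forall i j, centered (X i j)) ->
    ('E_P[fun w => opnorm p q%:E (\matrix_(i < m, j < n) X i j w)] <=
     C%:E *
     (\big[maxe/0]_(i < m)
         (\sum_(j < n) 'E_P[fun w => (`|X i j w| `^ pstar)%R]) `^ pstar^-1
      + \big[maxe/0]_(j < n)
         (\sum_(i < m) 'E_P[fun w => (`|X i j w| `^ q)%R]) `^ q^-1
      + (\sum_(i < m)
           (\sum_(j < n) 'E_P[fun w => (`|X i j w| `^ (2 * pstar))%R])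
             `^ (Num.max pstar q / pstar))
          `^ (2 * Num.max pstar q)^-1
      + (\sum_(j < n)
           (\sum_(i < m) 'E_P[fun w => (`|X i j w| `^ (2 * q))%R])
             `^ (Num.max pstar q / q))
          `^ (2 * Num.max pstar q)^-1))%E)
  /\
  (exists C : R, 0 < C /\
    forall (m n : nat) (d : measure_display) (T : measurableType d)
      (P : probability T R) (X : 'I_m -> 'I_n -> {RV P >-> R}),
    mutually_independent (fun ij : 'I_m * 'I_n => X ij.1 ij.2) ->
    (forall i j, centered (X i j)) ->
    ('E_P[fun w => opnorm p q%:E (\matrix_(i < m, j < n) X i j w)] <=
     C%:E *
     (\big[maxe/0]_(i < m)
         (\sum_(j < n) 'E_P[fun w => (`|X i j w| `^ pstar)%R]) `^ pstar^-1
      + \big[maxe/0]_(j < n)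
         (\sum_(i < m) 'E_P[fun w => (`|X i j w| `^ q)%R]) `^ q^-1
      + (\sum_(i < m) \sum_(j < n)
           'E_P[fun w => (`|X i j w| `^ (2 * pstar))%R]) `^ (2 * pstar)^-1
      + (\sum_(i < m) \sum_(j < n)
           'E_P[fun w => (`|X i j w| `^ (2 * q))%R]) `^ (2 * q)^-1))%E).
Proof.
have p0 : 0 < pstar by exact: lt_le_trans pstar_ge2.
have q0 : 0 < q by exact: lt_le_trans q_ge2.
have [C C0 hC] := expectation_opnorm_le pstar_ge2 q_ge2 p_conj.
have absE0 d (T : measurableType d) (P : probability T R) (Y : T -> R) r :
    (0 <= 'E_P[fun w => (`|Y w| `^ r)%R])%E.
  by apply: expectation_ge0 => w; exact: powR_ge0.
split; exists C; split => // m n d T P X X_indep X_cent;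
  apply: (le_trans (hC m n d T P X X_indep X_cent)); apply: lee_wpmul2l; rewrite ?lee_fin ?(ltW C0)//.
- rewrite -[X in (_ <= X)%E]addeA leeD2l//.
  have [pq|qp] := leP q pstar.
    rewrite -[X in (X <= _)%E]adde0; apply: leeD; last exact: poweR_ge0.
    rewrite le_eqVlt; apply/orP; left; apply/eqP; congr (_ `^ _)%E; apply: eq_bigr => i _.
    by rewrite divff ?gt_eqF// poweRe1// sume_ge0.
  rewrite -[X in (X <= _)%E]add0e; apply: leeD; first exact: poweR_ge0.
  rewrite exchange_big le_eqVlt; apply/orP; left; apply/eqP; congr (_ `^ _)%E; apply: eq_bigr => j _.
  by rewrite divff ?gt_eqF// poweRe1// sume_ge0.
- rewrite -[X in (_ <= X)%E]addeA leeD2l//.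
  have [pq|qp] := leP q pstar.
    by rewrite -[X in (X <= _)%E]adde0; apply: leeD => //; exact: poweR_ge0.
  by rewrite -[X in (X <= _)%E]add0e; apply: leeD => //; exact: poweR_ge0.
Qed.
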